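(* Let $T$ and $T'$ be increasing tableaux of type B. Then the reading words of $T$ and $T'$ are weakly $K$-Knuth equivalent if and only if $T$ and $T'$ are jeu de taquin equivalent for $\Delta$.
   Context: **Type B.** Let $\Delta=\{[r,c]\in\mathbb{N}^2\mid r\le c\}$ ($\mathbb{N}=\{1,2,3,\dots\}$), with boxes $[r,c]$ in row $r$ (rows numbered top to bottom) and column $c$ (columns numbered left to right), and partial order $[r_1,c_1]\le[r_2,c_2]$ iff $r_1\le r_2$ and $c_1\le c_2$. A straight shape is a finite lower order ideal of $\Delta$ (a shifted Young diagram); a skew shape is $\nu/\lambda:=\nu\setminus\lambda$ with $\lambda\subset\nu$ straight shapes. An increasing tableau of type B is a map $T:\nu/\lambda\to\mathbb{Z}$ on a skew shape in $\Delta$ with $T(\alpha)<T(\beta)$ whenever $\alpha<\beta$. **Slides.** Two boxes of $\Delta$ are neighbors if one covers the other in $\Delta$. For a tableau $Y$ with values in a set $S$ and $s,s'\in S$, $\mathrm{swap}_{s,s'}(Y)$ is the tableau of the same shape sending $\alpha$ to $s'$ if $Y(\alpha)=s$ and $Y(\beta)=s'$ for some neighbor $\beta$ of $\alpha$; to $s$ if $Y(\alpha)=s'$ and $Y(\beta)=s$ for some neighbor $\beta$ of $\alpha$; and to $Y(\alpha)$ otherwise. If $T$ is increasing of shape $\nu/\lambda$ with values in $[a,b]$ and $C$ is a set of maximal boxes of $\lambda$, the forward slide $\mathrm{jdt}_C(T)$ is obtained by adding the boxes of $C$ filled with $\bullet$, applying $\mathrm{swap}_{a,\bullet},\mathrm{swap}_{a+1,\bullet},\dots,\mathrm{swap}_{b,\bullet}$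 in this order, and deleting all boxes containing $\bullet$. If $\widehat C$ is a set of minimal boxes of $\Delta\setminus\nu$, the reverse slide starting from $\widehat C$ is obtained by adding the boxes of $\widehat C$ filled with $\bullet$, applying $\mathrm{swap}_{b,\bullet},\mathrm{swap}_{b-1,\bullet},\dots,\mathrm{swap}_{a,\bullet}$ in this order, and deleting all boxes containing $\bullet$. The results are increasing tableaux. Two increasing tableaux are jeu de taquin equivalent for $\Delta$ if one is obtained from the other by a sequence of forward and reverse slides. **Weak $K$-Knuth equivalence.** This is the equivalence relation $\widehat\equiv$ on words of integers generated by the following, for all words $\mathbf{u},\mathbf{v}$ and integers $a,b,c$: $(\mathbf{u},a,a,\mathbf{v})\mathrel{\widehat\equiv}(\mathbf{u},a,\mathbf{v})$; $(\mathbf{u},a,b,a,\mathbf{v})\mathrel{\widehat\equiv}(\mathbf{u},b,a,b,\mathbf{v})$; $(\mathbf{u},a,b,c,\mathbf{v})\mathrel{\widehat\equiv}(\mathbf{u},a,c,b,\mathbf{v})$ if $b<a<c$; $(\mathbf{u},a,b,c,\mathbf{v})\mathrel{\widehat\equiv}(\mathbf{u},b,a,c,\mathbf{v})$ if $a<c<b$; and $(a,b,\mathbf{u})\mathrel{\widehat\equiv}(b,a,\mathbf{u})$. A reading word of an increasing tableau $T$ is any word listing the entries of the boxes of $T$ in an order in which each box $[r,c]$ appears before all other boxes $[r',c']$ of $T$ with $r'\le r$ and $c'\ge c$ (for example the row word, reading rows left to right starting with the bottom row); all reading words of a given increasing tableau are weakly $K$-Knuth equivalent to each other. *)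

(* Defs.v *)
From Stdlib Require Export Relation_Operators.
From HB Require Import structures.
From mathcomp Require Export all_boot all_order all_algebra.
From mathcomp Require Export finmap.
From mathcomp Require Import boolp zify.

Set Implicit Arguments.
Unset Strict Implicit.
Unset Printing Implicit Defensive.

Import Order.TTheory GRing.Theory Num.Theory.

Local Open Scope fset_scope.
Local Open Scope fmap_scope.

Record box := Box {
  box_val : nat * nat;
  box_valP : (0 < box_val.1) && (box_val.1 <= box_val.2)
}.

HB.instance Definition _ := [isSub for box_val].
HB.instance Definition _ := [Countable of box by <:].

Definition box_row (x : box) : nat := (box_val x).1.
Definition box_col (x : box) : nat := (box_val x).2.

Definition box_le (x y : box) : bool := (box_row x <= box_row y) && (box_col x <= box_col y).

Lemma box_le_refl : reflexive box_le.
Proof. by move=> x; rewrite /box_le !leqnn. Qed.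

Lemma box_le_anti : antisymmetric box_le.
Proof.
move=> [[r c] px] [[r' c'] py]; rewrite /box_le /box_row /box_col /= => H.
by apply: val_inj => /=; congr pair; apply: anti_leq; lia.
Qed.

Lemma box_le_trans : transitive box_le.
Proof.
move=> y x z; rewrite /box_le => /andP[h1 h2] /andP[h3 h4].
by rewrite (leq_trans h1 h3) (leq_trans h2 h4).
Qed.

Fact box_display : Order.disp_t. Proof. exact: Order.Disp tt tt. Qed.

HB.instance Definition _ :=
  Order.Le_isPOrder.Build box_display box box_le_refl box_le_anti box_le_trans.

Definition covers (x y : box) : Prop :=
  (y < x)%O /\ ~ exists z : box, (y < z)%O /\ (z < x)%O.

Definition neighbor (x y : box) : Prop := covers x y \/ covers y x.

Definition straight_shape (nu : {fset box}) : Prop :=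
  forall x y : box, (x <= y)%O -> y \in nu -> x \in nu.

(* [skew nu lambda A]: the set [A] is the skew shape nu/lambda.  A skew shape
   is just a set of boxes; it does not determine nu and lambda. *)
Definition skew (nu lambda A : {fset box}) : Prop :=
  [/\ straight_shape nu, straight_shape lambda, lambda `<=` nu
    & A = nu `\` lambda].

Definition tableau := {fmap box -> int}.

Definition increasing (T : tableau) : Prop :=
  (exists nu lambda, skew nu lambda (domf T)) /\
  forall x y : domf T, (val x < val y)%O -> (T x < T y)%R.

Definition has_values_in (T : tableau) (a b : int) : Prop :=
  forall x : domf T, (a <= T x <= b)%R.

Definition has_neighbor_valued (S : eqType) (Y : {fmap box -> S})
    (x : domf Y) (s : S) : bool :=
  [exists y : domf Y, `[< neighbor (val x) (val y) >] && (Y y == s)].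

Definition swap (S : eqType) (s s' : S) (Y : {fmap box -> S}) :
    {fmap box -> S} :=
  [fmap x : domf Y =>
     if (Y x == s) && has_neighbor_valued x s' then s'
     else if (Y x == s') && has_neighbor_valued x s then s
     else Y x].

(* Tableaux with bullets take values in [option int]; [None] is the bullet. *)
Definition bullet : option int := None.

(* The boxes of [C] are not in [domf T], so [T.[? x]] is the bullet there. *)
Definition add_bullets (T : tableau) (C : {fset box}) : {fmap box -> option int} :=
  [fmap x : domf T `|` C => T.[? val x]].

(* [reducef] drops the boxes with value [None] and strips [Some] elsewhere. *)
Definition delete_bullets (Y : {fmap box -> option int}) : tableau := reducef Y.

Definition slide (vals : seq int) (C : {fset box}) (T : tableau) : tableau :=
  delete_bullets
    (foldl (fun Y s => swap (Some s) bullet Y) (add_bullets T C) vals).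

(* The integers a, a + 1, ..., b (empty when b < a). *)
Definition int_interval (a b : int) : seq int :=
  if (a <= b)%R then [seq (a + k%:Z)%R | k <- iota 0 `|b - a|%N.+1] else [::].

Definition maximal_boxes_of (lambda C : {fset box}) : Prop :=
  C `<=` lambda /\
  forall x y : box, x \in C -> y \in lambda -> ~~ (x < y)%O.

Definition minimal_boxes_outside (nu C : {fset box}) : Prop :=
  (forall x : box, x \in C -> x \notin nu) /\
  forall x y : box, x \in C -> y \notin nu -> ~~ (y < x)%O.

Definition forward_slide (T T' : tableau) : Prop :=
  exists (nu lambda C : {fset box}) (a b : int),
    [/\ increasing T, skew nu lambda (domf T), has_values_in T a b,
        maximal_boxes_of lambda C & T' = slide (int_interval a b) C T].

Definition reverse_slide (T T' : tableau) : Prop :=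
  exists (nu lambda C : {fset box}) (a b : int),
    [/\ increasing T, skew nu lambda (domf T), has_values_in T a b,
        minimal_boxes_outside nu C & T' = slide (rev (int_interval a b)) C T].

Definition jdt_equiv : tableau -> tableau -> Prop :=
  clos_refl_trans tableau (fun T T' => forward_slide T T' \/ reverse_slide T T').

Inductive weak_KKnuth_step : seq int -> seq int -> Prop :=
| KKnuth_idem u v (a : int) :
    weak_KKnuth_step (u ++ [:: a; a] ++ v) (u ++ [:: a] ++ v)
| KKnuth_braid u v (a b : int) :
    weak_KKnuth_step (u ++ [:: a; b; a] ++ v) (u ++ [:: b; a; b] ++ v)
| KKnuth_right u v (a b c : int) : (b < a)%R -> (a < c)%R ->
    weak_KKnuth_step (u ++ [:: a; b; c] ++ v) (u ++ [:: a; c; b] ++ v)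
| KKnuth_left u v (a b c : int) : (a < c)%R -> (c < b)%R ->
    weak_KKnuth_step (u ++ [:: a; b; c] ++ v) (u ++ [:: b; a; c] ++ v)
| KKnuth_weak u (a b : int) :
    weak_KKnuth_step ([:: a; b] ++ u) ([:: b; a] ++ u).

Definition weak_KKnuth : seq int -> seq int -> Prop :=
  clos_refl_sym_trans (seq int) weak_KKnuth_step.

Definition reading_order (T : tableau) (s : seq box) : Prop :=
  [/\ uniq s, s =i domf T
    & forall x y : box, x \in domf T -> y \in domf T -> y != x ->
        (box_row y <= box_row x)%N -> (box_col x <= box_col y)%N -> (index x s < index y s)%N].

(* [pmap (fnd T) s] lists the entries of [T] along [s]; nothing is dropped,
   since all boxes of [s] are in [domf T]. *)
Definition reading_word (T : tableau) (w : seq int) : Prop :=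
  exists2 s : seq box, reading_order T s & w = pmap (fnd T) s.

(* Main.v *)
(** Let [T'] be a forward slide of [T] and [V] the set of boxes visited by a
    bullet.  On [V] the entry of [T'] is the minimum of the right and lower entries
    of [T], and elsewhere [T'] agrees with [T].  Replace [T] by [T'] box by box,
    rows from top to bottom and each row from left to right.  A replacement moves
    an entry within its row, which does not change the row word, or drops an entry
    that occurs in the row above as well, or copies an entry of the row below.  The
    last two are K-Knuth equivalences, except at the diagonal, where the weak
    relation is needed to bring a smaller diagonal entry to the front of the word.
    Reverse slides are inverse to forward slides because a swap is an involution on
    the tableaux that increase when the bullet is ordered next to [k].

    Conversely, a tableau is jeu de taquin equivalent to the tableau which spreads
    its row word over an antidiagonal, and each generating relation of the weak
    K-Knuth equivalence is one forward slide of a 2x2 block on an antidiagonal; the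
    block lies on the diagonal for the weak relation. *)

Require Import Defs.
From mathcomp Require Import boolp zify.

Set Implicit Arguments.
Unset Strict Implicit.
Unset Printing Implicit Defensive.

Import Order.TTheory GRing.Theory Num.Theory.

Local Open Scope fset_scope.
Local Open Scope fmap_scope.
Local Open Scope ring_scope.

(** The obstacle is the diagonal. Away from it each entry to the left of the current column has an
    entry below it, and this comparison lets pieces of neighbouring rows commute. A row that starts
    on the diagonal sticks out one box further to the left than the next row. To drop a letter that
    is itself off the diagonal, a comparison shifted by one column suffices; otherwise the diagonal
    entry of the upper row, smaller than everything below, is taken out of the way by a recursion
    down the diagonal. The intermediate words belong to no tableau: a letter that moves up is
    present twice until its own row is reached. Slides are handled in coordinates. Skew shapes are
    replaced by convexity, and the visited boxes are the only solution of a recursion along [r + c].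
    A slide can thus be exhibited by naming its visited boxes, without running the swaps; the
    constructions of the converse rest on this. *)

(** * K-Knuth equivalence without the weak relation *)

Inductive kstep : seq int -> seq int -> Prop :=
| kstep_idem u v (a : int) : kstep (u ++ [:: a; a] ++ v) (u ++ [:: a] ++ v)
| kstep_braid u v (a b : int) :
    kstep (u ++ [:: a; b; a] ++ v) (u ++ [:: b; a; b] ++ v)
| kstep_right u v (a b c : int) : b < a -> a < c ->
    kstep (u ++ [:: a; b; c] ++ v) (u ++ [:: a; c; b] ++ v)
| kstep_left u v (a b c : int) : a < c -> c < b ->
    kstep (u ++ [:: a; b; c] ++ v) (u ++ [:: b; a; c] ++ v).

(** The four relations that may be applied anywhere in a word. The weak relation is tied to the
    beginning, so [weak_KKnuth] is preserved only by appending on the right; most computations are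
    made in [kk] and transferred by [kk_wk]. *)
Definition kk := clos_refl_sym_trans (seq int) kstep.

Lemma kk_refl u : kk u u. Proof. exact: rst_refl. Qed.
Lemma kk_sym u v : kk u v -> kk v u. Proof. exact: rst_sym. Qed.
Lemma kk_trans v u w : kk u v -> kk v w -> kk u w. Proof. exact: rst_trans. Qed.
Hint Resolve kk_refl : core.

Lemma wk_refl u : weak_KKnuth u u. Proof. exact: rst_refl. Qed.
Lemma wk_sym u v : weak_KKnuth u v -> weak_KKnuth v u. Proof. exact: rst_sym. Qed.
Lemma wk_trans v u w : weak_KKnuth u v -> weak_KKnuth v w -> weak_KKnuth u w.
Proof. exact: rst_trans. Qed.
Hint Resolve wk_refl : core.

Lemma kk_ctx p s u v : kk u v -> kk (p ++ u ++ s) (p ++ v ++ s).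
Proof.
elim=> {u v} [u v|u|u v _|u v w _ IH1 _]; last exact: kk_trans.
- move=> st; apply: rst_step; case: st => {u v} u v *;
    rewrite -!catA !(catA p u); by constructor.
- exact: kk_refl.
- exact: kk_sym.
Qed.

Lemma kk_at p s u v w w' : kk u v -> w = p ++ u ++ s -> w' = p ++ v ++ s -> kk w w'.
Proof. by move=> uv -> ->; apply: kk_ctx. Qed.

Lemma kk_wk u v : kk u v -> weak_KKnuth u v.
Proof.
elim=> {u v} [u v st|u|u v _|u v w _ IH1 _]; last exact: wk_trans.
- by apply: rst_step; case: st => {u v} *; constructor.
- exact: wk_refl.
- exact: wk_sym.
Qed.

Lemma wk_catr s u v : weak_KKnuth u v -> weak_KKnuth (u ++ s) (v ++ s).
Proof.
elim=> {u v} [u v st|u|u v _|u v w _ IH1 _]; last exact: wk_trans.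
- by apply: rst_step; case: st => {u v} *; rewrite -!catA; constructor.
- exact: wk_refl.
- exact: wk_sym.
Qed.

Lemma kk_idem (a : int) : kk [:: a; a] [:: a].
Proof. by apply: rst_step; apply: (@kstep_idem [::] [::]). Qed.
Lemma kk_braid (a b : int) : kk [:: a; b; a] [:: b; a; b].
Proof. by apply: rst_step; apply: (@kstep_braid [::] [::]). Qed.
Lemma kk_right (a b c : int) : b < a -> a < c -> kk [:: a; b; c] [:: a; c; b].
Proof. by move=> *; apply: rst_step; apply: (@kstep_right [::] [::]). Qed.
Lemma kk_left (a b c : int) : a < c -> c < b -> kk [:: a; b; c] [:: b; a; c].
Proof. by move=> *; apply: rst_step; apply: (@kstep_left [::] [::]). Qed.

(* Reversal combined with negation exchanges the two Knuth relations. *)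
Definition dual (w : seq int) := rev (map -%R w).

Lemma dualK : involutive dual.
Proof. by move=> w; rewrite /dual map_rev revK mapK //; exact: opprK. Qed.

Lemma dual_cat u v : dual (u ++ v) = dual v ++ dual u.
Proof. by rewrite /dual map_cat rev_cat. Qed.

Lemma dual_cons a v : dual (a :: v) = dual v ++ [:: - a].
Proof. by rewrite -cat1s dual_cat. Qed.

Lemma dual_kk u v : kk u v -> kk (dual u) (dual v).
Proof.
elim=> {u v} [u v st|u|u v _|u v w _ IH1 _]; last exact: kk_trans.
- case: st => {u v} [u v a|u v a b|u v a b c h1 h2|u v a b c h1 h2];
    rewrite !dual_cat -!catA; apply: kk_ctx; rewrite /dual /rev /=.
  + exact: kk_idem.
  + exact: kk_braid.
  + by apply: kk_left; lia.
  + by apply: kk_right; lia.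
- exact: kk_refl.
- exact: kk_sym.
Qed.

(** * Comparing, commuting and merging rows *)

(** Termwise comparison of [X] with a subsequence of [Y]. It keeps what the word relations use of
    two neighbouring rows and forgets the columns. *)
Inductive emb (r : rel int) : seq int -> seq int -> Prop :=
| emb_nil Y : emb r [::] Y
| emb_skip X y Y : emb r X Y -> emb r X (y :: Y)
| emb_cons x X y Y : r x y -> emb r X Y -> emb r (x :: X) (y :: Y).

Lemma emb_consP r x X Y : emb r (x :: X) Y ->
  exists Y1 y Y2, [/\ Y = Y1 ++ y :: Y2, r x y & emb r X Y2].
Proof.
elim: Y => [|y Y IH] H; first by inversion H.
inversion H; subst.
- have [//|Y1 [z [Y2 [-> rz e]]]] := IH.
  by exists (y :: Y1), z, Y2.
- by exists [::], y, Y.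
Qed.

Lemma emb_catl r X Z Y : emb r X Y -> emb r X (Z ++ Y).
Proof. by move=> H; elim: Z => //= z Z; exact: emb_skip. Qed.

Lemma emb_cat r X Y X' Y' : emb r X Y -> emb r X' Y' -> emb r (X ++ X') (Y ++ Y').
Proof.
move=> + H'; elim=> {X Y} [Y|X y Y _ IH|x X y Y rxy _ IH] /=.
- exact: emb_catl.
- exact: emb_skip.
- exact: emb_cons.
Qed.

Lemma emb_catr r X Y Z : emb r X Y -> emb r X (Y ++ Z).
Proof. by move=> H; rewrite -[X]cats0; apply: emb_cat => //; exact: emb_nil. Qed.

Lemma emb_dual (r r' : rel int) X Y : (forall x y, r x y -> r' (- x) (- y)) ->
  emb r X Y -> emb r' (dual X) (dual Y).
Proof.
move=> rr; elim=> {X Y} [Y|X y Y _ IH|x X y Y rxy _ IH].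
- exact: emb_nil.
- by rewrite dual_cons; exact: emb_catr.
- rewrite !dual_cons; apply: emb_cat => //.
  by apply: emb_cons; [exact: rr|exact: emb_nil].
Qed.

Notation row := (pairwise (<%R : rel int)).

Lemma row_cat A B : row (A ++ B) =
  [&& all (fun a => all (fun b => a < b) B) A, row A & row B].
Proof. by rewrite pairwise_cat. Qed.

Lemma dual_row A : row (dual A) = row A.
Proof.
elim: A => //= a A IH; rewrite dual_cons row_cat IH /= andbT; congr andb.
rewrite /dual all_rev all_map; apply: eq_all => x /=.
by rewrite andbT ltrN2.
Qed.

Ltac cateq := rewrite ?cats0 /= -?cats1 -?catA /= -?catA /=; reflexivity.

(** The letter [a] hops leftwards over [X]; each hop is [kk_right], with the preceding letter of the
    row as the intermediate value. *)
Lemma kk_move_left c X a : row (c :: X) -> a < c -> kk (c :: X ++ [:: a]) (c :: a :: X).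
Proof.
elim: X c => [|x X IH] c //= /and3P[/andP[cx _] xX rX] ac.
apply: (kk_trans (v := c :: x :: a :: X)).
  apply: (kk_at (p := [:: c]) (s := [::])); last by cateq.
    by apply: IH; [rewrite /= xX rX|exact: lt_trans cx].
  by cateq.
apply: (kk_at (p := [::]) (s := X) (kk_sym (kk_right ac cx))); by cateq.
Qed.

(** Each letter of [A] moves left until it stands just behind its larger partner in [C]; the
    remaining letters pass [E] by induction, and the letter then returns over the rest of [C]
    only. *)
Lemma kk_pass_row C E A : emb (<%R) A C -> row (C ++ E) -> kk (C ++ E ++ A) (C ++ A ++ E).
Proof.
elim: A C => [|a A IH] C; first by rewrite cats0.
move=> /emb_consP[C1 [c [C2 [-> ac eA]]]].
rewrite -catA /= row_cat => /and3P[_ _ rc].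
have [_ rC2E] := andP rc.
have mv X : row (c :: X) -> kk ((C1 ++ c :: X) ++ [:: a]) (C1 ++ c :: a :: X).
  move=> rX; apply: (kk_at (p := C1) (s := [::]) (kk_move_left rX ac)); by cateq.
apply: (kk_trans (v := C1 ++ c :: a :: C2 ++ E ++ A)).
  apply: (kk_at (p := [::]) (s := A) (mv (C2 ++ E) rc)); by cateq.
apply: (kk_trans (v := C1 ++ c :: a :: C2 ++ A ++ E)).
  apply: (kk_at (p := C1 ++ [:: c; a]) (s := [::]) (IH _ eA rC2E)); by cateq.
have rcC2 : row (c :: C2) by move: rc; rewrite -cat_cons row_cat => /and3P[].
apply: (kk_at (p := [::]) (s := A ++ E) (kk_sym (mv C2 rcC2))); by cateq.
Qed.

Lemma kk_pass_row_dual D A B : emb (>%R) D B -> row (A ++ B) ->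
  kk (D ++ A ++ B) (A ++ D ++ B).
Proof.
move=> eD rAB; rewrite -(dualK (D ++ _)) -(dualK (A ++ D ++ _)); apply: dual_kk.
rewrite !dual_cat -!catA; apply: kk_pass_row.
- by apply: emb_dual eD => x y /=; rewrite ltrN2.
- by rewrite -dual_cat dual_row.
Qed.

(** A weak comparison becomes strict when each letter is compared with the partner of its
    predecessor, because [D] increases strictly. *)
Lemma emb_shift d b D B : row (d :: D) -> b <= d -> emb (>=%R) D B ->
  emb (>%R) D (b :: B).
Proof.
elim: D d b B => [|e D IH] d b B; first by move=> *; exact: emb_nil.
move=> /= /andP[/andP[de _] reD] bd /emb_consP[B1 [b' [B2 [-> be eD]]]].
apply: emb_cons; first by rewrite /=; lia.
by apply: emb_catl; apply: (IH e).
Qed.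

Lemma kk_dup_small (y x d : int) : y < x -> x <= d -> kk [:: y; d; y; x] [:: d; y; x].
Proof.
move=> yx; rewrite le_eqVlt => /orP[/eqP xd|xd].
  subst d.
  apply: (kk_trans (v := [:: x; y; x; x])).
    apply: (kk_at (p := [::]) (s := [:: x]) (kk_braid y x)); by cateq.
  apply: (kk_at (p := [:: x; y]) (s := [::]) (kk_idem x)); by cateq.
have h := kk_left yx xd.
apply: (kk_trans (v := [:: y; y; d; x])).
  apply: (kk_at (p := [:: y]) (s := [::]) (kk_sym h)); by cateq.
apply: (kk_trans (v := [:: y; d; x])); last exact: h.
apply: (kk_at (p := [::]) (s := [:: d; x]) (kk_idem y)); by cateq.
Qed.

(** The first [y] is absorbed by the second although [D] stands between them, because the letters of
    [D] dominate letters of [B]. *)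
Lemma kk_dup D y B : emb (>=%R) D B -> row (y :: D) -> row (y :: B) ->
  kk (y :: D ++ y :: B) (D ++ y :: B).
Proof.
elim: D y B => [|d D IH] y B.
  move=> _ _ _; apply: (kk_at (p := [::]) (s := B) (kk_idem y)); by cateq.
move=> /emb_consP[B1 [b [B2 [-> bd eD]]]] /= /and3P[/andP[yd yD] dD rD] rB.
have bD : row (b :: D) by rewrite /= rD andbT; move: dD; apply: sub_all => x /=; lia.
have bB : row (b :: B2).
  by move: rB; rewrite row_cat => /andP[_ /and3P[_ _]].
have P1 : kk (D ++ y :: B1 ++ b :: B2) (y :: B1 ++ D ++ b :: B2).
  apply: (@kk_pass_row_dual D (y :: B1) (b :: B2)); last by rewrite /=.
  by apply: (@emb_shift d) => //=; rewrite dD.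
(* The induction hypothesis, used backwards, puts a copy of [b] in front of [D]. Then the letter
   after [y] is at most [d] even if [B1] is empty, and [kk_dup_small] applies. *)
have P2 : kk (D ++ y :: B1 ++ b :: B2) (y :: B1 ++ b :: D ++ b :: B2).
  apply: (kk_trans P1).
  apply: (kk_at (p := y :: B1) (s := [::]) (kk_sym (IH _ _ eD bD bB))); by cateq.
have K : kk (y :: d :: y :: B1 ++ [:: b]) (d :: y :: B1 ++ [:: b]).
  case: B1 rB {P1 P2} => [|x B1] /=.
    by move=> /andP[/andP[yb _] _]; apply: kk_dup_small.
  move=> /and3P[/andP[yx _] xB _].
  have /andP[xb _] : (x < b) && all (fun z => x < z) B2 by move: xB; rewrite all_cat => /andP[_].
  have h : x <= d by move: bd => /=; lia.
  apply: (kk_at (p := [::]) (s := B1 ++ [:: b]) (kk_dup_small yx h)); by cateq.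
apply: (kk_trans (v := y :: d :: y :: B1 ++ b :: D ++ b :: B2)).
  apply: (kk_at (p := [:: y; d]) (s := [::]) P2); by cateq.
apply: (kk_trans (v := d :: y :: B1 ++ b :: D ++ b :: B2)).
  apply: (kk_at (p := [::]) (s := D ++ b :: B2) K); by cateq.
apply: (kk_at (p := [:: d]) (s := [::]) (kk_sym P2)); by cateq.
Qed.

Lemma kk_dup_dual A z C : emb (<=%R) A C -> row (A ++ [:: z]) -> row (C ++ [:: z]) ->
  kk (C ++ z :: A ++ [:: z]) (C ++ z :: A).
Proof.
move=> eA rA rC; rewrite -(dualK (C ++ z :: A)) -(dualK (C ++ z :: A ++ _)); apply: dual_kk.
rewrite !(dual_cat, dual_cons) -!catA /=.
apply: (kk_dup (D := dual A) (B := dual C)).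
- by apply: emb_dual eA => x y /=; rewrite lerN2.
- by rewrite -dual_row dual_cons dualK opprK.
- by rewrite -dual_row dual_cons dualK opprK.
Qed.

Lemma row_drop_mid A x B : row (A ++ x :: B) -> row (A ++ B).
Proof.
rewrite !row_cat /= => /and3P[h -> /andP[_ ->]]; rewrite !andbT.
by move: h; apply: sub_all => a /= /andP[].
Qed.

Lemma row_catl A B : row (A ++ B) -> row A.
Proof. by rewrite row_cat => /and3P[]. Qed.

Lemma row_catr A B : row (A ++ B) -> row B.
Proof. by rewrite row_cat => /and3P[]. Qed.

Lemma row_consE y D : row (y :: D) -> all (fun x => y < x) D /\ row D.
Proof. by move=> /= /andP. Qed.

Lemma kk_commute D A y B : emb (>=%R) D B -> row (y :: D) -> row (A ++ y :: B) ->
  kk (D ++ A ++ y :: B) (A ++ D ++ y :: B).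
Proof.
by move=> eD rD rA; apply: kk_pass_row_dual => //; exact: (emb_shift rD).
Qed.

(* [C y D] is a row below [A y B]; the lower [y] is redundant. *)
Lemma kk_drop C y D A B : emb (<%R) A C -> emb (>=%R) D B ->
  row (C ++ y :: D) -> row (A ++ y :: B) ->
  kk (C ++ y :: D ++ A ++ y :: B) (C ++ D ++ A ++ y :: B).
Proof.
move=> eA eD rC rA; have rD := row_catr rC; have rB := row_catr rA.
apply: (kk_trans (v := C ++ A ++ y :: D ++ y :: B)).
  apply: (kk_at (p := [::]) (s := y :: B) (kk_pass_row eA rC)); by cateq.
apply: (kk_trans (v := C ++ A ++ D ++ y :: B)).
  apply: (kk_at (p := C ++ A) (s := [::]) (kk_dup eD rD rB)); by cateq.
apply: (kk_at (p := C) (s := [::]) (kk_sym (kk_commute eD rD rA))); by cateq.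
Qed.

(* Here the two rows start on the diagonal, so the upper one has one more box to
   the left of [y]. *)
Lemma kk_drop_shift C1 c y D A2 a' a B : emb (<%R) A2 C1 -> a < c -> emb (>=%R) D B ->
  row (C1 ++ c :: y :: D) -> row (A2 ++ a' :: a :: y :: B) ->
  kk (C1 ++ c :: y :: D ++ A2 ++ a' :: a :: y :: B)
     (C1 ++ c :: D ++ A2 ++ a' :: a :: y :: B).
Proof.
move=> eA ac eD rC rA; have rcyD := row_catr rC; have raB := row_catr rA.
have rD : row (y :: D) by case/row_consE: rcyD.
have rB : row (y :: B) by case/row_consE: raB => _ /row_consE[].
have a'a : a' < a by case/row_consE: raB => /andP[].
have ay : a < y by case/row_consE: raB => _ /row_consE[/andP[]].
have cy : c < y by case/row_consE: rcyD => /andP[].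
have a'c : a' < c by exact: lt_trans ac.
have rC1cy : row (C1 ++ [:: c; y]).
  by move: rC; rewrite -[c :: y :: D]/([:: c; y] ++ D) catA => /row_catl.
have rC1c : row (C1 ++ [:: c]).
  by move: rC1cy; rewrite -[[:: c; y]]/([:: c] ++ [:: y]) catA => /row_catl.
(* The core case has nothing to the right of [y]. In general a further [y] is created in front of
   [D] by [kk_dup], so that the core case applies, and is absorbed afterwards. *)
have core : kk (C1 ++ c :: y :: A2 ++ [:: a'; a; y]) (C1 ++ c :: A2 ++ [:: a'; a; y]).
  apply: (kk_trans (v := C1 ++ c :: A2 ++ [:: a'; y; a; y])).
    have e1 : emb (<%R) (A2 ++ [:: a']) (C1 ++ [:: c]).
      by apply: emb_cat => //; apply: emb_cons => //; exact: emb_nil.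
    have r1 : row ((C1 ++ [:: c]) ++ [:: y]) by rewrite -catA.
    apply: (kk_at (p := [::]) (s := [:: a; y]) (kk_pass_row e1 r1)); by cateq.
  (* The braid trades the extra [y] for an extra [a]. The latter is absorbed once [c], which lies
     between [a] and [y], stands in front of both and lets them commute. *)
  apply: (kk_trans (v := C1 ++ c :: A2 ++ [:: a'; a; y; a])).
    apply: (kk_at (p := C1 ++ c :: A2 ++ [:: a']) (s := [::]) (kk_braid y a)); by cateq.
  have P := kk_pass_row eA rC1c.
  apply: (kk_trans (v := C1 ++ A2 ++ [:: c; a'; a; y; a])).
    apply: (kk_at (p := [::]) (s := [:: a'; a; y; a]) P); by cateq.
  apply: (kk_trans (v := C1 ++ A2 ++ [:: a'; c; a; y; a])).
    apply: (kk_at (p := C1 ++ A2) (s := [:: y; a]) (kk_sym (kk_left a'a ac))); by cateq.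
  apply: (kk_trans (v := C1 ++ A2 ++ [:: a'; c; y; a; a])).
    apply: (kk_at (p := C1 ++ A2 ++ [:: a']) (s := [:: a]) (kk_right ac cy)); by cateq.
  apply: (kk_trans (v := C1 ++ A2 ++ [:: a'; c; y; a])).
    apply: (kk_at (p := C1 ++ A2 ++ [:: a'; c; y]) (s := [::]) (kk_idem a)); by cateq.
  apply: (kk_trans (v := C1 ++ A2 ++ [:: a'; c; a; y])).
    apply: (kk_at (p := C1 ++ A2 ++ [:: a']) (s := [::]) (kk_sym (kk_right ac cy))); by cateq.
  apply: (kk_trans (v := C1 ++ A2 ++ [:: c; a'; a; y])).
    apply: (kk_at (p := C1 ++ A2) (s := [:: y]) (kk_left a'a ac)); by cateq.
  apply: (kk_at (p := [::]) (s := [:: a'; a; y]) (kk_sym P)); by cateq.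
have E := kk_dup eD rD rB.
apply: (kk_trans (v := C1 ++ c :: y :: A2 ++ a' :: a :: D ++ y :: B)).
  have e1 : emb (<%R) (A2 ++ [:: a'; a]) (C1 ++ [:: c; y]).
    by apply: emb_cat => //; do 2 apply: emb_cons => //; exact: emb_nil.
  have r1 : row ((C1 ++ [:: c; y]) ++ D) by rewrite -catA.
  apply: (kk_at (p := [::]) (s := y :: B) (kk_pass_row e1 r1)); by cateq.
apply: (kk_trans (v := C1 ++ c :: y :: A2 ++ a' :: a :: y :: D ++ y :: B)).
  apply: (kk_at (p := C1 ++ c :: y :: A2 ++ [:: a'; a]) (s := [::]) (kk_sym E)); by cateq.
apply: (kk_trans (v := C1 ++ c :: A2 ++ a' :: a :: y :: D ++ y :: B)).
  apply: (kk_at (p := [::]) (s := D ++ y :: B) core); by cateq.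
apply: (kk_trans (v := C1 ++ c :: A2 ++ a' :: a :: D ++ y :: B)).
  apply: (kk_at (p := C1 ++ c :: A2 ++ [:: a'; a]) (s := [::]) E); by cateq.
have rA' : row ((A2 ++ [:: a'; a]) ++ y :: B) by rewrite -catA.
apply: (kk_at (p := C1 ++ [:: c]) (s := [::]) (kk_sym (kk_commute eD rD rA'))); by cateq.
Qed.

(** The rows are interleaved so that [A] stands right behind [z]; there [kk_dup_dual] repeats [z]
    after [A], and [D] is moved back past [A] and the new letter. *)
Lemma kk_insert C z D A B : emb (<=%R) A C -> emb (>%R) D B ->
  row (C ++ z :: D) -> row (A ++ z :: B) ->
  kk (C ++ z :: D ++ A ++ B) (C ++ z :: D ++ A ++ z :: B).
Proof.
move=> eA eD rC rA.
have rC' : row (C ++ [:: z]).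
  by move: rC; rewrite -[z :: D]/([:: z] ++ D) catA => /row_catl.
have rA' : row (A ++ [:: z]).
  by move: rA; rewrite -[z :: B]/([:: z] ++ B) catA => /row_catl.
apply: (kk_trans (v := C ++ z :: A ++ D ++ B)).
  apply: (kk_at (p := C ++ [:: z]) (s := [::]) (kk_pass_row_dual eD (row_drop_mid rA)));
    by cateq.
apply: (kk_trans (v := C ++ z :: A ++ z :: D ++ B)).
  apply: (kk_at (p := [::]) (s := D ++ B) (kk_sym (kk_dup_dual eA rA' rC'))); by cateq.
have rAzB : row ((A ++ [:: z]) ++ B) by rewrite -catA.
apply: (kk_at (p := C ++ [:: z]) (s := [::]) (kk_sym (kk_pass_row_dual eD rAzB))); by cateq.
Qed.

(** * Words of staircases and the weak relation *)

Definition rows_word (Rs : seq (seq int)) := flatten (rev Rs).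

Lemma rows_word_cons R Rs : rows_word (R :: Rs) = rows_word Rs ++ R.
Proof. by rewrite /rows_word rev_cons flatten_rcons. Qed.

(* The rows of a shifted shape from the top, none of them longer than the
   previous one minus its first box, the diagonal entries increasing from [a]. *)
Fixpoint staircase (a : int) (Rs : seq (seq int)) : Prop :=
  if Rs is R :: Rs' then
    if R is y :: D then
      [/\ row (a :: R), emb (>%R) (head [::] Rs') D & staircase y Rs']
    else all (@nilp int) Rs'
  else True.

Lemma all_nilp_word Rs : all (@nilp int) Rs -> rows_word Rs = [::].
Proof. by elim: Rs => // -[|//] Rs IH /= /IH; rewrite rows_word_cons => ->. Qed.

(** Being smaller than all letters of the rows below, [x] moves left past whole rows; the letters of
    [D] witness the first passage, and each row passed witnesses the next. *)
Lemma kk_pass_rows a Rs D x : staircase a Rs -> emb (>%R) (head [::] Rs) D ->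
  row (x :: D) -> x <= a -> kk (rows_word Rs ++ x :: D) (x :: rows_word Rs ++ D).
Proof.
elim: Rs a D => [|R Rs IH] a D //.
case: R => [/all_nilp_word w0|y E]; first by rewrite rows_word_cons w0.
move=> /= [rR eE st] eD rx xa; rewrite rows_word_cons -!catA.
have rxy : row (x :: y :: E).
  move: rR => /= /andP[/andP[ay aE] ->]; rewrite andbT.
  by apply/andP; split; [lia|move: aE; apply: sub_all => z /=; lia].
apply: (kk_trans (v := rows_word Rs ++ x :: (y :: E) ++ D)).
  apply: (kk_at (p := rows_word Rs) (s := [::])
           (kk_pass_row_dual (A := [:: x]) eD rx)); by cateq.
have h : kk (rows_word Rs ++ x :: y :: E) (x :: rows_word Rs ++ y :: E).
  apply: (IH y) => //; first exact: emb_skip.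
  by case/row_consE: rxy => /andP[/ltW].
apply: (kk_at (p := [::]) (s := D) h); by cateq.
Qed.

(** The weak relation exchanges only the first two letters of a word. So the next diagonal entry [y]
    is moved to the front first, by induction; [a] follows to the second place, the two are
    exchanged, and [y] goes back. *)
Lemma wk_min_front a Rs t : staircase a Rs ->
  weak_KKnuth (rows_word Rs ++ a :: t) (a :: rows_word Rs ++ t).
Proof.
elim: Rs a t => [|[|y D] Rs IH] a t //; first by move=> /all_nilp_word w0; rewrite rows_word_cons w0.
move=> /= [ray eD st]; rewrite rows_word_cons -!catA.
have /andP[/andP[ay aD] ryD] := ray.
have raD : row (a :: D) by rewrite /= aD; case/andP: ryD.
apply: (wk_trans (v := rows_word Rs ++ y :: a :: D ++ t)).
  apply: kk_wk; apply: (kk_at (p := rows_word Rs) (s := t) (kk_move_left ryD ay)); by cateq.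
apply: (wk_trans (IH _ _ st)).
apply: (wk_trans (v := y :: a :: rows_word Rs ++ D ++ t)).
  apply: kk_wk; apply: (kk_at (p := [:: y]) (s := t) (kk_pass_rows st eD raD (ltW ay))); by cateq.
apply: (wk_trans (v := a :: y :: rows_word Rs ++ D ++ t)).
  by apply: rst_step; exact: KKnuth_weak.
apply: kk_wk.
apply: (kk_at (p := [:: a]) (s := t) (kk_sym (kk_pass_rows st eD ryD (lexx y)))); by cateq.
Qed.

(** The dropped [y] is on the diagonal, so nothing in its row stands to its left. With [a0] at the
    front of the word, only [D] separates the two letters [y], and [kk_dup] applies. *)
Lemma wk_drop_diag y D Rs a0 B : staircase a0 ((y :: D) :: Rs) -> emb (>=%R) D B ->
  row (a0 :: y :: B) ->
  weak_KKnuth (rows_word Rs ++ y :: D ++ a0 :: y :: B) (rows_word Rs ++ D ++ a0 :: y :: B).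
Proof.
move=> st eD rB; have [ra eR st'] := st.
have /andP[/andP[ay aD] rD] := ra; have /andP[_ rB'] := rB.
have raD : row (a0 :: D) by apply/andP; split=> //; case/andP: rD.
apply: (wk_trans (v := a0 :: rows_word ((y :: D) :: Rs) ++ y :: B)).
  have := wk_min_front (y :: B) st; by rewrite rows_word_cons -!catA.
rewrite rows_word_cons.
apply: (wk_trans (v := a0 :: rows_word Rs ++ D ++ y :: B)).
  apply: kk_wk.
  apply: (kk_at (p := a0 :: rows_word Rs) (s := [::]) (kk_dup eD rD rB')); by cateq.
apply: (wk_trans (v := rows_word Rs ++ a0 :: D ++ y :: B)).
  apply: kk_wk; apply: (kk_at (p := [::]) (s := y :: B) (kk_sym (kk_pass_rows st' eR raD (ltW ay)))); by cateq.
apply: kk_wk; apply: (kk_at (p := rows_word Rs) (s := [::])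
  (kk_sym (kk_commute (A := [:: a0]) eD rD rB))); by cateq.
Qed.

(** Taking [a0] to the front removes the box by which the upper row sticks out, and [kk_insert]
    applies to the rest. *)
Lemma wk_insert_diag a0 Rs C z D A B : staircase a0 ((C ++ z :: D) :: Rs) ->
  emb (<=%R) A C -> emb (>%R) D B -> row (A ++ z :: B) ->
  weak_KKnuth (rows_word Rs ++ C ++ z :: D ++ a0 :: A ++ B)
              (rows_word Rs ++ C ++ z :: D ++ a0 :: A ++ z :: B).
Proof.
move=> st eA eD rA.
have rC : row (C ++ z :: D) by case: C {eA} st => [|c C] [/andP[]].
apply: (wk_trans (v := a0 :: rows_word ((C ++ z :: D) :: Rs) ++ A ++ B)).
  have := wk_min_front (A ++ B) st; by rewrite rows_word_cons -!catA.
apply: wk_sym.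
apply: (wk_trans (v := a0 :: rows_word ((C ++ z :: D) :: Rs) ++ A ++ z :: B)).
  have := wk_min_front (A ++ z :: B) st; by rewrite rows_word_cons -!catA.
rewrite rows_word_cons; apply: kk_wk.
apply: (kk_at (p := a0 :: rows_word Rs) (s := [::]) (kk_sym (kk_insert eA eD rC rA))); by cateq.
Qed.

(** * Fillings in coordinates and their row words *)

(** Total functions on pairs, empty off the shape, so that neighbouring boxes can be addressed
    without proofs of membership. *)
Definition fill := nat -> nat -> option int.

(** A missing neighbour counts as infinitely large. *)
Definition omin (x y : option int) : option int :=
  match x, y with
  | Some a, Some b => Some (Num.min a b)
  | Some a, None => Some a
  | None, _ => y
  end.

Lemma emb_pmap (r : rel int) (f g : nat -> option int) (t : nat -> nat) s :
  (forall j a, j \in s -> f j = Some a -> exists2 b, g (t j) = Some b & r a b) ->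
  emb r (pmap f s) (pmap g (map t s)).
Proof.
elim: s => [|j s IH] H; first exact: emb_nil.
have {}IH : emb r (pmap f s) (pmap g (map t s)).
  by apply: IH => i a si; apply: H; rewrite inE si orbT.
rewrite /=; case fj: (f j) => [a|].
  have [b -> ab] := H j a (mem_head _ _) fj; exact: emb_cons.
by case: (g (t j)) => [b|] //=; exact: emb_skip.
Qed.

Lemma emb_pmap_id (r : rel int) (f g : nat -> option int) s :
  (forall j a, j \in s -> f j = Some a -> exists2 b, g j = Some b & r a b) ->
  emb r (pmap f s) (pmap g s).
Proof. by move=> H; rewrite -[X in pmap g X]map_id; exact: emb_pmap. Qed.

Lemma pmap_none (f : nat -> option int) s :
  (forall j, j \in s -> f j = None) -> pmap f s = [::].
Proof.
elim: s => //= j s IH H; rewrite H ?mem_head //=.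
by apply: IH => i si; apply: H; rewrite inE si orbT.
Qed.

Lemma eq_in_pmap (f g : nat -> option int) s :
  (forall j, j \in s -> f j = g j) -> pmap f s = pmap g s.
Proof.
elim: s => //= j s IH H; rewrite H ?mem_head // IH // => i si.
by apply: H; rewrite inE si orbT.
Qed.

Definition opt_seq (x : option int) : seq int := if x is Some a then [:: a] else [::].

Lemma pmap_cons (f : nat -> option int) j s : pmap f (j :: s) = opt_seq (f j) ++ pmap f s.
Proof. by rewrite /=; case: (f j). Qed.

Definition row_inc (h : nat -> option int) :=
  forall i j a b, (i < j)%N -> h i = Some a -> h j = Some b -> a < b.

Lemma row_pmap h m n : row_inc h -> row (pmap h (iota m n)).
Proof.
move=> hi; elim: n m => [|n IH] m //.
rewrite [iota _ _]/= pmap_cons; case hm: (h m) => [a|]; last exact: IH.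
rewrite /=.
rewrite IH andbT; apply/allP => b.
rewrite mem_pmap => /mapP[j]; rewrite mem_iota => /andP[mj _] bj.
exact: hi hm (esym bj).
Qed.

Section RowWord.
Variable N : nat.
Implicit Types h f g : nat -> option int.

Definition row_word h := pmap h (iota 0 N).
Definition left_part h c := pmap h (iota 0 c).
Definition right_part h c := pmap h (iota c.+1 (N - c.+1)).

Lemma row_word_split h c : (c < N)%N ->
  row_word h = left_part h c ++ opt_seq (h c) ++ right_part h c.
Proof.
move=> cN; rewrite /row_word -pmap_cons -pmap_cat.
have -> : c :: iota c.+1 (N - c.+1) = iota c (N - c.+1).+1 by [].
by rewrite -[X in iota X]add0n -iotaD; congr (pmap h (iota 0 _)); lia.
Qed.

Lemma left_partS h c : left_part h c.+1 = left_part h c ++ opt_seq (h c).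
Proof. by rewrite /left_part -addn1 iotaD pmap_cat /= add0n; case: (h c). Qed.

Lemma right_partS h c : (c.+1 < N)%N ->
  right_part h c = opt_seq (h c.+1) ++ right_part h c.+1.
Proof.
move=> cN; rewrite /right_part -pmap_cons.
by have -> : (N - c.+1 = (N - c.+2).+1)%N by lia.
Qed.

End RowWord.

(** * The row word along a forward slide *)

Section SlideWord.
(** [G] is the filling before the slide and [F] the one after it; [C] is the set of initial bullets,
    [V] the set of visited boxes, and [N] bounds the columns. *)
Variables (N : nat) (G F : fill) (C V : nat -> nat -> Prop).

Definition slide_dom r c := C r c \/ G r c <> None.
Definition slide_min (G : fill) r c := omin (G r c.+1) (G r.+1 c).

Hypothesis dom_valid : forall r c, slide_dom r c -> (0 < r <= c)%N.
Hypothesis dom_bound : forall r c, slide_dom r c -> (c < N)%N.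
Hypothesis dom_convex : forall r1 c1 r c r2 c2, slide_dom r1 c1 -> slide_dom r2 c2 ->
  (r1 <= r <= r2)%N -> (c1 <= c <= c2)%N -> (r <= c)%N -> slide_dom r c.
Hypothesis C_minimal : forall r c r' c', C r c -> slide_dom r' c' ->
  (r' <= r)%N -> (c' <= c)%N -> r' = r /\ c' = c.
Hypothesis C_empty : forall r c, C r c -> G r c = None.
Hypothesis G_inc : forall r c r' c' a b, G r c = Some a -> G r' c' = Some b ->
  (r <= r')%N -> (c <= c')%N -> (r + c < r' + c')%N -> a < b.
Hypothesis F_inc : forall r c r' c' a b, F r c = Some a -> F r' c' = Some b ->
  (r <= r')%N -> (c <= c')%N -> (r + c < r' + c')%N -> a < b.
Hypothesis F_convex : forall r1 c1 r c r2 c2, F r1 c1 <> None -> F r2 c2 <> None ->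
  (r1 <= r <= r2)%N -> (c1 <= c <= c2)%N -> (r <= c)%N -> F r c <> None.
Hypothesis V_spec : forall r c, V r c <-> C r c \/ exists2 x, G r c = Some x &
  (exists c', [/\ c = c'.+1, V r c' & slide_min G r c' = Some x]) \/
  (exists r', [/\ r = r'.+1, V r' c & slide_min G r' c = Some x]).
Hypothesis F_visited : forall r c, V r c -> F r c = slide_min G r c.
Hypothesis F_other : forall r c, ~ V r c -> F r c = G r c.

Local Notation D := slide_dom.
Local Notation m := (slide_min G).

Lemma V_dom r c : V r c -> D r c.
Proof. by move=> /V_spec[?|[x h _]]; [left|right; rewrite h]. Qed.

Lemma dom_some r c : D r c -> ~ C r c -> exists x, G r c = Some x.
Proof. by case=> // + _; case: (G r c) => // x; exists x. Qed.

Lemma dom_above r c r' c' : D r c -> D r' c' -> (r <= r')%N -> (c <= c')%N ->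
  (r + c < r' + c')%N -> exists x, G r' c' = Some x.
Proof.
move=> d d' rr cc lt; apply: dom_some => // Cx.
have [] := C_minimal Cx d rr cc; lia.
Qed.

Lemma F_dom r c : F r c <> None -> D r c.
Proof.
case: (pselect (V r c)) => [/V_dom //|nV]; rewrite F_other //; by right.
Qed.

Lemma F_none r c : ~~ ((0 < r) && (r <= c))%N -> F r c = None.
Proof.
move=> h; case e: (F r c) => [x|] //.
have /F_dom/dom_valid : F r c <> None by rewrite e.
by move=> h'; rewrite h' in h.
Qed.

Lemma G_none r c : ~~ ((0 < r) && (r <= c))%N -> G r c = None.
Proof.
move=> h; case e: (G r c) => [x|] //.
have /dom_valid h' : D r c by right; rewrite e.
by rewrite h' in h.
Qed.

Lemma min_right r c x : G r c.+1 = Some x -> exists2 y, m r c = Some y & y <= x.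
Proof. by rewrite /slide_min => ->; case: (G r.+1 c) => [z|] /=; eexists; eauto; lia. Qed.

Lemma min_down r c x : G r.+1 c = Some x -> exists2 y, m r c = Some y & y <= x.
Proof. by rewrite /slide_min => ->; case: (G r c.+1) => [z|] /=; eexists; eauto; lia. Qed.

(** Convexity supplies the box below. The condition [r < j] keeps it on or right of the diagonal; at
    [j = r] there is no such box and the comparison breaks down. *)
Lemma left_below r j c a : F r j = Some a -> (j < c)%N -> (r < j)%N -> D r.+1 c ->
  exists2 b, F r.+1 j = Some b & a < b.
Proof.
move=> Fa jc rj dc.
have dj : D r j by apply: F_dom; rewrite Fa.
have dj1 : D r.+1 j by apply: dom_convex dj dc _ _ _; lia.
have [b Fb] : exists b, F r.+1 j = Some b.
  case: (pselect (V r.+1 j)) => [v|nv].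
    rewrite F_visited //.
    have dj2 : D r.+1 j.+1 by apply: dom_convex dj dc _ _ _; lia.
    have [x Gx] : exists x, G r.+1 j.+1 = Some x by apply: (dom_above dj1 dj2); lia.
    by have [y -> _] := min_right Gx; exists y.
  have [x Gx] : exists x, G r.+1 j = Some x by apply: (dom_above dj dj1); lia.
  by exists x; rewrite F_other.
by exists b => //; apply: F_inc Fa Fb _ _ _; lia.
Qed.

Lemma right_above r j c x : V r c -> (c < j)%N -> G r.+1 j = Some x ->
  exists2 b, F r j = Some b & b <= x.
Proof.
move=> v cj Gx; have dc := V_dom v.
have dj1 : D r.+1 j by right; rewrite Gx.
have := dom_valid dc; have := dom_valid dj1 => val1 val2.
have dj : D r j by apply: dom_convex dc dj1 _ _ _; lia.
case: (pselect (V r j)) => [v'|nv].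
  by rewrite F_visited //; exact: min_down.
have [y Gy] : exists y, G r j = Some y by apply: (dom_above dc dj); lia.
exists y; first by rewrite F_other.
apply: ltW; apply: G_inc Gy Gx _ _ _; lia.
Qed.

Lemma G_right_above r j c x : D r c -> (c < j)%N -> G r.+1 j = Some x ->
  exists2 b, G r j = Some b & b < x.
Proof.
move=> dc cj Gx.
have dj1 : D r.+1 j by right; rewrite Gx.
have := dom_valid dc; have := dom_valid dj1 => val1 val2.
have dj : D r j by apply: dom_convex dc dj1 _ _ _; lia.
have [y Gy] : exists y, G r j = Some y by apply: (dom_above dc dj); lia.
by exists y => //; apply: G_inc Gy Gx _ _ _; lia.
Qed.

Lemma left_below_G r j c a : F r j = Some a -> (j < c)%N -> (r < j)%N -> D r.+1 c ->
  exists2 b, G r.+1 j = Some b & a <= b.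
Proof.
move=> Fa jc rj dc.
have dj : D r j by apply: F_dom; rewrite Fa.
have dj1 : D r.+1 j by apply: dom_convex dj dc _ _ _; lia.
have [b Gb] : exists b, G r.+1 j = Some b by apply: (dom_above dj dj1); lia.
exists b => //.
case: (pselect (V r j)) => [v|nv].
  by have [y h yb] := min_down Gb; move: Fa; rewrite F_visited // h => -[<-].
move: Fa; rewrite F_other // => Ga.
by apply: ltW; apply: G_inc Ga Gb _ _ _; lia.
Qed.

Definition from_left r c := exists c', [/\ c = c'.+1, V r c' & slide_min G r c' = G r c].

(** The new entry of a visited box in column [j] is at most the old entry of column [j + 1];
    equality for [j + 1 = c] would mean that this entry has just moved left. *)
Lemma F_lt_G r j c a x : F r j = Some a -> (j < c)%N -> G r c = Some x ->
  ~ from_left r c -> a < x.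
Proof.
move=> Fa jc Gx nl; have dj : D r j by apply: F_dom; rewrite Fa.
have dc : D r c by right; rewrite Gx.
have := dom_valid dc; have := dom_valid dj => val1 val2.
case: (pselect (V r j)) => [v|nv]; last first.
  by move: Fa; rewrite F_other // => Ga; apply: G_inc Ga Gx _ _ _; lia.
have dj1 : D r j.+1 by apply: dom_convex dj dc _ _ _; lia.
have [y Gy] : exists y, G r j.+1 = Some y by apply: (dom_above dj dj1); lia.
have [z mz zy] := min_right Gy.
have az : a = z by move: Fa; rewrite F_visited // mz => -[].
have [e|ne] := eqVneq j.+1 c; last first.
  by apply: (le_lt_trans (y := y)); [rewrite az|apply: G_inc Gy Gx _ _ _; lia].
move: Gy zy; rewrite e Gx => -[<-] zy.
rewrite lt_neqAle az zy andbT; apply/eqP => zx.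
by apply: nl; exists j; split=> //; rewrite mz Gx zx.
Qed.

(* Row [r] after the columns before [c] have been slid: the entry in column [c]
   is missing if it has just moved left. *)
Definition hybrid r c j : option int :=
  if (j < c)%N then F r j
  else if (j == c) && `[< from_left r c >] then None else G r j.

(** Column [c] is empty here whichever way its entry went. This separates the loss of the old entry
    from the arrival of the new one. *)
Definition hybrid_hole r c j : option int :=
  if (j < c)%N then F r j else if j == c then None else G r j.

(** The word in progress is [below r] with old entries, then row [r], then [above r] with new
    ones. *)
Definition below r := rows_word [seq row_word N (G i) | i <- iota r.+1 (N - r.+1)].
Definition above r := rows_word [seq row_word N (F i) | i <- iota 0 r].

Lemma row_inc_G r : row_inc (G r).
Proof. by move=> i j a b ij Ga Gb; apply: G_inc Ga Gb _ _ _; lia. Qed.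

Lemma row_inc_F r : row_inc (F r).
Proof. by move=> i j a b ij Ga Gb; apply: F_inc Ga Gb _ _ _; lia. Qed.

Lemma left_part_eq (h h' : nat -> option int) c : (forall j, (j < c)%N -> h j = h' j) ->
  left_part h c = left_part h' c.
Proof. by move=> H; apply: eq_in_pmap => j; rewrite mem_iota; exact: H. Qed.

Lemma right_part_eq (h h' : nat -> option int) c : (forall j, (c < j)%N -> h j = h' j) ->
  right_part N h c = right_part N h' c.
Proof. by move=> H; apply: eq_in_pmap => j; rewrite mem_iota => /andP[/H]. Qed.

Lemma emb_left (r : rel int) (f g : nat -> option int) c :
  (forall j a, (j < c)%N -> f j = Some a -> exists2 b, g j = Some b & r a b) ->
  emb r (left_part f c) (left_part g c).
Proof. by move=> H; apply: emb_pmap_id => j a; rewrite mem_iota; exact: H. Qed.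

Lemma emb_right (r : rel int) (f g : nat -> option int) c :
  (forall j a, (c < j)%N -> f j = Some a -> exists2 b, g j = Some b & r a b) ->
  emb r (right_part N f c) (right_part N g c).
Proof. by move=> H; apply: emb_pmap_id => j a; rewrite mem_iota => /andP[+ _]; exact: H. Qed.

Lemma left_part_none f c : (forall j, (j < c)%N -> f j = None) -> left_part f c = [::].
Proof. by move=> H; apply: pmap_none => j; rewrite mem_iota; exact: H. Qed.

Lemma staircase_below i a n :
  (forall j x, G i j = Some x -> a < x) ->
  (forall k j k', (i <= k' <= k)%N -> G k j <> None -> G k' k' <> None) ->
  staircase a [seq row_word N (G k) | k <- iota i n].
Proof.
elim: n i a => [|n IH] i a Ha Hd //=.
case e: (G i i) => [y|]; last first.
  (* An empty diagonal box empties this and all further rows, which is the degenerate case of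
     [staircase]. *)
  have rw0 k : (i <= k)%N -> row_word N (G k) = [::].
    move=> ik; apply: pmap_none => j _; case g: (G k j) => [x|] //.
    have [] : False by apply: (Hd k j i) e; [lia|rewrite g].
  rewrite rw0 //; apply/allP => R /mapP[k]; rewrite mem_iota => /andP[ik _] ->.
  by rewrite rw0 // ltnW.
have iN : (i < N)%N by apply: (@dom_bound i i); right; rewrite e.
have i0 : (0 < i)%N by have /dom_valid : D i i by [right; rewrite e]; lia.
have l0 k : (i <= k)%N -> left_part (G k) i = [::].
  by move=> ik; apply: left_part_none => j ji; apply: G_none; lia.
have rwi : row_word N (G i) = y :: right_part N (G i) i.
  by rewrite (row_word_split _ iN) l0 // e.
have rrow := row_pmap 0 N (row_inc_G (r := i)).
have Hay := Ha _ _ e.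
rewrite rwi; split.
- move: rrow; rewrite -/(row_word N (G i)) rwi /= => /andP[h ->]; rewrite h Hay !andbT /=.
  by move: h; apply: sub_all => x; exact: lt_trans.
- case: n {IH} => [|n]; first exact: emb_nil.
  rewrite [head _ _]/= (row_word_split _ iN) l0 //= G_none ?ltnn ?andbF //=.
  apply: emb_right => j x ij Gx.
  by apply: (@G_right_above i j i x) Gx => //; right; rewrite e.
- apply: IH => [j x Gx|k j k' kk gk]; last by apply: (Hd k j); [lia|].
  have ij : (i < j)%N.
    by have /dom_valid : D i.+1 j by [right; rewrite Gx]; lia.
  by apply: G_inc e Gx _ _ _; lia.
Qed.

Lemma rows_word_rcons Rs R : rows_word (rcons Rs R) = R ++ rows_word Rs.
Proof. by rewrite /rows_word rev_rcons. Qed.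

Lemma aboveS r : above r.+1 = row_word N (F r) ++ above r.
Proof. by rewrite /above -(addn1 r) iotaD map_cat /= cats1 rows_word_rcons ?add0n. Qed.

Lemma belowE r : (r.+1 < N)%N -> below r = below r.+1 ++ row_word N (G r.+1).
Proof.
move=> rN; rewrite /below.
have -> : (N - r.+1 = (N - r.+2).+1)%N by lia.
by rewrite /= rows_word_cons.
Qed.

(** Convexity between the diagonal box [(i, i)] and any box further down fills the diagonal in
    between. *)
Lemma staircase_from i a k : D i i -> (forall j x, G i.+1 j = Some x -> a < x) ->
  staircase a [seq row_word N (G k) | k <- iota i.+1 k].
Proof.
move=> dii Ha; apply: staircase_below => // {}k j k' /andP[ik' kk'] gkj gk'.
have dk : D k j by right.
have vk := dom_valid dk.
have dk' : D k' k' by apply: dom_convex dii dk _ _ _; lia.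
have [x] : exists x, G k' k' = Some x by apply: (dom_above dii dk'); lia.
by rewrite gk'.
Qed.

(** The letter [y] has moved up, so a copy of it already stands in row [r] of [F]; this copy
    justifies erasing the one in row [r + 1]. *)
Lemma word_drop r c y : V r c -> G r.+1 c = Some y -> m r c = Some y ->
  ~ from_left r.+1 c ->
  weak_KKnuth (below r.+1 ++ row_word N (hybrid r.+1 c) ++ row_word N (F r))
              (below r.+1 ++ row_word N (hybrid_hole r.+1 c) ++ row_word N (F r)).
Proof.
move=> v Gy my nl.
have dc1 : D r.+1 c by right; rewrite Gy.
have dc := V_dom v.
have := dom_valid dc1; have := dom_valid dc => val val1.
have cN := dom_bound dc.
have Fy : F r c = Some y by rewrite F_visited.
pose A := left_part (F r) c; pose B := right_part N (F r) c.
pose L := left_part (F r.+1) c; pose E := right_part N (G r.+1) c.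
have hE : row_word N (hybrid r.+1 c) = L ++ y :: E.
  rewrite (row_word_split _ cN).
  have -> : left_part (hybrid r.+1 c) c = L.
    by apply: left_part_eq => j jc; rewrite /hybrid jc.
  have -> : right_part N (hybrid r.+1 c) c = E.
    by apply: right_part_eq => j jc; rewrite /hybrid ltnNge ltnW //= gtn_eqF.
  by rewrite /hybrid ltnn eqxx; case: asboolP => //= _; rewrite Gy.
have hh : row_word N (hybrid_hole r.+1 c) = L ++ E.
  rewrite (row_word_split _ cN).
  have -> : left_part (hybrid_hole r.+1 c) c = L.
    by apply: left_part_eq => j jc; rewrite /hybrid_hole jc.
  have -> : right_part N (hybrid_hole r.+1 c) c = E.
    by apply: right_part_eq => j jc; rewrite /hybrid_hole ltnNge ltnW //= gtn_eqF.
  by rewrite /hybrid_hole ltnn eqxx.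
have hF : row_word N (F r) = A ++ y :: B by rewrite (row_word_split _ cN) Fy.
have rLE : row (L ++ y :: E).
  pose h j := if (j < c)%N then F r.+1 j else G r.+1 j.
  have -> : L ++ y :: E = row_word N h.
    rewrite (row_word_split _ cN) /h ltnn Gy; congr (_ ++ _ :: _).
      by apply: left_part_eq => j ->.
    by apply: right_part_eq => j jc; rewrite ltnNge ltnW.
  apply: row_pmap => i j a b ij; rewrite /h.
  case: ltnP => ic; case: ltnP => jc; try lia.
  - by apply: row_inc_F.
  - move=> Fa Gb; have ay := F_lt_G Fa ic Gy nl.
    have [jE|cj] : j = c \/ (c < j)%N by lia.
      by move: Gb; rewrite jE Gy => -[<-].
    by apply: (lt_trans ay); apply: row_inc_G cj Gy Gb.
  - by apply: row_inc_G.
have rAB : row (A ++ y :: B) by rewrite -hF; exact: row_pmap (row_inc_F (r := r)).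
have eE : emb (>=%R) E B.
  by apply: emb_right => j x cj Gx; exact: right_above v cj Gx.
rewrite hE hh hF.
have [rc|rc] := leqP r.+1 c; last by lia.
(* If row [r] of [F] misses the diagonal, each of its entries left of column [c] has a larger one
   below it, and [kk_drop] applies. *)
case e0: (F r r) => [a0|]; last first.
  apply: kk_wk; apply: (kk_at (p := below r.+1) (s := [::]) (@kk_drop L y E A B _ eE rLE rAB));
    [|by rewrite -?catA /= ?cats0 -?catA..].
  apply: emb_left => j a jc Fa; apply: (left_below Fa jc _ dc1).
  have /dom_valid : D r j by apply: F_dom; rewrite Fa.
  by have : j <> r by [move=> jr; rewrite jr e0 in Fa]; lia.
have drr : D r r by apply: F_dom; rewrite e0.
have lF0 c' : (c' <= r)%N -> left_part (F r) c' = [::].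
  by move=> c'r; apply: left_part_none => j jr; apply: F_none; lia.
(* In the first case [y] lies on the diagonal, and the weak relation is used. *)
have [cr|] := eqVneq c r.+1.
  have L0 : L = [::] by apply: left_part_none => j jr; apply: F_none; lia.
  have A0 : A = [:: a0] by rewrite /A cr left_partS lF0 // e0.
  rewrite L0 A0 /=; apply: wk_drop_diag => //; last by rewrite A0 in rAB.
  have yr : row_word N (G r.+1) = y :: E.
    rewrite (row_word_split _ cN) Gy left_part_none // => j jc.
    by apply: G_none; lia.
  have -> : (y :: E) :: [seq row_word N (G i) | i <- iota r.+2 (N - r.+2)] =
     [seq row_word N (G i) | i <- iota r.+1 (N - r.+2).+1] by rewrite /= yr.
  apply: staircase_from => // j x Gx.
  have /dom_valid vj : D r.+1 j by right; rewrite Gx.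
  have a0y : a0 < y by apply: F_inc e0 Fy _ _ _; lia.
  apply: (lt_le_trans a0y); have [jE|cj] : j = c \/ (c < j)%N by lia.
    by move: Gx; rewrite jE Gy => -[->].
  by apply/ltW/(row_inc_G cj Gy Gx).
move=> cr1.
have [c2 cE] : exists c2, c = c2.+2 by case: (c) rc cr1 val => [|[|c2]]; try lia; exists c2.
have Fdef j : (r <= j <= c)%N -> exists a, F r j = Some a.
  move=> /andP[rj jc]; have : F r j <> None.
    by apply: (F_convex (r1 := r) (c1 := r) (r2 := r) (c2 := c)); rewrite ?e0 ?Fy //; lia.
  by case: (F r j) => // a _; exists a.
have [a Fa] : exists a, F r c2.+1 = Some a by apply: Fdef; lia.
have [a' Fa'] : exists a, F r c2 = Some a by apply: Fdef; lia.
have [x Fx ax] : exists2 b, F r.+1 c2.+1 = Some b & a < b by apply: (left_below Fa _ _ dc1); lia.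
have AE : A = left_part (F r) c2 ++ [:: a'; a] by rewrite /A cE !left_partS Fa Fa' /= -catA.
have LE : L = left_part (F r.+1) c2.+1 ++ [:: x] by rewrite /L cE left_partS Fx.
move: rLE rAB; rewrite AE LE -!catA /= => rLE rAB.
apply: kk_wk; apply: (kk_at (p := below r.+1) (s := [::])
  (@kk_drop_shift (left_part (F r.+1) c2.+1) x y E (left_part (F r) c2) a' a B _ ax eE rLE rAB));
    [|by rewrite -?catA /= ?cats0 -?catA..].
(* The diagonal box has none below it, so column [j] of row [r] is compared with column [j + 1] of
   the row below, through the entry to its right. *)
have -> : left_part (F r.+1) c2.+1 = pmap (F r.+1) (map S (iota 0 c2)).
  rewrite /left_part [iota _ _]/= pmap_cons F_none ?ltn0 ?andbF //= -(iotaDl 1 0).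
  by congr pmap; apply: eq_map => j; rewrite add1n.
apply: emb_pmap => j b; rewrite mem_iota => /= jc Fb.
have [b' Fb' bb'] : exists2 b', F r.+1 j.+1 = Some b' & 
   exists2 z, F r j.+1 = Some z & z < b'.
  have /dom_valid vj : D r j by apply: F_dom; rewrite Fb.
  have [z Fz] : exists z, F r j.+1 = Some z by apply: Fdef; lia.
  have [b' Fb' zb] : exists2 b, F r.+1 j.+1 = Some b & z < b by apply: (left_below Fz _ _ dc1); lia.
  by exists b' => //; exists z.
exists b' => //; case: bb' => z Fz zb'.
by apply: lt_trans zb'; apply: row_inc_F Fb Fz.
Qed.

(** A visited diagonal box receives its new entry from the right, since no box lies below it. *)
Lemma below_diag r a0 j x : F r r = Some a0 -> G r.+1 j = Some x -> a0 < x.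
Proof.
move=> Fa Gx; have /dom_valid vj : D r.+1 j by right; rewrite Gx.
case: (pselect (V r r)) => [v|nv]; last first.
  by move: Fa; rewrite F_other // => Ga; apply: G_inc Ga Gx _ _ _; lia.
have Gd : G r.+1 r = None by apply: G_none; lia.
move: Fa; rewrite F_visited // /slide_min Gd.
case Gr: (G r r.+1) => [y|] //= -[<-].
by apply: G_inc Gr Gx _ _ _; lia.
Qed.

(** The new entry [z] comes from below and does not also stand to the right, so a letter is really
    gained; the original in row [r + 1] is still in place and is what gets copied. *)
Lemma word_insert r c z : V r c -> G r.+1 c = Some z -> m r c = Some z ->
  G r c.+1 <> Some z ->
  weak_KKnuth (below r ++ row_word N (hybrid_hole r c))
              (below r ++ row_word N (hybrid r c.+1)).
Proof.
move=> v Gz mz Gr.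
have dc1 : D r.+1 c by right; rewrite Gz.
have dc := V_dom v.
have := dom_valid dc1; have := dom_valid dc => val val1.
have cN := dom_bound dc.
have Fz : F r c = Some z by rewrite F_visited.
pose A := left_part (F r) c; pose B := right_part N (G r) c.
pose L := left_part (G r.+1) c; pose E := right_part N (G r.+1) c.
have hh : row_word N (hybrid_hole r c) = A ++ B.
  rewrite (row_word_split _ cN) /hybrid_hole ltnn eqxx; congr (_ ++ _).
    by apply: left_part_eq => j ->.
  by apply: right_part_eq => j jc; rewrite ltnNge ltnW //= gtn_eqF.
have hE : row_word N (hybrid r c.+1) = A ++ z :: B.
  rewrite (row_word_split _ cN) /hybrid leqnn Fz; congr (_ ++ _ :: _).
    by apply: left_part_eq => j jc; rewrite ltnS ltnW.
  apply: right_part_eq => j jc; rewrite ltnNge jc /=.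
  case: eqP => //= -> ; case: asboolP => // -[c' [[<-] _ mE]].
  by case: Gr; rewrite -mE.
have hG : row_word N (G r.+1) = L ++ z :: E by rewrite (row_word_split _ cN) Gz.
have rLE : row (L ++ z :: E) by rewrite -hG; exact: row_pmap (row_inc_G (r := r.+1)).
have rAB : row (A ++ z :: B).
  pose h j := if (j <= c)%N then F r j else G r j.
  have -> : A ++ z :: B = row_word N h.
    rewrite (row_word_split _ cN) /h leqnn Fz; congr (_ ++ _ :: _).
      by apply: left_part_eq => j jc; rewrite ltnW.
    by apply: right_part_eq => j jc; rewrite leqNgt jc.
  apply: row_pmap => i j a b ij; rewrite /h.
  case: leqP => ic; case: leqP => jc; try lia.
  - by apply: row_inc_F.
  - move=> Fa Gb.
    have az : a <= z.
      have [iE|ic'] : i = c \/ (i < c)%N by lia.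
        by move: Fa; rewrite iE Fz => -[->].
      by apply/ltW/(row_inc_F ic' Fa Fz).
    have dj : D r j by right; rewrite Gb.
    have dc2 : D r c.+1 by apply: dom_convex dc dj _ _ _; lia.
    have [y Gy] : exists y, G r c.+1 = Some y by apply: (dom_above dc dc2); lia.
    have [z' mz' zy] := min_right Gy.
    move: mz' zy; rewrite mz => -[<-] zy.
    have zy' : z < y.
      by rewrite lt_neqAle zy andbT; apply/eqP => zyE; apply: Gr; rewrite Gy zyE.
    apply: (le_lt_trans az); apply: (lt_le_trans zy').
    have [jE|cj] : j = c.+1 \/ (c.+1 < j)%N by lia.
      by move: Gb; rewrite jE Gy => -[->].
    by apply/ltW/(row_inc_G cj Gy Gb).
  - by apply: row_inc_G.
have eE : emb (>%R) E B.
  by apply: emb_right => j x cj Gx; exact: G_right_above dc cj Gx.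
have vj j a : F r j = Some a -> (0 < r <= j)%N.
  by move=> Fa; apply: dom_valid; apply: F_dom; rewrite Fa.
have rN : (r.+1 < N)%N by lia.
rewrite hE hh (belowE rN) hG.
case e0: (F r r) => [a0|]; last first.
  apply: kk_wk; apply: (kk_at (p := below r.+1) (s := [::]) (@kk_insert L z E A B _ eE rLE rAB));
    [|by rewrite -?catA /= ?cats0 -?catA..].
  apply: emb_left => j a jc Fa; apply: (left_below_G Fa jc _ dc1).
  by have := vj _ _ Fa; have : j <> r by [move=> jr; rewrite jr e0 in Fa]; lia.
have drr : D r r by apply: F_dom; rewrite e0.
(* The diagonal entry [a0] is split off; the rest of the left part compares with the lower row
   column by column. *)
pose f j := if j == r then None else F r j.
have AE : A = a0 :: left_part f c.
  have rc : (r < c)%N by lia.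
  have lE h : left_part h c = row_word c h by [].
  rewrite /A !lE !(row_word_split _ rc).
  have F0 j : (j < r)%N -> F r j = None by move=> jr; apply: F_none; lia.
  rewrite e0 (left_part_none F0) (@left_part_none f) => [|j jr].
    rewrite /f eqxx; congr (_ :: _); apply: eq_in_pmap => j.
    by rewrite mem_iota => /andP[rj _]; rewrite gtn_eqF.
  by rewrite /f ltn_eqF // F0.
rewrite AE -catA /= -catA /= -?catA; apply: wk_insert_diag => //.
- have -> : (L ++ z :: E) :: [seq row_word N (G i) | i <- iota r.+2 (N - r.+2)] =
     [seq row_word N (G i) | i <- iota r.+1 (N - r.+2).+1] by rewrite /= hG.
  by apply: staircase_from => // j x; exact: below_diag.
- apply: emb_left => j a jc; rewrite /f; case: eqP => // jr Fa.
  apply: (left_below_G Fa jc _ dc1); have := vj _ _ Fa; lia.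
- by move: rAB; rewrite AE => /andP[].
Qed.

Lemma eq_row_word h h' : h =1 h' -> row_word N h = row_word N h'.
Proof. by move=> hh; apply: eq_in_pmap => j _. Qed.

Lemma slide_min_none r c : m r c = None -> G r c.+1 = None.
Proof. by rewrite /slide_min; case: (G r c.+1) => // a; case: (G r.+1 c). Qed.

(** Passing column [c] consists of two changes, through [hybrid_hole]: the old entry disappears,
    then the new one arrives. Horizontal moves are invisible in the word, so only vertical ones cost
    a relation. *)
Lemma hybrid_step r c :
  weak_KKnuth (below r ++ row_word N (hybrid r c) ++ above r)
              (below r ++ row_word N (hybrid r c.+1) ++ above r).
Proof.
case: (pselect (V r c)) => [v|nv]; last first.
  suff -> : row_word N (hybrid r c) = row_word N (hybrid r c.+1) by [].
  apply: eq_row_word => j; rewrite /hybrid ltnS.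
  case: ltngtP => //= [cj|->].
    case: eqP => //= jc; case: asboolP => // -[c' [cE v' _]].
    by move: cE; rewrite jc => -[cE]; case: nv; rewrite cE.
  rewrite F_other //; case: asboolP => // -[c' [cE v' mE]].
  case g: (G r c) => [x|] //; case: nv; apply/V_spec; right; exists x => //.
  by left; exists c'; rewrite mE.
apply: (wk_trans (v := below r ++ row_word N (hybrid_hole r c) ++ above r)).
  case g: (G r c) => [y|]; last first.
    suff -> : row_word N (hybrid r c) = row_word N (hybrid_hole r c) by [].
    apply: eq_row_word => j; rewrite /hybrid /hybrid_hole.
    by case: ltngtP => //= ->; rewrite g; case: asboolP.
  case: (pselect (from_left r c)) => [fl|nfl].
    suff -> : row_word N (hybrid r c) = row_word N (hybrid_hole r c) by [].
    apply: eq_row_word => j; rewrite /hybrid /hybrid_hole.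
    by case: ltngtP => //= ->; case: asboolP.
  have /V_spec[/C_empty|[x]] := v; first by rewrite g.
  rewrite g => -[<-] [[c' [cE v' mE]]|[r' [rE v' mE]]].
    by case: nfl; exists c'; rewrite mE g.
  move: g nfl; rewrite rE aboveS => g nfl.
  by rewrite !catA; apply: wk_catr; rewrite -!catA; exact: word_drop v' g mE nfl.
case mE: (m r c) => [z|]; last first.
  suff -> : row_word N (hybrid_hole r c) = row_word N (hybrid r c.+1) by [].
  apply: eq_row_word => j; rewrite /hybrid /hybrid_hole ltnS.
  case: ltngtP => //= [cj|->]; last by rewrite F_visited.
  by case: eqP => //= ->; rewrite (slide_min_none mE); case: asboolP.
(* When the right and lower neighbours agree, the new entry is taken from the right; the copy below
   is erased when its own row is treated. *)
have [ge|gne] := pselect (G r c.+1 = Some z); last first.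
  rewrite !catA; apply: wk_catr; apply: (word_insert v _ mE gne).
  move: mE gne; rewrite /slide_min; case: (G r c.+1) => [a|]; case: (G r.+1 c) => [b|] //= [<-] //.
  by rewrite minEle; case: ifP.
suff -> : row_word N (hybrid_hole r c) = row_word N (hybrid r c.+1) by [].
have cN1 : (c.+1 < N)%N by apply: (@dom_bound r); right; rewrite ge.
have cN : (c < N)%N by exact: ltnW.
rewrite !(row_word_split _ cN) !(right_partS _ cN1).
have -> : hybrid_hole r c c = None by rewrite /hybrid_hole ltnn eqxx.
have -> : hybrid_hole r c c.+1 = Some z by rewrite /hybrid_hole ltnNge leqnSn /= gtn_eqF.
have -> : hybrid r c.+1 c = Some z by rewrite /hybrid leqnn F_visited.
have -> : hybrid r c.+1 c.+1 = None.
  rewrite /hybrid ltnn eqxx; case: asboolP => // -[]; exists c.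
  by rewrite mE ge.
congr (_ ++ _ :: _).
  by apply: left_part_eq => j jc; rewrite /hybrid_hole /hybrid jc ltnS ltnW.
apply: right_part_eq => j jc; rewrite /hybrid_hole /hybrid.
by rewrite ltnNge (ltnW (ltnW jc)) ltnNge (ltnW jc) /= !gtn_eqF // ltnW.
Qed.

Lemma row_step r : weak_KKnuth (below r ++ row_word N (G r) ++ above r)
  (below r ++ row_word N (F r) ++ above r).
Proof.
have h c : weak_KKnuth (below r ++ row_word N (G r) ++ above r)
    (below r ++ row_word N (hybrid r c) ++ above r).
  elim: c => [|c IH]; last exact: wk_trans (hybrid_step r c).
  suff -> : row_word N (G r) = row_word N (hybrid r 0) by [].
  apply: eq_row_word => j; rewrite /hybrid ltn0; case: eqP => //= ->.
  by case: asboolP => // -[c' []].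
suff <- : row_word N (hybrid r N) = row_word N (F r) by exact: h.
by apply: eq_in_pmap => j; rewrite mem_iota /hybrid => /= ->.
Qed.

Definition fill_word (H : fill) := rows_word [seq row_word N (H i) | i <- iota 0 N].

Lemma slide_word : weak_KKnuth (fill_word G) (fill_word F).
Proof.
pose st r := rows_word [seq row_word N (G i) | i <- iota r (N - r)] ++ above r.
suff h r : (r <= N)%N -> weak_KKnuth (fill_word G) (st r).
  by have := h N (leqnn _); rewrite /st subnn.
elim: r => [|r IH] rN; first by rewrite /st subn0 cats0.
apply: (wk_trans (IH (ltnW rN))); rewrite /st aboveS -/(below r).
have -> : (N - r = (N - r.+1).+1)%N by lia.
by rewrite /= rows_word_cons -catA; exact: row_step.
Qed.

End SlideWord.

(** * Boxes, coordinates and skew shapes *)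

Lemma box_exists r c : (0 < r <= c)%N -> exists x, box_row x = r /\ box_col x = c.
Proof. by move=> h; exists (@Box (r, c) h). Qed.

Lemma box_valid x : (0 < box_row x <= box_col x)%N.
Proof. exact: box_valP. Qed.

Lemma box_eqP x y : box_row x = box_row y -> box_col x = box_col y -> x = y.
Proof.
move: x y => [[r c] px] [[r' c'] py]; rewrite /box_row /box_col /= => e1 e2.
by apply: val_inj; rewrite /= e1 e2.
Qed.

Lemma box_leE x y : (x <= y)%O = ((box_row x <= box_row y) && (box_col x <= box_col y))%N.
Proof. by []. Qed.

Lemma box_ltE x y : (x < y)%O = [&& (box_row x <= box_row y), (box_col x <= box_col y)
  & (box_row x + box_col x < box_row y + box_col y)]%N.
Proof.
rewrite lt_neqAle box_leE; have [->|ne] := eqVneq x y; first by rewrite ltnn !andbF.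
have : ~ (box_row x = box_row y /\ box_col x = box_col y).
  by case=> e1 e2; case/eqP: ne; exact: box_eqP.
rewrite /=; lia.
Qed.

Definition adjacent (x y : box) : bool :=
  ((box_row y == box_row x) && (box_col y == (box_col x).+1))
  || ((box_row y == (box_row x).+1) && (box_col y == box_col x)).

Lemma coversP x y : covers y x <-> adjacent x y.
Proof.
rewrite /covers box_ltE; have vx := box_valid x; have vy := box_valid y; split.
- case=> h nz; case: (leqP (box_col y) (box_col x)) => hc.
    have [z [zr zc]] : exists z, box_row z = (box_row x).+1 /\ box_col z = box_col x.
      by apply: box_exists; lia.
    rewrite /adjacent; case: (pselect (z = y)) => [<-|ne]; first by rewrite zr zc !eqxx orbT.
    case: nz; exists z; rewrite !box_ltE zr zc; split; first lia.
    have : ~ (box_row z = box_row y /\ box_col z = box_col y).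
      by case=> *; apply/ne/box_eqP.
    by rewrite zr zc; lia.
  have [z [zr zc]] : exists z, box_row z = box_row x /\ box_col z = (box_col x).+1.
    by apply: box_exists; lia.
  rewrite /adjacent; case: (pselect (z = y)) => [<-|ne]; first by rewrite zr zc !eqxx.
  case: nz; exists z; rewrite !box_ltE zr zc; split; first lia.
  have : ~ (box_row z = box_row y /\ box_col z = box_col y).
    by case=> *; apply/ne/box_eqP.
  by rewrite zr zc; lia.
- rewrite /adjacent => h; split; first lia.
  by case=> z []; rewrite !box_ltE; lia.
Qed.

Lemma neighborP x y : neighbor x y <-> adjacent x y || adjacent y x.
Proof.
rewrite /neighbor; split; first by case=> /coversP ->; rewrite ?orbT.
by case/orP => /coversP; [right|left].
Qed.

Definition box_convex (A : {fset box}) : Prop :=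
  forall x z y, x \in A -> y \in A -> (x <= z)%O -> (z <= y)%O -> z \in A.

Definition boxes_upto n : {fset box} :=
  [fset x in pmap insub [seq (r, c) | r <- iota 0 n, c <- iota 0 n]]%fset.

Lemma mem_boxes_upto n x : (x \in boxes_upto n) = (box_col x < n)%N.
Proof.
rewrite !inE; have v := box_valid x.
apply/idP/idP => [|h].
  rewrite mem_pmap => /mapP[[r c] /allpairsP[[r' c'] /= [h1 h2 [-> ->]]]].
  by case: insubP => // u _ uE [->]; move: h2; rewrite mem_iota /box_col uE.
rewrite mem_pmap; apply/mapP; exists (val x); last by rewrite valK.
apply/allpairsP; exists (val x) => /=; rewrite -surjective_pairing.
rewrite !mem_iota; split=> //; rewrite /box_row /box_col in v h *; lia.
Qed.

Lemma box_bound (A : {fset box}) : exists n, forall x, x \in A -> (box_col x < n)%N.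
Proof.
exists (\max_(x : A) box_col (val x)).+1 => x xA; rewrite ltnS.
by rewrite (@leq_bigmax A (fun x => box_col (val x)) [`xA]%fset).
Qed.

Section Shapes.

Lemma skew_convex nu la A : skew nu la A -> box_convex A.
Proof.
case=> snu sla _ -> x z y; rewrite !inE => /andP[xla xnu] /andP[yla ynu] xz zy.
rewrite (snu _ _ zy ynu) andbT; apply: contra xla => zla; exact: sla xz zla.
Qed.

(** The two straight shapes are not determined by the boxes of a tableau. They are eliminated in
    favour of a condition on [A] and [C] alone. *)
Lemma forward_corners A C : (exists nu la, skew nu la A /\ maximal_boxes_of la C) <->
  [/\ box_convex (A `|` C), [disjoint A & C] &
      forall x y, x \in C -> y \in A `|` C -> (y <= x)%O -> y = x].
Proof.
split.
- case=> nu [la [sk [Cla Cmax]]]; have [snu sla lanu AE] := sk.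
  have CxA x : x \in C -> x \in la by move/(fsubsetP Cla).
  have low x y : x \in C -> y \in A `|` C -> (y <= x)%O -> y = x.
    move=> xC /fsetUP[yA|yC] yx.
      by move: yA; rewrite AE inE => /andP[/negP[]]; exact: sla yx (CxA _ xC).
    apply/eqP; rewrite eq_le yx /=; have := Cmax _ _ yC (CxA _ xC).
    by rewrite lt_neqAle yx andbT negbK => /eqP->.
  split=> // [x z y|].
  + move=> xD yD xz zy; case: (boolP (y \in C)) => [yC|yC].
      have xC : x = y by apply: low (le_trans xz zy).
      have -> : z = y by apply/eqP; rewrite eq_le zy -xC xz.
      by rewrite inE yC orbT.
    have yA : y \in A by move: yD; rewrite inE (negPf yC) orbF.
    move: xD => /fsetUP[xA|xC]; first by rewrite inE (skew_convex sk xA yA xz zy).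
    have [->|ne] := eqVneq z x; first by rewrite inE xC orbT.
    have ynu : y \in nu by move: yA; rewrite AE inE => /andP[].
    rewrite inE AE inE (snu _ _ zy ynu) andbT; apply/orP; left; apply/negP => zla.
    by have := Cmax _ _ xC zla; rewrite lt_neqAle eq_sym ne xz.
  + apply/fdisjointP => x; rewrite AE inE => /andP[xla _].
    by apply: contra xla; exact: CxA.
- case=> cv dj low.
  have [n bn] := box_bound (A `|` C).
  (* The lower ideal generated by [A] and [C]; its part outside [A] is the inner shape, in which the
     boxes of [C] are maximal. *)
  pose nu := [fset x in boxes_upto n | `[< exists2 y, y \in A `|` C & (x <= y)%O >]].
  have nuP x : x \in nu <-> exists2 y, y \in A `|` C & (x <= y)%O.
    have -> : (x \in nu) = (x \in boxes_upto n) && `[< exists2 y, y \in A `|` C & (x <= y)%O >] by rewrite inE.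
    rewrite mem_boxes_upto; split; first by case/andP => _ /asboolP.
    move=> [y yD xy]; apply/andP; split; last by apply/asboolP; exists y.
    by have := bn _ yD; move: xy; rewrite box_leE; lia.
  move: nu nuP => nu nuP.
  have cA : box_convex A.
    move=> x z y xA yA xz zy; have : z \in A `|` C.
      by apply: cv xz zy; rewrite inE ?xA ?yA.
    case/fsetUP => // zC; have xz' : x = z by apply: low => //; rewrite inE xA.
    by rewrite -xz'.
  exists nu, (nu `\` A); split; first split.
  + move=> x y xy /nuP[z zD yz]; apply/nuP; exists z => //; exact: le_trans yz.
  + move=> x y xy; rewrite !inE => /andP[yA ynu]; apply/andP; split.
      apply/negP => xA; have [z zD yz] := (nuP y).1 ynu.
      move: zD => /fsetUP[zA|zC]; first by case/negP: yA; exact: cA xy yz.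
      have xz : x = z by apply: low (le_trans xy yz) => //; rewrite inE xA.
      by case/negP: yA; rewrite (_ : y = x) //; apply/eqP; rewrite eq_le xy xz yz.
    have [z zD yz] := (nuP y).1 ynu; apply/nuP; exists z => //; exact: le_trans yz.
  + by apply/fsubsetP => x; rewrite inE => /andP[].
  + apply/fsetP => x; rewrite !inE negb_and negbK; case: (boolP (x \in A)) => xA /=.
      by apply/esym/nuP; exists x; rewrite ?inE ?xA.
    by rewrite andNb.
  split.
  + apply/fsubsetP => x xC; rewrite inE; apply/andP; split.
      by apply/negP => xA; move/fdisjointP: dj => /(_ _ xA); rewrite xC.
    by apply/nuP; exists x; rewrite ?inE ?xC ?orbT.
  + move=> x y xC; rewrite inE => /andP[yA /nuP[z zD yz]]; apply/negP => xy.
    have yD : y \in A `|` C by apply: cv (ltW xy) yz => //; rewrite inE xC orbT.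
    have yC : y \in C by move: yD; rewrite inE (negPf yA).
    have xyE : x = y by apply: low (ltW xy); rewrite ?inE ?xC ?orbT.
    by rewrite xyE ltxx in xy.
Qed.

Lemma reverse_corners A C : (exists nu la, skew nu la A /\ minimal_boxes_outside nu C) <->
  [/\ box_convex (A `|` C), [disjoint A & C] &
      forall x y, x \in C -> y \in A `|` C -> (x <= y)%O -> y = x].
Proof.
split.
- case=> nu [la [sk [Cnu Cmin]]]; have [snu sla lanu AE] := sk.
  have Anu x : x \in A -> x \in nu by rewrite AE inE => /andP[].
  have high x y : x \in C -> y \in A `|` C -> (x <= y)%O -> y = x.
    move=> xC /fsetUP[yA|yC] xy.
      by have := Cnu _ xC; rewrite (snu _ _ xy (Anu _ yA)).
    apply/esym/eqP; rewrite eq_le xy /=; have := Cmin _ _ yC (Cnu _ xC).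
    by rewrite lt_neqAle xy andbT negbK => /eqP->.
  split=> // [x z y|].
  + move=> xD yD xz zy; case: (boolP (x \in C)) => [xC|xC].
      have yx : y = x by apply: high (le_trans xz zy).
      have -> : z = x by apply/eqP; rewrite eq_le xz -yx zy.
      by rewrite inE xC orbT.
    have xA : x \in A by move: xD; rewrite inE (negPf xC) orbF.
    move: yD => /fsetUP[yA|yC]; first by rewrite inE (skew_convex sk xA yA xz zy).
    have [->|ne] := eqVneq z y; first by rewrite inE yC orbT.
    rewrite inE; apply/orP; left; rewrite AE inE; apply/andP; split.
      apply/negP => zla; move: xA; rewrite AE inE => /andP[/negP[]]; exact: sla xz zla.
    apply/negPn/negP => znu.
    by have := Cmin _ _ yC znu; rewrite lt_neqAle ne zy.
  + by apply/fdisjointP => x /Anu xnu; apply/negP => /Cnu; rewrite xnu.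
- case=> cv dj high.
  have [n bn] := box_bound (A `|` C).
  (* The boxes strictly below [C] must belong to the outer shape, for otherwise [C] would not be
     minimal outside it. *)
  pose nu := [fset x in boxes_upto n |
    `[< (exists2 y, y \in A & (x <= y)%O) \/ (exists2 y, y \in C & (x < y)%O) >]].
  have nuP x : x \in nu <->
      (exists2 y, y \in A & (x <= y)%O) \/ (exists2 y, y \in C & (x < y)%O).
    have -> : (x \in nu) = (x \in boxes_upto n) && `[< (exists2 y, y \in A & (x <= y)%O) \/ (exists2 y, y \in C & (x < y)%O) >] by rewrite inE.
    rewrite mem_boxes_upto; split; first by case/andP => _ /asboolP.
    move=> h; apply/andP; split; last by apply/asboolP.
    case: h => -[y yD xy]; (have : (box_col y < n)%N by apply: bn; rewrite inE yD ?orbT).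
      by move: xy; rewrite box_leE; lia.
    by move: xy; rewrite box_ltE; lia.
  move: nu nuP => nu nuP.
  have cA : box_convex A.
    move=> x z y xA yA xz zy; have : z \in A `|` C.
      by apply: cv xz zy; rewrite inE ?xA ?yA.
    case/fsetUP => // zC; have <- : y = z by apply: high => //; rewrite inE yA.
    by [].
  have snu : straight_shape nu.
    move=> x y xy /nuP[[z zA yz]|[z zC yz]]; apply/nuP; [left|right]; exists z => //.
      exact: le_trans yz.
    exact: le_lt_trans yz.
  exists nu, (nu `\` A); split; first split=> //.
  + move=> x y xy; rewrite !inE => /andP[yA ynu]; apply/andP; split.
      apply/negP => xA; move/nuP: ynu => [[z zA yz]|[z zC yz]].
        by case/negP: yA; exact: cA xy yz.
      have yD : y \in A `|` C.
        by apply: cv xy (ltW yz); rewrite inE ?xA ?zC ?orbT.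
      have yC : y \in C by move: yD; rewrite inE (negPf yA).
      have zy : z = y by apply: high (ltW yz); rewrite ?inE ?zC ?orbT.
      by rewrite zy ltxx in yz.
    exact: snu xy ynu.
  + by apply/fsubsetP => x; rewrite inE => /andP[].
  + apply/fsetP => x; rewrite !inE negb_and negbK; case: (boolP (x \in A)) => xA /=.
      by apply/esym/nuP; left; exists x.
    by rewrite andNb.
  split.
  + move=> x xC; apply/negP => /nuP[[y yA xy]|[y yC xy]].
      have yx : y = x by apply: high xy => //; rewrite inE yA.
      by move/fdisjointP: dj => /(_ _ yA); rewrite yx xC.
    have yx : y = x by apply: high (ltW xy); rewrite ?inE ?yC ?orbT.
    by rewrite yx ltxx in xy.
  + by move=> x y xC ynu; apply/negP => yx; case/negP: ynu; apply/nuP; right; exists x.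
Qed.

End Shapes.

(** * Swaps of bullets and their inverses *)

Section Swaps.
Implicit Types (Y : {fmap box -> option int}) (T : tableau) (C : {fset box}).

Definition has_adjacent Y x v := exists2 y, adjacent x y || adjacent y x & Y.[? y] = Some v.

Lemma swap_fnd s s' Y x : (swap s s' Y).[? x] =
  match Y.[? x] with
  | Some v => Some (if (v == s) && `[< has_adjacent Y x s' >] then s'
                    else if (v == s') && `[< has_adjacent Y x s >] then s else v)
  | None => None
  end.
Proof.
have hE (xD : x \in domf Y) v :
    has_neighbor_valued [`xD]%fset v = `[< has_adjacent Y x v >].
  apply/existsP/asboolP => [[y /andP[/asboolP/neighborP xy /eqP yv]]|[y xy yv]].
    by exists (val y) => //; rewrite -yv Some_fnd.
  have yD : y \in domf Y by rewrite -fndSome yv.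
  exists [`yD]%fset; apply/andP; split; first by apply/asboolP/neighborP.
  by move: yv; rewrite (in_fnd yD) => -[->].
have [xD|xD] := boolP (x \in domf Y); last by rewrite !not_fnd.
by rewrite (in_fnd xD) (in_fnd (f := swap s s' Y) xD) ffunE !hE.
Qed.

(* [val_lt k] orders values with the bullet strictly between [k] and [k + 1]. *)
Definition val_lt (k : int) (u v : option int) : bool :=
  match u, v with
  | Some a, Some b => a < b
  | Some a, None => a <= k
  | None, Some b => k < b
  | None, None => false
  end.

Definition bullet_inc k Y :=
  box_convex (domf Y) /\
  forall x y u v, Y.[? x] = Some u -> Y.[? y] = Some v -> (x < y)%O -> val_lt k u v.

Lemma adjacent_lt x y : adjacent x y -> (x < y)%O.
Proof. by rewrite box_ltE /adjacent; lia. Qed.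

Lemma lt_between_adjacent x y : (x < y)%O ->
  (forall z, (x < z)%O -> (z < y)%O -> False) -> adjacent x y.
Proof. by move=> xy h; apply/coversP; split=> // -[z [xz zy]]; exact: h xz zy. Qed.

(** No value fits strictly between the bullet and the integer next to it in the order, so by
    convexity no box fits between two such boxes. *)
Lemma bullet_inc_adjacent k k' Y x y (u v : option int) : bullet_inc k Y ->
  Y.[? x] = Some u -> Y.[? y] = Some v -> (x < y)%O ->
  (u = Some k' /\ v = None /\ k' = k \/ u = None /\ v = Some k' /\ k' = k + 1) ->
  adjacent x y.
Proof.
move=> [cv inc] Yx Yy xy h; apply: lt_between_adjacent => // z xz zy.
have : z \in domf Y.
  by apply: (cv x z y); rewrite -?fndSome ?Yx ?Yy // ltW.
rewrite -fndSome; case Yz: (Y.[? z]) => [w|] // _.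
have := inc _ _ _ _ Yx Yz xz; have := inc _ _ _ _ Yz Yy zy.
by case: h => -[-> [-> ->]]; case: w {Yz} => [w|] /=; lia.
Qed.

Definition swap_value k (p q : bool) (v : option int) : option int :=
  if v is Some a then if (a == k) && p then None else Some a
  else if q then Some k else None.

Lemma swap_fnd_bullet k Y x : (swap (Some k) bullet Y).[? x] =
  omap (swap_value k `[< has_adjacent Y x None >] `[< has_adjacent Y x (Some k) >]) Y.[? x].
Proof. by rewrite swap_fnd; case: (Y.[? x]) => [[a|]|] //=; case: ifP. Qed.

Lemma has_adjacent_pair Y x y u v : adjacent x y -> Y.[? x] = Some u -> Y.[? y] = Some v ->
  `[< has_adjacent Y x v >] /\ `[< has_adjacent Y y u >].
Proof. by move=> a Yx Yy; split; apply/asboolP; [exists y|exists x]; rewrite ?a ?orbT. Qed.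

(** The bullet passes from just above [k] to just below it. The only pairs at risk consist of a [k]
    below a bullet in the order of boxes; they are adjacent, so both of their entries are
    exchanged. *)
Lemma swap_dec k Y : bullet_inc k Y -> bullet_inc (k - 1) (swap (Some k) bullet Y).
Proof.
move=> inc; split; first by case: inc.
move=> x y u v; rewrite !swap_fnd_bullet.
case Yx: (Y.[? x]) => [ox|] // [<-]; case Yy: (Y.[? y]) => [oy|] // [<-] xy.
have h := inc.2 _ _ _ _ Yx Yy xy.
case: ox Yx h => [a|] Yx; case: oy Yy => [b|] Yy //= h; try by do !case: ifP => /=; lia.
case: (eqVneq a k) Yx h => [->|nk] Yx h; last by do !case: ifP => /=; lia.
have a1 : adjacent x y.
  by apply: (bullet_inc_adjacent (k' := k) inc Yx Yy xy); left.
have [-> ->] := has_adjacent_pair a1 Yx Yy; rewrite ?eqxx /=; lia.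
Qed.

Lemma swap_inc k Y : bullet_inc (k - 1) Y -> bullet_inc k (swap (Some k) bullet Y).
Proof.
move=> inc; split; first by case: inc.
move=> x y u v; rewrite !swap_fnd_bullet.
case Yx: (Y.[? x]) => [ox|] // [<-]; case Yy: (Y.[? y]) => [oy|] // [<-] xy.
have h := inc.2 _ _ _ _ Yx Yy xy.
case: ox Yx h => [a|] Yx; case: oy Yy => [b|] Yy //= h; try by do !case: ifP => /=; lia.
case: (eqVneq b k) Yy h => [->|nk] Yy h; last by do !case: ifP => /=; lia.
have a1 : adjacent x y.
  by apply: (bullet_inc_adjacent (k' := k) inc Yx Yy xy); right; do !split=> //; lia.
have [-> ->] := has_adjacent_pair a1 Yx Yy; rewrite ?eqxx /=; lia.
Qed.

(** Adjacent boxes carry different values. So an exchanged entry still sees its exchanged partner,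
    and an entry without a partner gains none. *)
Lemma swapK k k' Y : bullet_inc k' Y -> swap (Some k) bullet (swap (Some k) bullet Y) = Y.
Proof.
move=> inc; apply/fmapP => x; rewrite !swap_fnd_bullet.
case Yx: (Y.[? x]) => [v|] //=.
have ne y w : adjacent x y || adjacent y x -> Y.[? y] = Some w -> Y.[? x] = Some w -> False.
  move=> + Yy {}Yx.
  case/orP => /adjacent_lt lt; [have := inc.2 _ _ _ _ Yx Yy lt|have := inc.2 _ _ _ _ Yy Yx lt];
    by case: w {Yx Yy} => [w|] //=; rewrite ltxx.
have e1 : v = Some k -> `[< has_adjacent Y x None >] ->
    `[< has_adjacent (swap (Some k) bullet Y) x (Some k) >].
  move=> vk /asboolP[y a Yy]; apply/asboolP; exists y => //.
  rewrite swap_fnd_bullet Yy /=; suff -> : `[< has_adjacent Y y (Some k) >] by [].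
  by apply/asboolP; exists x; [rewrite orbC|rewrite Yx vk].
have e2 : v = None -> `[< has_adjacent Y x (Some k) >] ->
    `[< has_adjacent (swap (Some k) bullet Y) x None >].
  move=> vk /asboolP[y a Yy]; apply/asboolP; exists y => //.
  rewrite swap_fnd_bullet Yy /= eqxx; suff -> : `[< has_adjacent Y y None >] by [].
  by apply/asboolP; exists x; [rewrite orbC|rewrite Yx vk].
have e3 : v = Some k -> ~~ `[< has_adjacent Y x None >] ->
    ~~ `[< has_adjacent (swap (Some k) bullet Y) x None >].
  move=> vk n; apply/asboolP => -[y a]; rewrite swap_fnd_bullet.
  case Yy: (Y.[? y]) => [[w|]|] //=.
    by case: (eqVneq w k) => // wk; case: (ne _ _ a Yy); rewrite Yx vk wk.
  by case/asboolP: n; exists y.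
have e4 : v = None -> ~~ `[< has_adjacent Y x (Some k) >] ->
    ~~ `[< has_adjacent (swap (Some k) bullet Y) x (Some k) >].
  move=> vk n; apply/asboolP => -[y a]; rewrite swap_fnd_bullet.
  case Yy: (Y.[? y]) => [[w|]|] //=.
    case: ifP => // _ [wk]; case/asboolP: n; exists y => //; by rewrite Yy wk.
  by case: (ne _ _ a Yy); rewrite Yx vk.
case: v Yx e1 e2 e3 e4 => [a|] Yx e1 e2 e3 e4 /=; last first.
  by case: (boolP `[< has_adjacent Y x (Some k) >]) => h /=; rewrite ?eqxx ?e2 // (negPf (e4 _ _)).
case: (eqVneq a k) => [ak|nk] /=; last by rewrite (negPf nk).
case: (boolP `[< has_adjacent Y x None >]) => h /=.
  by rewrite e1 ?ak.
by rewrite ak eqxx (negPf (e3 _ _)) ?ak.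
Qed.

(** Half-open intervals given by their length include the empty one and allow induction on [n]. *)
Definition interval a n : seq int := [seq a + k%:Z | k <- iota 0 n].

Lemma intervalS a n : interval a n.+1 = rcons (interval a n) (a + n%:Z).
Proof. by rewrite /interval -addn1 iotaD map_cat cats1. Qed.

Definition swaps (s : seq int) Y := foldl (fun Y s => swap (Some s) bullet Y) Y s.

Lemma swaps_rcons s k Y : swaps (rcons s k) Y = swap (Some k) bullet (swaps s Y).
Proof. by rewrite /swaps -cats1 foldl_cat. Qed.

Lemma swaps_cons s k Y : swaps (k :: s) Y = swaps s (swap (Some k) bullet Y).
Proof. by []. Qed.

Lemma swaps_up a n Y : bullet_inc (a - 1) Y ->
  bullet_inc (a + n%:Z - 1) (swaps (interval a n) Y) /\
  swaps (rev (interval a n)) (swaps (interval a n) Y) = Y.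
Proof.
elim: n => [|n IH] inc; first by rewrite addr0.
have [i1 i2] := IH inc; rewrite intervalS swaps_rcons rev_rcons swaps_cons; split.
  have -> : a + n.+1%:Z - 1 = a + n%:Z by lia.
  exact: swap_inc.
by rewrite (swapK _ i1).
Qed.

Lemma swaps_down a n Y : bullet_inc (a + n%:Z - 1) Y ->
  bullet_inc (a - 1) (swaps (rev (interval a n)) Y) /\
  swaps (interval a n) (swaps (rev (interval a n)) Y) = Y.
Proof.
elim: n Y => [|n IH] Y inc; first by rewrite addr0 in inc.
rewrite intervalS swaps_rcons rev_rcons swaps_cons.
have inc1 : bullet_inc (a + n%:Z) Y by move: inc; congr bullet_inc; lia.
have [i1 i2] := IH _ (swap_dec inc1).
by split=> //; rewrite i2 (swapK _ inc1).
Qed.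

Definition values_in (P : int -> Prop) Y := forall x a, Y.[? x] = Some (Some a) -> P a.

Lemma swap_values P k Y : P k -> values_in P Y -> values_in P (swap (Some k) bullet Y).
Proof.
move=> Pk PY x a; rewrite swap_fnd_bullet.
case Yx: (Y.[? x]) => [[b|]|] //=; first by case: ifP => // _ [<-]; exact: PY Yx.
by case: ifP => // _ [<-].
Qed.

Lemma swaps_values (P : int -> Prop) s Y : (forall k, k \in s -> P k) -> values_in P Y ->
  values_in P (swaps s Y).
Proof.
elim: s Y => //= k s IH Y Ps PY; apply: IH => [j js|].
  by apply: Ps; rewrite inE js orbT.
by apply: swap_values => //; apply: Ps; rewrite mem_head.
Qed.

Definition bullets Y : {fset box} := [fset x in domf Y | Y.[? x] == Some None].

Lemma mem_bullets Y x : (x \in bullets Y) = (Y.[? x] == Some None).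
Proof.
rewrite !inE /=; case: (boolP (x \in domf Y)) => //= xD.
by rewrite not_fnd.
Qed.

Lemma add_bullets_fnd T C x : (add_bullets T C).[? x] =
  if x \in domf T `|` C then Some T.[? x] else None.
Proof.
case: ifP => [xD|/negbT xD]; last by rewrite not_fnd.
by rewrite (in_fnd (f := add_bullets T C) xD) ffunE.
Qed.

Lemma delete_bullets_fnd Y x : (delete_bullets Y).[? x] = obind id Y.[? x].
Proof. by rewrite /delete_bullets fnd_reducef. Qed.

Lemma delete_add_bullets T C : delete_bullets (add_bullets T C) = T.
Proof.
apply/fmapP => x; rewrite delete_bullets_fnd add_bullets_fnd inE.
by case: (boolP (x \in domf T)) => //= xT; rewrite not_fnd //; case: ifP.
Qed.

Lemma add_delete_bullets Y : add_bullets (delete_bullets Y) (bullets Y) = Y.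
Proof.
apply/fmapP => x; rewrite add_bullets_fnd inE mem_bullets -fndSome delete_bullets_fnd.
by case: (Y.[? x]) => [[a|]|].
Qed.

Lemma disjoint_bullets Y : [disjoint domf (delete_bullets Y) & bullets Y].
Proof.
apply/fdisjointP => x; rewrite -fndSome delete_bullets_fnd mem_bullets.
by case: (Y.[? x]) => [[a|]|].
Qed.

End Swaps.

(** * Slides without shapes, and their reversal *)

Lemma increasingE T : increasing T <-> (exists nu la, skew nu la (domf T)) /\
  forall x y a b, T.[? x] = Some a -> T.[? y] = Some b -> (x < y)%O -> a < b.
Proof.
split=> -[sk inc]; split=> //.
- move=> x y a b Tx Ty xy.
  have xT : x \in domf T by rewrite -fndSome Tx.
  have yT : y \in domf T by rewrite -fndSome Ty.
  have := inc [`xT] [`yT] xy; move: Tx Ty.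
  by rewrite (in_fnd xT) (in_fnd yT) => -[->] [->].
- by move=> x y xy; apply: inc xy; rewrite Some_fnd.
Qed.

Definition tab_values (T : tableau) a n :=
  forall x v, T.[? x] = Some v -> a <= v < a + n%:Z.

Lemma has_values_inE T a b : has_values_in T a b <->
  forall x v, T.[? x] = Some v -> a <= v <= b.
Proof.
split=> h x; last by apply: (h (val x)); rewrite Some_fnd.
move=> v Tx; have xT : x \in domf T by rewrite -fndSome Tx.
by have := h [`xT]; move: Tx; rewrite (in_fnd xT) => -[->].
Qed.

Lemma int_interval_ex a b : exists n, int_interval a b = interval a n /\
  forall v, (a <= v <= b) = (a <= v < a + n%:Z).
Proof.
rewrite /int_interval; case: ifP => ab; last by exists 0%N; split=> // v; lia.
by exists `|b - a|%N.+1; split=> // v; lia.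
Qed.

Lemma interval_int a n : interval a n = int_interval a (a + n%:Z - 1).
Proof.
rewrite /int_interval; case: ifP => h; last first.
  by have -> : n = 0%N by lia.
by have -> : (`|(a + n%:Z - 1 - a)%R|.+1 = n)%N by lia.
Qed.

Lemma interval_mem a n k : k \in interval a n -> a <= k < a + n%:Z.
Proof. by move=> /mapP[j]; rewrite mem_iota => h ->; lia. Qed.

(** Data common to both directions: [k = a - 1] puts the bullets below all values for a forward
    slide, and [k = a + n - 1] puts them above all values for a reverse one. *)
Definition slide_start k (T : tableau) (C : {fset box}) a n :=
  [/\ [disjoint domf T & C], tab_values T a n & bullet_inc k (add_bullets T C)].

Lemma slide_start_increasing k T C a n (nu la : {fset box}) : slide_start k T C a n ->
  skew nu la (domf T) -> increasing T.
Proof.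
move=> [_ _ [_ inc]] sk; apply/increasingE; split; first by exists nu, la.
move=> x y b c Tx Ty xy.
have xT : x \in domf T by rewrite -fndSome Tx.
have yT : y \in domf T by rewrite -fndSome Ty.
by apply: (inc x y (Some b) (Some c)) => //; rewrite add_bullets_fnd inE ?xT ?yT ?Tx ?Ty.
Qed.

Lemma forward_slideE T T' : forward_slide T T' <->
  exists C a n, slide_start (a - 1) T C a n /\ T' = slide (interval a n) C T.
Proof.
split.
- case=> nu [la [C [a [b [/increasingE[_ inc] sk /has_values_inE hv mx ->]]]]].
  have [n [-> hn]] := int_interval_ex a b.
  have [cv dj low] := (forward_corners (domf T) C).1 (ex_intro _ _ (ex_intro _ _ (conj sk mx))).
  exists C, a, n; split=> //; split=> //; first by move=> x v /hv; rewrite hn.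
  split=> // x y u v; rewrite !add_bullets_fnd.
  case: ifP => // xD [<-]; case: ifP => // yD [<-] xy.
  case Tx: (T.[? x]) => [b'|]; case Ty: (T.[? y]) => [c|] //=.
  + exact: inc xy.
  + have yC : y \in C by move: yD; rewrite inE -fndSome Ty.
    by have e := low _ _ yC xD (ltW xy); rewrite e ltxx in xy.
  + by have := hv _ _ Ty; lia.
  + have yC : y \in C by move: yD; rewrite inE -fndSome Ty.
    by have e := low _ _ yC xD (ltW xy); rewrite e ltxx in xy.
- case=> C [a [n [st ->]]]; have [dj hv [cv inc]] := st.
  have [nu [la [sk mx]]] : exists nu la, skew nu la (domf T) /\ maximal_boxes_of la C.
    apply/forward_corners; split=> // x y xC yD yx; apply/eqP/negPn/negP => ne.
    have lt : (y < x)%O by rewrite lt_neqAle ne.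
    have Tx : T.[? x] = None.
      by apply: not_fnd; apply/negP => xT; move/fdisjointP: dj => /(_ _ xT); rewrite xC.
    have := inc y x T.[? y] T.[? x]; rewrite !add_bullets_fnd yD !inE xC orbT Tx.
    move=> /(_ erefl erefl lt); case Ty: (T.[? y]) => [v|] //=.
    by have := hv _ _ Ty; lia.
  exists nu, la, C, a, (a + n%:Z - 1); split=> //.
  + exact: slide_start_increasing st sk.
  + by apply/has_values_inE => x v /hv; lia.
  + by rewrite interval_int.
Qed.

Lemma reverse_slideE T T' : reverse_slide T T' <->
  exists C a n, slide_start (a + n%:Z - 1) T C a n /\ T' = slide (rev (interval a n)) C T.
Proof.
split.
- case=> nu [la [C [a [b [/increasingE[_ inc] sk /has_values_inE hv mx ->]]]]].
  have [n [-> hn]] := int_interval_ex a b.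
  have [cv dj low] := (reverse_corners (domf T) C).1 (ex_intro _ _ (ex_intro _ _ (conj sk mx))).
  exists C, a, n; split=> //; split=> //; first by move=> x v /hv; rewrite hn.
  split=> // x y u v; rewrite !add_bullets_fnd.
  case: ifP => // xD [<-]; case: ifP => // yD [<-] xy.
  case Tx: (T.[? x]) => [b'|]; case Ty: (T.[? y]) => [c|] //=.
  + exact: inc xy.
  + by have := hv _ _ Tx; rewrite hn; lia.
  + have xC : x \in C by move: xD; rewrite inE -fndSome Tx.
    by have e := low _ _ xC yD (ltW xy); rewrite e ltxx in xy.
  + have xC : x \in C by move: xD; rewrite inE -fndSome Tx.
    by have e := low _ _ xC yD (ltW xy); rewrite e ltxx in xy.
- case=> C [a [n [st ->]]]; have [dj hv [cv inc]] := st.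
  have [nu [la [sk mx]]] : exists nu la, skew nu la (domf T) /\ minimal_boxes_outside nu C.
    apply/reverse_corners; split=> // x y xC yD xy; apply/eqP/negPn/negP => ne.
    have lt : (x < y)%O by rewrite lt_neqAle eq_sym ne.
    have Tx : T.[? x] = None.
      by apply: not_fnd; apply/negP => xT; move/fdisjointP: dj => /(_ _ xT); rewrite xC.
    have := inc x y T.[? x] T.[? y]; rewrite !add_bullets_fnd yD !inE xC orbT Tx.
    move=> /(_ erefl erefl lt); case Ty: (T.[? y]) => [v|] //=.
    by have := hv _ _ Ty; lia.
  exists nu, la, C, a, (a + n%:Z - 1); split=> //.
  + exact: slide_start_increasing st sk.
  + by apply/has_values_inE => x v /hv; lia.
  + by rewrite interval_int.
Qed.

Lemma slideE s C T : slide s C T = delete_bullets (swaps s (add_bullets T C)).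
Proof. by []. Qed.

Lemma slide_values a n s C T : {subset s <= interval a n} -> tab_values T a n ->
  tab_values (slide s C T) a n.
Proof.
move=> sub hv x v; rewrite slideE delete_bullets_fnd => e.
have : values_in (fun v => a <= v < a + n%:Z) (swaps s (add_bullets T C)).
  apply: swaps_values => [k /sub|y b]; first exact: interval_mem.
  by rewrite add_bullets_fnd; case: ifP => // _ [/hv].
move=> H; apply: (H x); move: e.
by case: ((swaps s (add_bullets T C)).[? x]) => [[w|]|] //= [->].
Qed.

(** The bullets left at the end of a slide are the starting boxes of its inverse. *)
Lemma slide_back k k' s s' T C a n : slide_start k T C a n ->
  {subset s <= interval a n} ->
  bullet_inc k' (swaps s (add_bullets T C)) ->
  swaps s' (swaps s (add_bullets T C)) = add_bullets T C ->
  exists2 C', slide_start k' (slide s C T) C' a n & T = slide s' C' (slide s C T).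
Proof.
move=> [dj hv inc] sub inc' e.
exists (bullets (swaps s (add_bullets T C))); first split.
- exact: disjoint_bullets.
- exact: slide_values.
- by rewrite slideE add_delete_bullets.
- by rewrite !slideE add_delete_bullets e delete_add_bullets.
Qed.

Lemma forward_reverse T T' : forward_slide T T' <-> reverse_slide T' T.
Proof.
split.
- move=> /forward_slideE[C [a [n [st ->]]]]; have [_ _ inc] := st.
  have [inc' e] := swaps_up n inc.
  have [C' st' Te] := slide_back st (fun x h => h) inc' e.
  by apply/reverse_slideE; exists C', a, n.
- move=> /reverse_slideE[C [a [n [st ->]]]]; have [_ _ inc] := st.
  have [inc' e] := swaps_down inc.
  have [|C' st' Te] := slide_back st _ inc' e; first by move=> x; rewrite mem_rev.
  by apply/forward_slideE; exists C', a, n.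
Qed.

Lemma jdt_sym T T' : jdt_equiv T T' -> jdt_equiv T' T.
Proof.
elim=> [{}T {}T'|{}T|{}T U {}T' _ h1 _ h2].
- by case=> h; apply: rt_step; [right|left]; apply/forward_reverse.
- exact: rt_refl.
- exact: rt_trans h2 h1.
Qed.

Lemma jdt_trans U T T' : jdt_equiv T U -> jdt_equiv U T' -> jdt_equiv T T'.
Proof. exact: rt_trans. Qed.

(** * The path of the bullets *)

Definition at_pos (V : Type) (Y : {fmap box -> V}) r c : option V :=
  if (insub (r, c) : option box) is Some x then Y.[? x] else None.

Lemma at_posE V (Y : {fmap box -> V}) x : at_pos Y (box_row x) (box_col x) = Y.[? x].
Proof. by rewrite /at_pos /box_row /box_col -surjective_pairing valK. Qed.

Lemma at_pos_some V (Y : {fmap box -> V}) r c v : at_pos Y r c = Some v ->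
  exists x, [/\ box_row x = r, box_col x = c & Y.[? x] = Some v].
Proof.
rewrite /at_pos; case: insubP => // x _ xE Yx; exists x.
by rewrite /box_row /box_col xE.
Qed.

Lemma at_pos_valid V (Y : {fmap box -> V}) r c v : at_pos Y r c = Some v ->
  (0 < r <= c)%N.
Proof. by move=> /(@at_pos_some _ _ _ _ _)[x [<- <- _]]; exact: box_valid. Qed.

Lemma at_pos_ext V (Y Z : {fmap box -> V}) : (forall r c, at_pos Y r c = at_pos Z r c) -> Y = Z.
Proof. by move=> h; apply/fmapP => x; rewrite -!at_posE. Qed.

(** The boxes that have held a bullet once the swap with [k] is done. A bullet spreads to the right
    or lower neighbour with the smaller entry, and to both if these are equal. *)
Inductive visited (G : fill) (C : nat -> nat -> Prop) (k : int) : nat -> nat -> Prop :=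
| visited_start r c : C r c -> visited G C k r c
| visited_right r c x : visited G C k r c -> G r c.+1 = Some x ->
    slide_min G r c = Some x -> x <= k -> visited G C k r c.+1
| visited_down r c x : visited G C k r c -> G r.+1 c = Some x ->
    slide_min G r c = Some x -> x <= k -> visited G C k r.+1 c.

Lemma adjacent_bullet k Y x : bullet_inc (k - 1) Y -> Y.[? x] = Some None ->
  has_adjacent Y x (Some k) <-> at_pos Y (box_row x) (box_col x).+1 = Some (Some k) \/
    at_pos Y (box_row x).+1 (box_col x) = Some (Some k).
Proof.
move=> inc Yx; split.
- case=> y /orP[] a Yy; last first.
    by have := inc.2 _ _ _ _ Yy Yx (adjacent_lt a); rewrite /=; lia.
  by move: a; rewrite /adjacent => /orP[] /andP[/eqP <- /eqP <-]; rewrite at_posE; [left|right].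
- case=> /(@at_pos_some _ _ _ _ _)[y [e1 e2 Yy]]; exists y => //;
    by rewrite /adjacent e1 e2 !eqxx ?orbT.
Qed.

Lemma adjacent_value k Y x : bullet_inc (k - 1) Y -> Y.[? x] = Some (Some k) ->
  has_adjacent Y x None <->
    (exists c', box_col x = c'.+1 /\ at_pos Y (box_row x) c' = Some None) \/
    (exists r', box_row x = r'.+1 /\ at_pos Y r' (box_col x) = Some None).
Proof.
move=> inc Yx; split.
- case=> y /orP[] a Yy.
    by have := inc.2 _ _ _ _ Yx Yy (adjacent_lt a); rewrite /=; lia.
  move: a; rewrite /adjacent => /orP[] /andP[/eqP e1 /eqP e2].
    by left; exists (box_col y); rewrite e1 at_posE.
  by right; exists (box_row y); rewrite e2 at_posE.
- case=> -[j [e /(@at_pos_some _ _ _ _ _)[y [e1 e2 Yy]]]]; exists y => //;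
    by rewrite /adjacent e e1 e2 !eqxx ?orbT.
Qed.

Section Visited.
Variables (G : fill) (C : nat -> nat -> Prop).
Hypothesis C_empty : forall r c, C r c -> G r c = None.
Hypothesis G_inc : forall r c r' c' a b, G r c = Some a -> G r' c' = Some b ->
  (r <= r')%N -> (c <= c')%N -> (r + c < r' + c')%N -> a < b.
Local Notation m := (slide_min G).
Local Notation V := (visited G C).

Lemma slide_min_some r c x : m r c = Some x ->
  (G r c.+1 = Some x \/ G r.+1 c = Some x) /\
  (forall y, G r c.+1 = Some y \/ G r.+1 c = Some y -> x <= y).
Proof.
rewrite /slide_min; case: (G r c.+1) => [a|]; case: (G r.+1 c) => [b|] //= [<-];
  by split; [rewrite ?minEle; try case: ifP; auto
    |move=> y []// [<-]; rewrite ?ge_min ?lexx ?orbT].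
Qed.

Lemma slide_min_exists r c y : G r c.+1 = Some y \/ G r.+1 c = Some y ->
  exists2 x, m r c = Some x & x <= y.
Proof. by case; [exact: min_right|exact: min_down]. Qed.

Lemma visited_value k r c x : V k r c -> G r c = Some x -> x <= k.
Proof. by case=> {r c} [r c /C_empty ->|r c y _ -> _ h [<-]|r c y _ -> _ h [<-]]. Qed.

Lemma slide_min_gt r c g x : G r c = Some g -> m r c = Some x -> g < x.
Proof.
by move=> Gg /slide_min_some[[] Gx _]; apply: G_inc Gg Gx _ _ _; lia.
Qed.

(** A box entered at stage [k] held [k] itself, so its bullet can leave only for a larger value;
    hence each stage depends on the previous one alone. *)
Lemma visitedS k r c : V k r c <-> V (k - 1) r c \/
  G r c = Some k /\ ((exists c', [/\ c = c'.+1, V (k - 1) r c' & m r c' = Some k]) \/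
    (exists r', [/\ r = r'.+1, V (k - 1) r' c & m r' c = Some k])).
Proof.
split.
- elim=> {r c} [r c Cc|r c x _ IH Gx mx xk|r c x _ IH Gx mx xk]; first by left; exact: visited_start.
  + have {}IH : V (k - 1) r c.
      case: IH => // -[Gk _]; have := slide_min_gt Gk mx; lia.
    have [xk'|xk'] : x = k \/ x <= k - 1 by lia.
      by rewrite xk' in Gx mx *; right; split=> //; left; exists c.
    by left; exact: visited_right IH Gx mx xk'.
  + have {}IH : V (k - 1) r c.
      case: IH => // -[Gk _]; have := slide_min_gt Gk mx; lia.
    have [xk'|xk'] : x = k \/ x <= k - 1 by lia.
      by rewrite xk' in Gx mx *; right; split=> //; right; exists r.
    by left; exact: visited_down IH Gx mx xk'.
- have mono r' c' : V (k - 1) r' c' -> V k r' c'.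
    elim=> {r' c'} [r' c' Cc|r' c' x _ IH Gx mx xk|r' c' x _ IH Gx mx xk].
    + exact: visited_start.
    + by apply: visited_right Gx mx _ => //; lia.
    + by apply: visited_down Gx mx _ => //; lia.
  case=> [/mono //|[Gk [[c' [cE /mono v mk]]|[r' [rE /mono v mk]]]]]; subst.
  + exact: visited_right v Gk mk (lexx k).
  + exact: visited_down v Gk mk (lexx k).
Qed.

(** A bullet waits in its box until the swaps reach the smaller of the two neighbouring entries. *)
Definition partial_value k r c : option int :=
  if m r c is Some x then if x <= k then Some x else None else None.

Definition slide_state k (Y : {fmap box -> option int}) := bullet_inc k Y /\
  forall r c, (V k r c -> at_pos Y r c = Some (partial_value k r c)) /\
    (~ V k r c -> at_pos Y r c = omap Some (G r c)).

(** Before the swap with [k], the value [k] still stands exactly where [G] has it, since visited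
    boxes hold smaller values or bullets. So the neighbours with which a bullet is exchanged can be
    read off [G]. *)
Lemma slide_state_step k Y : slide_state (k - 1) Y -> slide_state k (swap (Some k) bullet Y).
Proof.
move=> [inc st]; split; first exact: swap_inc.
have Vpos r c : V (k - 1) r c -> exists x, [/\ box_row x = r, box_col x = c &
    Y.[? x] = Some (partial_value (k - 1) r c)].
  by move=> v; have [/(_ v) /(@at_pos_some _ _ _ _ _)[x xP] _] := st r c; exists x.
have Gpos r c : ~ V (k - 1) r c -> at_pos Y r c = omap Some (G r c) by case: (st r c).
have Gk r c : G r c = Some k -> ~ V (k - 1) r c.
  by move=> Gk /visited_value/(_ Gk); lia.
have bul r c : at_pos Y r c = Some None -> V (k - 1) r c /\ partial_value (k - 1) r c = None.
  move=> e; have [v|nv] := pselect (V (k - 1) r c).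
    by have [/(_ v)] := st r c; rewrite e => -[].
  by move: e; rewrite Gpos //; case: (G r c).
have valk r c : at_pos Y r c = Some (Some k) <-> G r c = Some k.
  split=> [e|e]; last by rewrite Gpos ?e //; exact: Gk.
  have [v|nv] := pselect (V (k - 1) r c).
    have [/(_ v)] := st r c; rewrite e /partial_value => -[] //.
    by case: (m r c) => // x; case: ifP => // h [xE]; lia.
  by move: e; rewrite Gpos //; case: (G r c) => // x [->].
have pos r c : at_pos (swap (Some k) bullet Y) r c =
    if (insub (r, c) : option box) is Some x then
    omap (swap_value k `[< has_adjacent Y x None >] `[< has_adjacent Y x (Some k) >]) Y.[? x]
    else None.
  by rewrite /at_pos; case: insubP => // x _ _; rewrite swap_fnd_bullet.
have new r c x : G r c = Some k -> box_row x = r -> box_col x = c -> 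
    (has_adjacent Y x None <-> V k r c).
  move=> g xr xc; have Yx : Y.[? x] = Some (Some k) by rewrite -at_posE xr xc valk.
  rewrite (adjacent_value inc Yx) xr xc visitedS; split.
  - case=> -[j [e /bul[v pv]]]; right; split=> //; [left|right]; exists j; split=> //;
      rewrite e in g.
    + have [|y my yk] := @slide_min_exists r j k; first by left.
      by rewrite my; move: pv; rewrite /partial_value my; case: ifP => // h _; congr Some; lia.
    + have [|y my yk] := @slide_min_exists j c k; first by right.
      by rewrite my; move: pv; rewrite /partial_value my; case: ifP => // h _; congr Some; lia.
  - case=> [/(Gk _ _ g) //|[_ [[c' [e v mk]]|[r' [e v mk]]]]]; 
      [left; exists c'; have [/(_ v) -> _] := st r c'|right; exists r'; have [/(_ v) -> _] := st r' c];
      by split=> //; rewrite /partial_value mk; case: ifP => //; lia.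
move=> r c; rewrite pos; split=> [v|nv].
- case: (pselect (V (k - 1) r c)) => [v'|nv'].
    have [x [xr xc Yx]] := Vpos _ _ v'.
    have -> : (insub (r, c) : option box) = Some x.
      by rewrite -xr -xc /box_row /box_col -surjective_pairing valK.
    rewrite Yx /=; congr Some; rewrite /partial_value.
    case mE: (m r c) => [y|]; last first.
      have Yx0 : Y.[? x] = Some None by rewrite Yx /partial_value mE.
      rewrite /=; case: asboolP => // /(adjacent_bullet inc Yx0).
      rewrite xr xc !valk => /slide_min_exists[y my _]; by rewrite mE in my.
    case: ifP => yk /=.
      have -> : (y == k) = false by lia.
      by have -> : (y <= k) by lia.
    have Yx0 : Y.[? x] = Some None by rewrite Yx /partial_value mE yk.
    case: asboolP => /(adjacent_bullet inc Yx0); rewrite xr xc !valk => h.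
      have [y' my' yk'] := slide_min_exists h.
      move: my'; rewrite mE => -[yy]; have -> : y = k by lia.
      by rewrite lexx.
    case: ifP => // yk'; case: h; have -> : k = y by lia.
    by case: (slide_min_some mE).
  have [//|[g _]] := (visitedS k r c).1 v.
  have [x [xr xc Yx]] := at_pos_some ((valk r c).2 g).
  have -> : (insub (r, c) : option box) = Some x.
    by rewrite -xr -xc /box_row /box_col -surjective_pairing valK.
  rewrite Yx /= eqxx; have /asboolP -> : has_adjacent Y x None by apply/(new _ _ _ g xr xc).
  rewrite /partial_value /=; case mE: (m r c) => [y|] //.
  by have := slide_min_gt g mE; case: ifP => // h; lia.
- have nv' : ~ V (k - 1) r c by move=> v; apply: nv; apply/visitedS; left.
  have := Gpos _ _ nv'; rewrite /at_pos; case: insubP => [x _ xE|_].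
    have xr : box_row x = r by rewrite /box_row xE.
    have xc : box_col x = c by rewrite /box_col xE.
    move=> ->; case g: (G r c) => [y|] //=; case: eqP => //= yk.
    rewrite yk in g; by case: asboolP => // /(new _ _ _ g xr xc).
  by case: (G r c).
Qed.

End Visited.

Definition fill_inc (G : fill) := forall r c r' c' a b,
  G r c = Some a -> G r' c' = Some b ->
  (r <= r')%N -> (c <= c')%N -> (r + c < r' + c')%N -> a < b.

Definition pos_convex (D : nat -> nat -> Prop) := forall r1 c1 r c r2 c2,
  D r1 c1 -> D r2 c2 -> (r1 <= r <= r2)%N -> (c1 <= c <= c2)%N -> (r <= c)%N -> D r c.

Record corner_set (G : fill) (C : nat -> nat -> Prop) : Prop := CornerSet {
  corner_valid : forall r c, C r c -> (0 < r <= c)%N;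
  corner_bound : exists n, forall r c, C r c -> (c < n)%N;
  corner_convex : pos_convex (slide_dom G C);
  corner_minimal : forall r c r' c', C r c -> slide_dom G C r' c' ->
    (r' <= r)%N -> (c' <= c)%N -> r' = r /\ c' = c;
  corner_empty : forall r c, C r c -> G r c = None
}.

Definition slides_to (G : fill) (C : nat -> nat -> Prop) (F : fill) :=
  exists V : nat -> nat -> Prop, [/\
    forall r c, V r c <-> C r c \/ exists2 x, G r c = Some x &
      (exists c', [/\ c = c'.+1, V r c' & slide_min G r c' = Some x]) \/
      (exists r', [/\ r = r'.+1, V r' c & slide_min G r' c = Some x]),
    forall r c, V r c -> F r c = slide_min G r c
  & forall r c, ~ V r c -> F r c = G r c].

(** Whether a box is visited depends only on boxes with smaller [r + c], so the recursive condition
    has one solution. *)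
Lemma slides_to_unique G C F F' : slides_to G C F -> slides_to G C F' ->
  forall r c, F r c = F' r c.
Proof.
move=> [V [Vs Fv Fo]] [V' [Vs' Fv' Fo']].
have VV r c : V r c <-> V' r c.
  have [n] := ubnP (r + c); elim: n r c => // n IH r c rcn.
  rewrite Vs Vs'; split; (case=> [?|[x Gx [[j [e v mj]]|[j [e v mj]]]]];
    [by left|right; exists x => //; left|right; exists x => //; right]);
    exists j; split=> //; apply/IH => //; lia.
move=> r c; case: (pselect (V r c)) => [v|nv].
  by rewrite Fv // Fv' //; apply/VV.
by rewrite Fo // Fo' // => /VV.
Qed.

Lemma fill_inc_tab T : increasing T -> fill_inc (at_pos T).
Proof.
move=> /increasingE[_ inc] r c r' c' a b /(@at_pos_some _ _ _ _ _)[x [xr xc Tx]].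
move=> /(@at_pos_some _ _ _ _ _)[y [yr yc Ty]] *; apply: inc Tx Ty _.
by rewrite box_ltE; lia.
Qed.

Definition in_pos (A : {fset box}) r c := exists x, [/\ x \in A, box_row x = r & box_col x = c].

Lemma in_posE A x : in_pos A (box_row x) (box_col x) <-> x \in A.
Proof. by split=> [[y [yA e1 e2]]|xA]; [rewrite -(box_eqP e1 e2)|exists x]. Qed.

Lemma in_pos_convex A : box_convex A <-> pos_convex (in_pos A).
Proof.
split=> cv.
- move=> r1 c1 r c r2 c2 [x [xA <- <-]] [y [yA <- <-]] h1 h2 rc.
  have [z [zr zc]] : exists z, box_row z = r /\ box_col z = c.
    by apply: box_exists; have := box_valid x; lia.
  by rewrite -zr -zc; apply/in_posE; apply: cv xA yA _ _; rewrite box_leE; lia.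
- move=> x z y /in_posE xA /in_posE yA; rewrite !box_leE => xz zy.
  by apply/in_posE; apply: cv xA yA _ _ _; have := box_valid z; lia.
Qed.

Lemma in_pos_dom (T : tableau) r c : in_pos (domf T) r c <-> at_pos T r c <> None.
Proof.
split=> [[x [xT <- <-]]|]; first by rewrite at_posE (in_fnd xT).
case e: (at_pos T r c) => [a|] // _; have [x [xr xc Tx]] := at_pos_some e.
by exists x; split=> //; rewrite -fndSome Tx.
Qed.

Lemma pos_convex_ext D D' : (forall r c, D r c <-> D' r c) -> pos_convex D -> pos_convex D'.
Proof.
move=> e cv r1 c1 r c r2 c2 /e h1 /e h2 h3 h4 h5; apply/e; exact: cv h1 h2 h3 h4 h5.
Qed.

Lemma in_pos_slide_dom T C r c :
  in_pos (domf T `|` C) r c <-> slide_dom (at_pos T) (in_pos C) r c.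
Proof.
rewrite /slide_dom -in_pos_dom; split.
- by move=> [x [/fsetUP[xA|xA] xr xc]]; [right|left]; exists x.
- by case=> -[x [xA xr xc]]; exists x; rewrite inE xA ?orbT.
Qed.

Lemma fill_convex_tab T : increasing T -> pos_convex (fun r c => at_pos T r c <> None).
Proof.
move=> [[nu [la sk]] _]; have := (in_pos_convex _).1 (skew_convex sk).
by apply: pos_convex_ext => r c; exact: in_pos_dom.
Qed.

Lemma in_pos_add_bullets T C r c : [disjoint domf T & C] ->
  at_pos (add_bullets T C) r c =
  if `[< in_pos C r c >] then Some None else omap Some (at_pos T r c).
Proof.
move=> dj; case: (boolP (0 < r <= c)%N) => [/box_exists[x [<- <-]]|h].
  rewrite !at_posE add_bullets_fnd inE; case: asboolP => [/in_posE xC|nC].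
    rewrite xC orbT not_fnd //; apply/negP => xT.
    by move/fdisjointP: dj => /(_ _ xT); rewrite xC.
  have /negPf -> : x \notin C by apply/negP => xC; apply/nC/in_posE.
  by rewrite orbF -fndSome; case: (T.[? x]).
have none (U : Type) (Y : {fmap box -> U}) : at_pos Y r c = None.
  by case e: (at_pos Y r c) => // ; move: (at_pos_valid e); rewrite (negPf h).
rewrite !none; case: asboolP => // -[x [_ xr xc]].
by have := box_valid x; rewrite xr xc (negPf h).
Qed.

(** After the largest value has been swapped, [partial_value] is the full minimum of the two
    neighbours, or a bullet, which is then deleted. *)
Lemma slide_spec T C a n : slide_start (a - 1) T C a n -> increasing T ->
  corner_set (at_pos T) (in_pos C) /\
  slides_to (at_pos T) (in_pos C) (at_pos (slide (interval a n) C T)).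
Proof.
move=> [dj hv inc] incT; have Ginc := fill_inc_tab incT.
have hv' r c v : at_pos T r c = Some v -> a <= v < a + n%:Z.
  by move=> /(@at_pos_some _ _ _ _ _)[x [_ _]]; exact: hv.
have Cempty r c : in_pos C r c -> at_pos T r c = None.
  move=> [x [xC <- <-]]; rewrite at_posE not_fnd //; apply/negP => xT.
  by move/fdisjointP: dj => /(_ _ xT); rewrite xC.
have cs : corner_set (at_pos T) (in_pos C).
  split=> //.
  - by move=> r c [x [_ <- <-]]; exact: box_valid.
  - by have [m hm] := box_bound C; exists m => r c [x [xC _ <-]]; exact: hm.
  - by apply: pos_convex_ext (in_pos_slide_dom T C) _; apply/in_pos_convex; case: inc.
  - move=> r c r' c' Cx dy rr cc.
    have [lt|//] : (r' + c' < r + c)%N \/ r' = r /\ c' = c by lia.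
    have [x [xC xr xc]] := Cx; have [y [yD yr yc]] := (in_pos_slide_dom _ _ _ _).2 dy.
    have := inc.2 y x T.[? y] T.[? x].
    rewrite !add_bullets_fnd yD inE xC orbT -(at_posE T x) xr xc (Cempty _ _ Cx).
    move=> /(_ erefl erefl); rewrite box_ltE yr yc xr xc rr cc lt => /(_ isT).
    case Ty: (T.[? y]) => [v|] //=; have := hv _ _ Ty; lia.
split=> //.
have st0 : slide_state (at_pos T) (in_pos C) (a - 1) (add_bullets T C).
  split=> // r c; rewrite in_pos_add_bullets //.
  have small r' c' x : at_pos T r' c' = Some x -> x <= a - 1 -> False.
    by move=> /hv'; lia.
  split=> [v|nv]; last by case: asboolP => // Cx; case: nv; exact: visited_start.
  have -> : partial_value (at_pos T) (a - 1) r c = None.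
    rewrite /partial_value; case mE: (slide_min _ r c) => [x|] //; case: ifP => // h.
    by have [[] /small/(_ h)] := slide_min_some mE.
  by case: v => {r c} [r c Cx|r c x _ /small + _ h|r c x _ /small + _ h];
    [case: asboolP|move=> /(_ h)|move=> /(_ h)].
have stn m : slide_state (at_pos T) (in_pos C) (a + m%:Z - 1)
    (swaps (interval a m) (add_bullets T C)).
  elim: m => [|m IH]; first by rewrite addr0.
  rewrite intervalS swaps_rcons; have -> : a + m.+1%:Z - 1 = a + m%:Z by lia.
  exact: slide_state_step.
have [_ {}stn] := stn n; set K := a + n%:Z - 1 in stn.
have big r c x : at_pos T r c = Some x -> x <= K by move=> /hv'; rewrite /K; lia.
have get r c : at_pos (slide (interval a n) C T) r c =
    obind id (at_pos (swaps (interval a n) (add_bullets T C)) r c).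
  by rewrite slideE /at_pos; case: insubP => // x _ _; rewrite delete_bullets_fnd.
exists (visited (at_pos T) (in_pos C) K); split=> r c.
- split.
  + case=> {r c} [r c Cx|r c x v Gx mx _|r c x v Gx mx _]; [by left|right|right];
      exists x => //; [left; exists c|right; exists r]; by split.
  + case=> [|[x Gx [[j [e v mx]]|[j [e v mx]]]]]; first exact: visited_start.
    * by subst c; apply: visited_right v Gx mx (big _ _ _ Gx).
    * by subst r; apply: visited_down v Gx mx (big _ _ _ Gx).
- move=> v; have [/(_ v) e _] := stn r c; rewrite get e /partial_value /=.
  case mE: (slide_min _ r c) => [x|] //.
  by have -> : (x <= K) = true by have [[] /big] := slide_min_some mE.
- by move=> nv; have [_ /(_ nv) e] := stn r c; rewrite get e; case: (at_pos T r c).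
Qed.

Lemma forward_increasing T T' : forward_slide T T' -> increasing T /\ increasing T'.
Proof.
move=> fs; split; first by case: fs => nu [la [C [a [b []]]]].
by move/forward_reverse: fs => [nu [la [C [a [b []]]]]].
Qed.

Lemma tab_values_ex T : exists a n, tab_values T a n.
Proof.
pose M := \max_(x : domf T) `|T x|%N.
exists (- M%:Z), (M.*2.+1)%N => x v Tx.
have xT : x \in domf T by rewrite -fndSome Tx.
have : (`|v| <= M)%N.
  by move: Tx; rewrite (in_fnd xT) => -[<-]; rewrite (@leq_bigmax _ (fun x => `|T x|%N)).
lia.
Qed.

(** By uniqueness, a visited set satisfying the recursion certifies a slide. The slides constructed
    later are all obtained in this way. *)
Lemma forward_slide_fill T T' : forward_slide T T' <-> increasing T /\ exists C,
  corner_set (at_pos T) C /\ slides_to (at_pos T) C (at_pos T').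
Proof.
split.
  move=> fs; have [incT _] := forward_increasing fs; split=> //.
  move/forward_slideE: fs => [C [a [n [st ->]]]].
  by exists (in_pos C); exact: slide_spec st incT.
move=> [incT [C [cs sl]]]; have [N CN] := corner_bound cs.
pose C' := [fset x in boxes_upto N | `[< C (box_row x) (box_col x) >]].
have C'E r c : in_pos C' r c <-> C r c.
  have mem x : (x \in C') = (x \in boxes_upto N) && `[< C (box_row x) (box_col x) >].
    by rewrite inE.
  split=> [[x [+ <- <-]]|Cx]; first by rewrite mem => /andP[_ /asboolP].
  have [x [xr xc]] := box_exists (corner_valid cs Cx); exists x; split=> //.
  rewrite mem mem_boxes_upto xr xc (CN _ _ Cx); exact/asboolP.
have dE r c : slide_dom (at_pos T) C r c <-> in_pos (domf T `|` C') r c.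
  rewrite in_pos_slide_dom /slide_dom; split=> -[]; try by right.
    by move=> /C'E; left.
  by move=> /C'E; left.
have [a [n hv]] := tab_values_ex T.
have st : slide_start (a - 1) T C' a n.
  have low x y : x \in C' -> y \in domf T `|` C' -> (y < x)%O -> False.
    move=> /in_posE/C'E Cx /in_posE/dE dy; rewrite box_ltE => /and3P[h1 h2 h3].
    by have [] := corner_minimal cs Cx dy h1 h2; lia.
  split=> //.
    apply/fdisjointP => x xT; apply/negP => /in_posE/C'E/(corner_empty cs).
    by rewrite at_posE (in_fnd xT).
  split; first by apply/in_pos_convex; apply: pos_convex_ext dE (corner_convex cs).
  move=> x y u v; rewrite !add_bullets_fnd.
  case: ifP => // xD [<-]; case: ifP => // yD [<-] xy.
  case Ty: (T.[? y]) => [c|] /=; last first.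
    by case: (low y x) => //; move: yD; rewrite inE -fndSome Ty.
  case Tx: (T.[? x]) => [b|]; last by have := hv _ _ Ty; rewrite /=; lia.
  by have [_ inc] := (increasingE T).1 incT; apply: inc xy.
have [_ sl'] := slide_spec st incT.
apply/forward_slideE; exists C', a, n; split=> //.
apply: at_pos_ext => r c; apply: slides_to_unique sl _ r c.
case: sl' => V [Vs Fv Fo]; exists V; split=> // r c.
by rewrite Vs; split=> -[/C'E|]; auto.
Qed.

Lemma forward_weak T T' : forward_slide T T' -> exists N0, forall N, (N0 <= N)%N ->
  weak_KKnuth (fill_word N (at_pos T)) (fill_word N (at_pos T')).
Proof.
move=> fs; have [incT incT'] := forward_increasing fs.
have [_ [C [cs [V [Vs Fv Fo]]]]] := (forward_slide_fill T T').1 fs.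
have [n1 b1] := corner_bound cs; have [n2 b2] := box_bound (domf T).
exists (maxn n1 n2) => N; rewrite geq_max => /andP[nN1 nN2].
apply: (@slide_word N (at_pos T) (at_pos T') C V) => //.
- move=> r c [/(corner_valid cs) //|]; case e: (at_pos T r c) => [x|] // _.
  exact: at_pos_valid e.
- move=> r c [/b1|]; first by lia.
  by move=> /in_pos_dom[x [/b2 h _ <-]]; lia.
- exact: corner_convex cs.
- exact: corner_minimal cs.
- exact: corner_empty cs.
- exact: fill_inc_tab.
- exact: fill_inc_tab.
- exact: fill_convex_tab.
Qed.

(** * Reading words of one tableau *)

Definition reads_before (x y : box) : bool :=
  (box_row y <= box_row x)%N && (box_col x <= box_col y)%N.

Definition reading_list (s : seq box) := pairwise (fun x y => ~~ reads_before y x) s.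

Lemma reading_list_uniq s : reading_list s -> uniq s.
Proof. by apply: pairwise_uniq => x; rewrite /reads_before !leqnn. Qed.

Lemma reading_list_cons x s : reading_list (x :: s) =
  all (fun y => ~~ reads_before y x) s && reading_list s.
Proof. by []. Qed.

Section ReadingWords.
Variable T : tableau.
Hypothesis incT : increasing T.
Local Notation word s := (pmap (fnd T) s).

Lemma reading_order_list s : reading_order T s ->
  reading_list s /\ s =i domf T.
Proof.
move=> [us sT ord]; split=> //; case: s us sT ord => // x0 s us sT ord.
apply/(pairwiseP x0) => i j; rewrite !inE => si sj ij; apply/negP => /andP[h1 h2].
set x := nth x0 _ i in h1 h2; set y := nth x0 _ j in h1 h2.
have xT : x \in domf T by rewrite -sT mem_nth.
have yT : y \in domf T by rewrite -sT mem_nth.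
have ne : x != y by rewrite nth_uniq // ltn_eqF.
by have := ord _ _ yT xT ne h1 h2; rewrite !index_uniq //; lia.
Qed.

Lemma word_cons x s : x \in domf T -> exists2 a, T.[? x] = Some a & word (x :: s) = a :: word s.
Proof. by rewrite -fndSome /=; case: (T.[? x]) => //= a _; exists a. Qed.

Lemma kk_word_cons x s s' : kk (word s) (word s') -> kk (word (x :: s)) (word (x :: s')).
Proof.
move=> h /=; case: (T.[? x]) => //= a.
by apply: (kk_at (p := [:: a]) (s := [::]) h); rewrite cats0.
Qed.

Lemma kk_swap_heads x y u s : x \in domf T -> y \in domf T -> u \in domf T ->
  (x < u)%O -> (u < y)%O -> kk (word [:: x, y, u & s]) (word [:: y, x, u & s]).
Proof.
move=> xT yT uT xu uy; have [_ inc] := (increasingE T).1 incT.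
have [a Tx _] := word_cons [::] xT; have [b Ty _] := word_cons [::] yT.
have [c Tu _] := word_cons [::] uT; rewrite /= Tx Ty Tu /=.
have := inc _ _ _ _ Tx Tu xu; have := inc _ _ _ _ Tu Ty uy => cb ac.
apply: (kk_at (p := [::]) (s := word s) (kk_left ac cb)); by [].
Qed.

(** What remains true of a reading order after its first boxes have been removed. *)
Definition upper_closed (s : seq box) := forall x y, x \in s -> y \in domf T ->
  reads_before x y -> y \in s.

(** The first box [u] of the list with [reads_before u z] can be moved to the front: by
    transitivity, a box that had to precede [u] would have been found earlier. *)
Lemma reading_list_select z s : has (reads_before^~ z) s -> reading_list s ->
  exists u t, [/\ reads_before u z, perm_eq (u :: t) s & reading_list (u :: t)].
Proof.
move=> hs; have [u s1 s2 uz n1] := split_find hs => ls.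
exists u, (s1 ++ s2); split=> //; first by rewrite cat_rcons -cat1s perm_catCA.
move: ls; rewrite /reading_list cat_rcons pairwise_cat /= => /and3P[h1 h2 /andP[h3 h4]].
rewrite pairwise_cat all_cat h2 h3 h4 !andbT; move: h1; rewrite allrel_consr => /andP[h1 ->].
rewrite andbT; apply/allP => v vs; apply/negP => vu.
have /negP[] := hasPn n1 _ vs.
by move: vu uz; rewrite /reads_before => /andP[a b] /andP[c d]; rewrite (leq_trans c) // (leq_trans b).
Qed.

(** Two orders with different first boxes [x] and [y] are brought to a form in which some [u] with
    [x < u < y] comes third; then [kk_left] exchanges the first two letters. *)
Lemma reading_list_kk s1 s2 : reading_list s1 -> reading_list s2 -> perm_eq s1 s2 ->
  upper_closed s1 -> {subset s1 <= domf T} -> kk (word s1) (word s2).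
Proof.
have [n] := ubnP (size s1); elim: n s1 s2 => // n IH s1 s2.
have half x y r1 r2 : (size r1 < n)%N -> reading_list (x :: r1) -> reading_list (y :: r2) ->
    perm_eq (x :: r1) (y :: r2) -> upper_closed (x :: r1) ->
    {subset x :: r1 <= domf T} -> (box_row x < box_row y)%N -> (box_col x < box_col y)%N ->
    kk (word (x :: r1)) (word (y :: r2)).
  move=> szn l1 l2 pm cl sub rr cc; pose sx := x :: r1; rewrite -/sx in cl sub *.
  have ne : x != y by apply/eqP => e; rewrite e ltnn in rr.
  have xT : x \in domf T by apply/sub/mem_head.
  have ysx : y \in sx by rewrite (perm_mem pm) mem_head.
  have yT := sub _ ysx.
  have yr1 : y \in r1 by move: ysx; rewrite inE eq_sym (negPf ne).
  (* This corner lies between [x] and [y], hence in the skew shape. It need not be readable right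
     after them, so [u] is chosen among the boxes read no later than it. *)
  have [z [zr zc]] : exists z, box_row z = box_row x /\ box_col z = box_col y.
    by apply: box_exists; have := box_valid x; lia.
  have zT : z \in domf T.
    have [[nu [la sk]] _] := incT.
    by apply: (skew_convex sk xT yT); rewrite box_leE; lia.
  have zsx : z \in sx by apply: (cl y); rewrite // /reads_before; lia.
  have zx : z != x by apply/eqP => e; rewrite e in zc; lia.
  have zy : z != y by apply/eqP => e; rewrite e in zr; lia.
  set R := rem y r1.
  have pR : perm_eq r1 (y :: R) by exact: perm_to_rem.
  have pR2 : perm_eq r2 (x :: R).
    rewrite -(perm_cons y); apply: (@perm_trans _ (x :: r1)); first by rewrite perm_sym.
    apply: (@perm_trans _ (x :: y :: R)); first by rewrite perm_cons.
    by rewrite (perm_catCA [:: x] [:: y] R).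
  have lr1 : reading_list r1 by case/andP: l1.
  have lR : reading_list R by apply: subseq_pairwise (rem_subseq _ _) lr1.
  have zR : z \in R.
    rewrite mem_rem_uniq ?reading_list_uniq // inE zy.
    by move: zsx; rewrite inE (negPf zx).
  have [|u [t [uz pt lt]]] := @reading_list_select z R _ lR.
    by apply/hasP; exists z; rewrite // /reads_before !leqnn.
  have memR v : v \in u :: t -> v \in r1 /\ v \in r2.
    by rewrite (perm_mem pt) (perm_mem pR) (perm_mem pR2) !inE => ->; rewrite !orbT.
  have xb v : v \in r1 -> ~~ reads_before v x.
    by move: l1; rewrite reading_list_cons => /andP[/allP h _]; exact: h.
  have yb v : v \in r2 -> ~~ reads_before v y.
    by move: l2; rewrite reading_list_cons => /andP[/allP h _]; exact: h.
  have lx : reading_list (x :: u :: t).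
    by rewrite reading_list_cons lt andbT; apply/allP => v /memR[/xb].
  have ly : reading_list (y :: u :: t).
    by rewrite reading_list_cons lt andbT; apply/allP => v /memR[_ /yb].
  have pyt : perm_eq r1 (y :: u :: t).
    by apply: (perm_trans pR); rewrite perm_cons perm_sym.
  have pxt : perm_eq r2 (x :: u :: t).
    by apply: (perm_trans pR2); rewrite perm_cons perm_sym.
  have sub1 : {subset r1 <= domf T} by move=> v vr; apply: sub; rewrite inE vr orbT.
  have memr2 v : v \in r2 -> v \in sx.
    by move=> vr; rewrite (perm_mem pm) inE vr orbT.
  have kxy : kk (word (x :: r1)) (word [:: x, y, u & t]).
    have h : kk (word r1) (word (y :: u :: t)).
      apply: IH => // v w vr wT vw; have := cl v w; rewrite !inE vr orbT => /(_ isT wT vw).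
      by case/orP => // /eqP wx; rewrite wx (negPf (xb _ vr)) in vw.
    exact: kk_word_cons.
  have kyx : kk (word (y :: r2)) (word [:: y, x, u & t]).
    have h : kk (word r2) (word (x :: u :: t)).
      apply: IH => //.
      + by have /perm_size := pm => /= -[<-].
      + by case/andP: l2.
      + move=> v w vr wT vw; have := cl v w (memr2 _ vr) wT vw.
        rewrite (perm_mem pm) inE => /orP[/eqP wy|//].
        by rewrite wy (negPf (yb _ vr)) in vw.
      + by move=> v /memr2/sub.
    exact: kk_word_cons.
  apply: (kk_trans kxy); apply: (kk_trans _ (kk_sym kyx)).
  have [ur1 ur2] := memR u (mem_head _ _).
  have uT := sub1 _ ur1; have := xb _ ur1; have := yb _ ur2; move: uz.
  rewrite /reads_before zr zc => h1 h2 h3.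
  have [xu uy] : (x < u)%O /\ (u < y)%O.
    by rewrite !box_ltE; clear -h1 h2 h3 rr cc; lia.
  exact: kk_swap_heads xT yT uT xu uy.
case: s1 => [|x r1]; first by move=> _ _ _ /perm_size; case: s2.
case: s2 => [|y r2]; first by move=> _ _ _ /perm_size.
rewrite [size _]/= ltnS => szn l1 l2 pm cl sub.
have [xy|ne] := eqVneq x y.
  rewrite -xy in l2 pm *; rewrite perm_cons in pm; apply: kk_word_cons; apply: IH => //.
  - by case/andP: l1.
  - by case/andP: l2.
  - move=> v w vr wT vw; have := cl v w; rewrite !inE vr orbT => /(_ isT wT vw).
    case/orP => // /eqP wx; move: l1; rewrite reading_list_cons => /andP[/allP/(_ _ vr)].
    by rewrite -wx vw.
  - by move=> v vr; apply: sub; rewrite inE vr orbT.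
have xs2 : x \in r2.
  by have := perm_mem pm x; rewrite mem_head inE (negPf ne) => /esym.
have ys1 : y \in r1.
  by have := perm_mem pm y; rewrite mem_head inE eq_sym (negPf ne).
have h1 : ~~ reads_before y x by move: l1; rewrite reading_list_cons => /andP[/allP/(_ _ ys1)].
have h2 : ~~ reads_before x y by move: l2; rewrite reading_list_cons => /andP[/allP/(_ _ xs2)].
move: h1 h2; rewrite /reads_before => h1 h2.
have [rr|rr] := ltnP (box_row x) (box_row y); first by apply: half => //; lia.
apply: kk_sym; apply: half => //; try lia.
- by have /perm_size := pm => /= -[<-].
- by rewrite perm_sym.
- move=> v w; rewrite -!(perm_mem pm); exact: cl.
- by move=> v; rewrite -(perm_mem pm); exact: sub.
Qed.

Definition row_boxes N r : seq box := pmap (fun c => insub (r, c)) (iota 0 N).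

Fixpoint row_order N n : seq box := if n is n'.+1 then row_boxes N n' ++ row_order N n' else [::].

Lemma mem_row_boxes N r x : (x \in row_boxes N r) = (box_row x == r) && (box_col x < N)%N.
Proof.
rewrite mem_pmap; apply/mapP/idP => [[c]|/andP[/eqP <- xN]].
  rewrite mem_iota; case: insubP => // y _ yE cN [->].
  by rewrite /box_row /box_col yE eqxx.
exists (box_col x); first by rewrite mem_iota.
by rewrite /box_row /box_col -surjective_pairing valK.
Qed.

Lemma mem_row_order N n x : (x \in row_order N n) = (box_row x < n)%N && (box_col x < N)%N.
Proof.
elim: n => [|n IH] //=; by rewrite mem_cat IH mem_row_boxes ltnS (leq_eqVlt (box_row x) n) andb_orl.
Qed.

Lemma row_boxes_reading N r : reading_list (row_boxes N r).
Proof.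
suff h m : reading_list (pmap (fun c => insub (r, c)) (iota m N)) by exact: h.
elim: N m => [|N IH] m //=.
case: insubP => [x _ xE|_] //=; apply/andP; split; last exact: IH.
apply/allP => y; rewrite mem_pmap => /mapP[c]; rewrite mem_iota => cm.
case: insubP => // z _ zE [->]; rewrite /reads_before /box_row /box_col xE zE /=.
by rewrite leqnn -ltnNge; case/andP: cm.
Qed.

Lemma row_order_reading N n : reading_list (row_order N n).
Proof.
elim: n => //= n IH; rewrite /reading_list pairwise_cat; apply/and3P; split=> //.
  apply/allrelP => x y; rewrite mem_row_boxes mem_row_order => /andP[/eqP xn _] /andP[yn _].
  by rewrite /reads_before xn leqNgt yn.
exact: row_boxes_reading.
Qed.

Lemma row_order_word N n : word (row_order N n) =
  rows_word [seq row_word N (at_pos T i) | i <- iota 0 n].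
Proof.
elim: n => [|n IH] //; rewrite -addn1 iotaD map_cat cats1 rows_word_rcons -IH addn1 /=.
rewrite pmap_cat add0n; congr (_ ++ _); rewrite /row_word /row_boxes.
elim: (iota 0 N) => //= c s IHs.
have -> : at_pos T n c = obind (fnd T) (insub (n, c)) by rewrite /at_pos; case: insub.
by case: insub => [x|] /=; rewrite IHs.
Qed.

Lemma reading_word_fill w : reading_word T w -> exists N0, forall N, (N0 <= N)%N ->
  kk w (fill_word N (at_pos T)).
Proof.
move=> [s /reading_order_list[ls sT] ->]; have [N0 bN] := box_bound (domf T).
exists N0 => N N0N; rewrite /fill_word -row_order_word.
have -> : word (row_order N N) = word [seq x <- row_order N N | x \in domf T].
  elim: (row_order N N) => //= x l IH; case: (boolP (x \in domf T)) => [xT|xT] /=.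
    by rewrite IH.
  by rewrite not_fnd.
apply: reading_list_kk => //.
- by apply: subseq_pairwise (filter_subseq _ _) (row_order_reading N N).
- apply: uniq_perm; first exact: reading_list_uniq.
    by rewrite filter_uniq // reading_list_uniq // row_order_reading.
  move=> x; rewrite sT mem_filter mem_row_order; case: (boolP (x \in domf T)) => //= xT.
  by have := bN _ xT; have := box_valid x; lia.
- by move=> x y _; rewrite sT.
- by move=> x; rewrite sT.
Qed.

End ReadingWords.

Lemma jdt_weak T T' : jdt_equiv T T' -> exists N0, forall N, (N0 <= N)%N ->
  weak_KKnuth (fill_word N (at_pos T)) (fill_word N (at_pos T')).
Proof.
elim=> [{}T {}T'|{}T|{}T U {}T' _ [n1 h1] _ [n2 h2]].
- case=> [|/forward_reverse] /forward_weak[n h]; exists n => N nN; first exact: h.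
  by apply/wk_sym/h.
- by exists 0%N.
- exists (maxn n1 n2) => N; rewrite geq_max => /andP[n1N n2N].
  exact: wk_trans (h1 _ n1N) (h2 _ n2N).
Qed.

(** * Shifting a row and lowering a box by slides *)

Definition fill_valid (F : fill) := forall r c, F r c <> None -> (0 < r <= c)%N.
Definition fill_bounded (F : fill) := exists N, forall r c, F r c <> None -> (c < N)%N.
Definition fill_convex (F : fill) := pos_convex (fun r c => F r c <> None).

Lemma tab_of_fill F : fill_valid F -> fill_bounded F ->
  exists T, forall r c, at_pos T r c = F r c.
Proof.
move=> Fv [N FN].
pose S := [fset x in boxes_upto N | F (box_row x) (box_col x) != None].
exists [fmap x : S => odflt 0 (F (box_row (val x)) (box_col (val x)))] => r c.
have mem x : (x \in S) = (x \in boxes_upto N) && (F (box_row x) (box_col x) != None).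
  by rewrite inE.
case e: (F r c) => [v|]; last first.
  rewrite /at_pos; case: insubP => // x _ xE; rewrite not_fnd // mem negb_and negbK.
  by rewrite /box_row /box_col xE e orbT.
have [|x [xr xc]] := @box_exists r c; first by apply: Fv; rewrite e.
have xS : x \in S.
  by rewrite mem mem_boxes_upto xr xc e andbT; apply: (FN r); rewrite e.
by rewrite -xr -xc at_posE (in_fnd (f := [fmap x : S => _]) xS) ffunE xr xc e.
Qed.

Lemma increasing_fill T : fill_inc (at_pos T) -> fill_convex (at_pos T) -> increasing T.
Proof.
move=> inc cv; apply/increasingE; split.
  suff [nu [la [sk _]]] : exists nu la, skew nu la (domf T) /\ maximal_boxes_of la fset0.
    by exists nu, la.
  apply/forward_corners; split=> [||x y]; [|exact: fdisjointX0|by rewrite inE].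
  rewrite fsetU0; apply/in_pos_convex; apply: pos_convex_ext cv => r c.
  by rewrite in_pos_dom.
move=> x y a b; rewrite -!at_posE box_ltE => Tx Ty /and3P[h1 h2 h3].
exact: inc Tx Ty h1 h2 h3.
Qed.

Lemma corner_set_convex G C : corner_set G C -> fill_convex G.
Proof.
move=> cs r1 c1 r c r2 c2 g1 g2 h1 h2 h3.
have [Cx|//] := corner_convex cs (or_intror g1) (or_intror g2) h1 h2 h3.
have [] := corner_minimal cs Cx (or_intror g1); try lia.
by move=> e1 e2; move: (corner_empty cs Cx); rewrite -e1 -e2.
Qed.

(** Slides are used backwards: [G] is the wanted filling, and the forward slide leads from it to the
    given tableau. *)
Lemma slide_from_fill T G C : increasing T -> fill_valid G -> fill_bounded G -> fill_inc G ->
  corner_set G C -> slides_to G C (at_pos T) ->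
  exists T2, [/\ increasing T2, jdt_equiv T T2 & forall r c, at_pos T2 r c = G r c].
Proof.
move=> incT Gv Gb Gi cs [V [Vs Fv Fo]]; have [T2 TG] := tab_of_fill Gv Gb.
have TG' : at_pos T2 = G by apply/funext => r; apply/funext.
have inc2 : increasing T2.
  by apply: increasing_fill; rewrite TG' //; exact: corner_set_convex cs.
exists T2; split=> //; apply/jdt_sym/rt_step; left; apply/forward_slide_fill.
by split=> //; exists C; rewrite TG'; split=> //; exists V.
Qed.

Section ShiftRow.
Variables (F : fill) (r : nat).
Hypotheses (Fv : fill_valid F) (Fi : fill_inc F) (Fc : fill_convex F).
Hypothesis sep : forall r' c' c, (r' < r)%N -> F r' c' <> None -> F r c <> None ->
  (c.+1 < c')%N.

(** A slide undoes the shift: its bullet runs along the whole row, since the entries below are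
    larger. The hypothesis [sep] keeps the shifted row strictly to the left of the rows above. *)
Definition shift_row : fill := fun r' c =>
  if r' == r then (if c is c'.+1 then F r c' else None) else F r' c.

Definition shift_start r' c :=
  [/\ r' = r, F r c <> None & (forall c', c = c'.+1 -> F r c' = None)].

Definition shift_visited r' c :=
  r' = r /\ (F r c <> None \/ exists2 c', c = c'.+1 & F r c' <> None).

Lemma shift_row_row c : shift_row r c.+1 = F r c.
Proof. by rewrite /shift_row eqxx. Qed.

Lemma shift_row_other r' c : r' <> r -> shift_row r' c = F r' c.
Proof. by move=> /eqP/negPf; rewrite /shift_row => ->. Qed.

Lemma shift_row_some r' c x : shift_row r' c = Some x ->
  (r' = r /\ exists2 c', c = c'.+1 & F r c' = Some x) \/ (r' <> r /\ F r' c = Some x).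
Proof.
rewrite /shift_row; case: eqP => [->|]; last by right.
by case: c => // c' Fx; left; split=> //; exists c'.
Qed.

Lemma some_neq (x : option int) a : x = Some a -> x <> None. Proof. by move=> ->. Qed.

Lemma shift_dom r' c : slide_dom shift_row shift_start r' c <->
  (r' <> r /\ F r' c <> None) \/ shift_visited r' c.
Proof.
split.
- case=> [[-> f _]|]; first by right; split=> //; left.
  case e: (shift_row r' c) => [x|] // _.
  case: (shift_row_some e) => [[-> [c' -> f]]|[ne f]].
    by right; split=> //; right; exists c'; rewrite // f.
  by left; rewrite f.
- case=> [[ne f]|[-> [f|[c' -> f]]]]; first by right; rewrite shift_row_other.
    case: c f => [|c] f; first by have /Fv := f; lia.
    case e: (F r c) => [x|]; first by right; rewrite shift_row_row e.
    by left; split=> // c' [<-].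
  by right; rewrite shift_row_row.
Qed.

Lemma shift_min r' c : shift_visited r' c -> F r' c = slide_min shift_row r' c.
Proof.
move=> [-> v]; rewrite /slide_min shift_row_row shift_row_other; last by lia.
case e': (F r.+1 c) => [y|]; last by case: (F r c).
case e: (F r c) => [x|] /=.
  by have xy := Fi e e' ; rewrite min_l // ltW // xy; lia.
case: v => [|[c' cE f]]; first by rewrite e.
have v1 := Fv (some_neq e').
have : F r c <> None by apply: Fc f (some_neq e') _ _ _; lia.
by rewrite e.
Qed.

Lemma shift_corner : fill_bounded F -> corner_set shift_row shift_start.
Proof.
move=> [N FN]; split.
- by move=> r' c [-> /Fv].
- by exists N => r' c [_ f _]; exact: FN f.
- move=> r1 c1 r2 c2 r3 c3 /shift_dom d1 /shift_dom d3 h1 h2 h3; apply/shift_dom.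
  have left_of c : shift_visited r c -> exists2 c', F r c' <> None & (c' <= c <= c'.+1)%N.
    by case=> _ [f|[c' -> f]]; [exists c|exists c']; rewrite ?leqnn ?leqnSn.
  case: (eqVneq r1 r) d1 => [r1E|/eqP n1] d1.
    subst r1; have {}d1 : shift_visited r c1 by case: d1 => [[]|].
    have [c0 f0 hc] := left_of _ d1.
    case: (eqVneq r3 r) d3 => [r3E|/eqP n3] d3.
      subst r3; have {}d3 : shift_visited r c3 by case: d3 => [[]|].
      have r2E : r2 = r by lia.
      subst r2; right; split=> //; have [c4 f4 hc4] := left_of _ d3.
      have [c24|c24] : (c2 <= c4)%N \/ c2 = c4.+1 by lia.
        by left; apply: Fc f0 f4 _ _ _; lia.
      by right; exists c4.
    have f3 : F r3 c3 <> None by case: d3 => [[]|[]].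
    have f2 : F r2 c2 <> None by apply: Fc f0 f3 _ _ _; lia.
    case: (eqVneq r2 r) => [r2E|/eqP n2]; last by left.
    by right; split=> //; left; rewrite -r2E.
  have f1 : F r1 c1 <> None by case: d1 => [[]|[]].
  case: (eqVneq r3 r) d3 => [r3E|/eqP n3] d3.
    subst r3; have {}d3 : shift_visited r c3 by case: d3 => [[]|].
    have [c0 f0 hc] := left_of _ d3.
    have := sep _ f1 f0; lia.
  have f3 : F r3 c3 <> None by case: d3 => [[]|[]].
  have f2 : F r2 c2 <> None by apply: Fc f1 f3 _ _ _; lia.
  case: (eqVneq r2 r) => [r2E|/eqP n2]; last by left.
  by right; split=> //; left; rewrite -r2E.
- move=> r1 c1 r2 c2 [-> f1 s1] /shift_dom d2 rr cc.
  case: d2 => [[ne f2]|[-> d2]]; first by have := sep _ f2 f1; lia.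
  split=> //; have [//|lt] : c2 = c1 \/ (c2 < c1)%N by lia.
  have nf : F r c1.-1 = None by apply: s1; lia.
  have v1 := Fv f1.
  suff : F r c1.-1 <> None by rewrite nf.
  by case: d2 => [f|[c' cE f]]; have v2 := Fv f; apply: Fc f f1 _ _ _; lia.
- move=> r' c [-> f s]; rewrite /shift_row eqxx; case: c s {f} => //= c s; exact: s.
Qed.

Lemma shift_inc : fill_inc shift_row.
Proof.
move=> r1 c1 r2 c2 a b /shift_row_some + /shift_row_some.
case=> [[-> [c1' -> f1]]|[n1 f1]] [[-> [c2' -> f2]]|[n2 f2]] h1 h2 h3.
- by apply: Fi f1 f2 _ _ _; lia.
- by apply: Fi f1 f2 _ _ _; lia.
- by have := sep (r' := r1) _ (some_neq f1) (some_neq f2); lia.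
- by apply: Fi f1 f2 _ _ _; lia.
Qed.

Lemma shift_slides : slides_to shift_row shift_start F.
Proof.
exists shift_visited; split.
- move=> r' c; split.
  + move=> [-> v].
    case: c v => [|c] v; first by case: v => [/Fv|[]//]; lia.
    case e: (F r c) => [x|]; last first.
      case: v => [f|[c' [<-]]]; last by rewrite e.
      by left; split=> // c' [<-].
    right; exists x; first by rewrite shift_row_row.
    left; exists c; have vc : shift_visited r c by split=> //; left; rewrite e.
    by rewrite -(shift_min vc) e.
  + case=> [[-> f _]|[x Gx [[j [e v mj]]|[j [e v mj]]]]]; first by split=> //; left.
      subst c; have [rE _] := v; split=> //; right; exists j => //.
      by move: Gx; rewrite rE shift_row_row => ->.
    have [rE _] := v; subst j r'.
    move: Gx mj; rewrite -(shift_min v) shift_row_other; last by lia.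
    move=> Gx Fx; have := Fi Fx Gx; rewrite ltxx => h.
    by have : false by apply: h; lia.
- by move=> r' c /shift_min.
- move=> r' c nv; rewrite /shift_row; case: eqP => // rE; subst r'.
  have F0 : F r c = None by case e: (F r c) => //; case: nv; split=> //; left; rewrite e.
  case: c nv F0 => // c nv ->.
  by case e: (F r c) => //; case: nv; split=> //; right; exists c; rewrite ?e.
Qed.

End ShiftRow.

Section DropBox.
Variables (F : fill) (r c : nat) (v : int).
Hypotheses (Fv : fill_valid F) (Fi : fill_inc F) (Fc : fill_convex F).
Hypothesis Fr : F r c = Some v.
Hypothesis leftmost : forall c', F r c' <> None -> (c <= c')%N.
Hypothesis above_right : forall r' c', (r' < r)%N -> F r' c' <> None -> (c < c')%N.
Hypothesis below_left : forall r' c', (r < r')%N -> F r' c' <> None -> (c' < c)%N.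
Hypothesis next_empty : forall c', F r.+1 c' = None.
Hypothesis rc : (r < c)%N.

(** The inverse move is a slide with one bullet at [(r, c)]: the entry to the right exceeds [v], so
    [v] moves up, and the bullet stops in its old place, which has no further neighbours to take
    in. *)
Definition drop_box : fill := fun r' c' =>
  if (r' == r.+1) && (c' == c) then Some v
  else if (r' == r) && (c' == c) then None else F r' c'.

Definition drop_start r' c' := r' = r /\ c' = c.
Definition drop_visited r' c' := c' = c /\ (r' = r \/ r' = r.+1).

Lemma drop_box_some r' c' x : drop_box r' c' = Some x ->
  (r' = r.+1 /\ c' = c /\ x = v) \/ (~ (r' = r /\ c' = c) /\ r' <> r.+1 /\ F r' c' = Some x).
Proof.
rewrite /drop_box; case: andP => [[/eqP -> /eqP ->] [<-]|n1]; first by left.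
case: andP => // n2 f; right; split; first by case=> e1 e2; apply: n2; rewrite e1 e2 !eqxx.
by split=> // e; rewrite e next_empty in f.
Qed.

Lemma drop_dom r' c' : slide_dom drop_box drop_start r' c' <->
  F r' c' <> None \/ r' = r.+1 /\ c' = c.
Proof.
rewrite /slide_dom /drop_start /drop_box; split.
- case=> [[-> ->]|]; first by left; rewrite Fr.
  by case: andP => [[/eqP -> /eqP ->]|_]; [right|case: andP => // _; left].
- have [/andP[/eqP e1 /eqP e2]|n1] := boolP ((r' == r.+1) && (c' == c)); first by right.
  case: andP => [[/eqP -> /eqP ->]|_]; first by left.
  by case=> [|[e1 e2]]; [right|rewrite e1 e2 !eqxx in n1].
Qed.

Lemma drop_corner : fill_bounded F -> corner_set drop_box drop_start.
Proof.
move=> [N FN]; split.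
- by move=> r' c' [-> ->]; apply: Fv; rewrite Fr.
- by exists N => r' c' [_ ->]; apply: (FN r); rewrite Fr.
- move=> r1 c1 r2 c2 r3 c3 /drop_dom d1 /drop_dom d3 h1 h2 h3; apply/drop_dom.
  have fr : F r c <> None by rewrite Fr.
  case: d3 => [f3|[e3 e4]].
    case: d1 => [f1|[e1 e2]]; first by left; exact: Fc f1 f3 h1 h2 h3.
    have := below_left (r' := r3) _ f3; lia.
  case: d1 => [f1|[e1 e2]]; last by right; lia.
  have [r1r|r1r] : (r1 < r)%N \/ (r <= r1)%N by lia.
    have := above_right r1r f1; lia.
  have [r1E|r1E] : r1 = r \/ r1 = r.+1 by lia.
    subst r1; have := leftmost f1 => cc1; have cE : c2 = c by lia.
    have [r2E|r2E] : r2 = r \/ r2 = r.+1 by lia.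
      by left; rewrite r2E cE.
    by right.
  by rewrite r1E next_empty in f1.
- move=> r1 c1 r2 c2 [-> ->] /drop_dom [f|]; last by lia.
  move=> rr cc; have [lt|e] : (r2 < r)%N \/ r2 = r by lia.
    have := above_right lt f; lia.
  split=> //; rewrite e in f; have := leftmost f; lia.
- move=> r' c' [-> ->]; rewrite /drop_box !eqxx andbT.
  by have -> : (r == r.+1) = false by lia.
Qed.

Lemma drop_inc : fill_inc drop_box.
Proof.
move=> r1 c1 r2 c2 a b /drop_box_some + /drop_box_some.
case=> [[-> [-> ->]]|[n1 [n1' f1]]] [[-> [-> ->]]|[n2 [n2' f2]]] h1 h2 h3; first by lia.
- have := below_left (r' := r2) _ (some_neq f2); lia.
- by apply: Fi f1 Fr _ _ _; lia.
- by apply: Fi f1 f2 _ _ _; lia.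
Qed.

Lemma drop_slides : slides_to drop_box drop_start F.
Proof.
have Gr : drop_box r.+1 c = Some v by rewrite /drop_box !eqxx.
have Gright : drop_box r c.+1 = F r c.+1.
  rewrite /drop_box; have -> : (r == r.+1) = false by lia.
  have -> : (c.+1 == c) = false by lia.
  by rewrite !andbF.
have Grest r' c' : (r < r')%N -> (r' <> r.+1 \/ c' <> c) -> drop_box r' c' = F r' c'.
  move=> h1 h2; rewrite /drop_box; case: andP => [[/eqP e1 /eqP e2]|_]; first by lia.
  by case: andP => // -[/eqP e1 _]; lia.
have F0 r' c' : (r < r')%N -> (c <= c')%N -> F r' c' = None.
  by move=> h1 h2; case e: (F r' c') => [x|] //; have := below_left h1 (some_neq e); lia.
have m1 : slide_min drop_box r c = Some v.
  rewrite /slide_min Gr Gright; case e: (F r c.+1) => [x|] //=.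
  by rewrite min_r // ltW //; apply: Fi Fr e _ _ _; lia.
have m2 : slide_min drop_box r.+1 c = None.
  by rewrite /slide_min !Grest ?F0 //; lia.
exists drop_visited; split.
- move=> r' c'; split.
  + case=> -> [->|->]; first by left.
    by right; exists v => //; right; exists r; split=> //; split=> //; left.
  + case=> [[-> ->]|[x Gx [[j [e [jc w] mj]]|[j [e [jc w] mj]]]]]; first by split=> //; left.
      subst j c'; case: w mj => e; subst r'; last by rewrite m2.
      rewrite m1 => -[vx]; move: Gx; rewrite Gright => /(Fi Fr) h.
      have : v < x by apply: h; lia.
      by rewrite vx ltxx.
    subst c' r'; case: w mj => e; subst j; first by split=> //; right.
    by rewrite m2.
- by move=> r' c' [-> [->|->]]; rewrite ?m1 ?m2 // next_empty.
- move=> r' c' nv; rewrite /drop_box.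
  case: andP => [[/eqP e1 /eqP e2]|_]; first by case: nv; split=> //; right.
  by case: andP => // -[/eqP e1 /eqP e2]; case: nv; split=> //; left.
Qed.

End DropBox.

(** * Spreading a word over an antidiagonal *)

(** Boxes are indexed by the letters of the word, so that moves of boxes become changes of the two
    functions [pr] and [pc]. *)
Definition places (pr pc : nat -> nat) (w : seq int) (F : fill) := forall r c v,
  F r c = Some v <-> exists2 i, (i < size w)%N & [/\ pr i = r, pc i = c & nth 0 w i = v].

Definition reaches T pr pc w := exists T2,
  [/\ increasing T2, jdt_equiv T T2 & places pr pc w (at_pos T2)].

Lemma fill_valid_tab (T : tableau) : fill_valid (at_pos T).
Proof. by move=> r c; case e: (at_pos T r c) => // _; exact: at_pos_valid e. Qed.

Lemma fill_bounded_tab (T : tableau) : fill_bounded (at_pos T).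
Proof.
have [N bN] := box_bound (domf T); exists N => r c /in_pos_dom[x [xT _ <-]]; exact: bN.
Qed.

Lemma places_ext pr pc pr' pc' w F : (forall i, (i < size w)%N -> pr i = pr' i /\ pc i = pc' i) ->
  places pr pc w F -> places pr' pc' w F.
Proof.
move=> e p r c v; rewrite p; split=> -[i iw [h1 h2 h3]]; exists i => //;
  have [e1 e2] := e _ iw; split=> //; congruence.
Qed.

Lemma reaches_ext T pr pc pr' pc' w :
  (forall i, (i < size w)%N -> pr i = pr' i /\ pc i = pc' i) ->
  reaches T pr pc w -> reaches T pr' pc' w.
Proof. by move=> e [T2 [h1 h2 h3]]; exists T2; split=> //; exact: places_ext h3. Qed.

Lemma places_at pr pc w F i : places pr pc w F -> (i < size w)%N ->
  F (pr i) (pc i) = Some (nth 0 w i).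
Proof. by move=> p iw; apply/p; exists i. Qed.

Lemma places_neq pr pc w F r c : places pr pc w F -> F r c <> None ->
  exists2 i, (i < size w)%N & pr i = r /\ pc i = c.
Proof.
by move=> p; case e: (F r c) => [v|] // _; move/p: e => [i iw [h1 h2 _]]; exists i.
Qed.

Lemma reaches_shift T pr pc w r : reaches T pr pc w ->
  (forall i j, (i < size w)%N -> (j < size w)%N -> (pr i < r)%N -> pr j = r ->
    ((pc j).+1 < pc i)%N) ->
  reaches T pr (fun i => if pr i == r then (pc i).+1 else pc i) w.
Proof.
move=> [T2 [inc2 T2T p]] sep; set F := at_pos T2.
have Fv : fill_valid F := fill_valid_tab (T := T2).
have Fb : fill_bounded F := fill_bounded_tab T2.
have Fi : fill_inc F := fill_inc_tab inc2.
have Fc : fill_convex F := fill_convex_tab inc2.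
have Fsep r' c' c : (r' < r)%N -> F r' c' <> None -> F r c <> None -> (c.+1 < c')%N.
  move=> rr /(places_neq p)[i iw [ir ic]] /(places_neq p)[j jw [jr jc]].
  by rewrite -ic -jc; apply: sep => //; rewrite ir.
have Gv : fill_valid (shift_row F r).
  move=> r' c; case e: (shift_row F r r' c) => [x|] // _.
  have [[-> [c' -> f]]|[_ f]] := shift_row_some e; have := Fv _ _ (some_neq f); lia.
have Gb : fill_bounded (shift_row F r).
  have [N FN] := Fb; exists N.+1 => r' c; case e: (shift_row F r r' c) => [x|] // _.
  have [[_ [c' -> f]]|[_ f]] := shift_row_some e; have := FN _ _ (some_neq f); lia.
have [T3 [inc3 T3T e]] := slide_from_fill inc2 Gv Gb (shift_inc Fi Fsep)
  (shift_corner Fv Fc Fsep Fb) (shift_slides r Fv Fi Fc).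
exists T3; split=> //; first exact: jdt_trans T2T T3T.
move=> r' c v; rewrite e; split.
- move=> /shift_row_some[[-> [c' -> /p[i iw [i1 i2 i3]]]]|[ne /p[i iw [i1 i2 i3]]]];
    exists i => //; split=> //; first by rewrite i1 eqxx i2.
  by move/eqP/negPf: ne; rewrite i1 => ->.
- move=> [i iw [<- <- <-]]; rewrite /shift_row.
  by case: eqP => [er|_]; [rewrite -er|]; exact: places_at p iw.
Qed.

Lemma reaches_shift_by T pr pc w r k : reaches T pr pc w ->
  (forall i j, (i < size w)%N -> (j < size w)%N -> (pr i < r)%N -> pr j = r ->
    (pc j + k < pc i)%N) ->
  reaches T pr (fun i => if pr i == r then (pc i + k)%N else pc i) w.
Proof.
move=> h; elim: k => [|k IH] sep.
  by apply: reaches_ext h => i _; rewrite addn0; case: ifP.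
have {IH}h1 : reaches T pr (fun i => if pr i == r then (pc i + k)%N else pc i) w.
  by apply: IH => i j iw jw h1 h2; have := sep i j iw jw h1 h2; lia.
have {h1} := reaches_shift (r := r) h1 _.
move=> h1; apply: reaches_ext (h1 _) => [i _|i j iw jw ir jr].
  by split=> //=; case: eqP => // _; rewrite addnS.
by have := sep i j iw jw ir jr; rewrite jr eqxx (ltn_eqF ir); lia.
Qed.

Lemma reaches_drop T pr pc w t : reaches T pr pc w -> (t < size w)%N ->
  (forall i, (i < size w)%N -> i <> t -> [\/ (pr i < pr t)%N /\ (pc t < pc i)%N,
     pr i = pr t /\ (pc t < pc i)%N | ((pr t).+1 < pr i)%N /\ (pc i < pc t)%N]) ->
  (pr t < pc t)%N ->
  reaches T (fun i => if i == t then (pr t).+1 else pr i) pc w.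
Proof.
move=> [T2 [inc2 T2T p]] tw cond rc; set F := at_pos T2.
have Fv : fill_valid F := fill_valid_tab (T := T2).
have Fb : fill_bounded F := fill_bounded_tab T2.
have Fi : fill_inc F := fill_inc_tab inc2.
have Fc : fill_convex F := fill_convex_tab inc2.
have Ft := places_at p tw.
have cases r c : F r c <> None -> r = pr t /\ c = pc t \/
    [\/ (r < pr t)%N /\ (pc t < c)%N, r = pr t /\ (pc t < c)%N |
        ((pr t).+1 < r)%N /\ (c < pc t)%N].
  move=> /(places_neq p)[i iw [<- <-]]; have [->|/eqP ne] := eqVneq i t; first by left.
  by right; exact: cond.
have h1 c' : F (pr t) c' <> None -> (pc t <= c')%N by move=> /cases[|[]]; lia.
have h2 r' c' : (r' < pr t)%N -> F r' c' <> None -> (pc t < c')%N by move=> ? /cases[|[]]; lia.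
have h3 r' c' : (pr t < r')%N -> F r' c' <> None -> (c' < pc t)%N by move=> ? /cases[|[]]; lia.
have h4 c' : F (pr t).+1 c' = None.
  by case e: (F _ c') => [x|] //; have /cases[|[]] := some_neq e; lia.
pose G := drop_box F (pr t) (pc t) (nth 0 w t).
have Gv : fill_valid G.
  move=> r' c; case e: (G r' c) => [x|] // _.
  have [[-> [-> _]]|[_ [_ f]]] := drop_box_some h4 e; last exact: Fv (some_neq f).
  by rewrite rc.
have Gb : fill_bounded G.
  have [N FN] := Fb; exists N => r' c; case e: (G r' c) => [x|] // _.
  have [[_ [-> _]]|[_ [_ f]]] := drop_box_some h4 e; last exact: FN (some_neq f).
  exact: FN (some_neq Ft).
have [T3 [inc3 T3T e]] := slide_from_fill inc2 Gv Gb (drop_inc Fi Ft h3 h4 rc)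
  (drop_corner Fv Fc Ft h1 h2 h3 h4 rc Fb) (drop_slides Fi Ft h3 h4 rc).
exists T3; split=> //; first exact: jdt_trans T2T T3T.
move=> r' c v; rewrite e -/G; split.
- move=> /(drop_box_some h4)[[-> [-> ->]]|[ne [_ /p[i iw [i1 i2 i3]]]]].
    by exists t; rewrite ?eqxx.
  exists i => //; split=> //; case: eqP => // it; case: ne.
  by rewrite -i1 -i2 it.
- move=> [i iw [<- <- <-]]; rewrite /G /drop_box.
  have [->|/eqP it] := eqVneq i t; first by rewrite !eqxx.
  have := cond i iw it; case: andP => [[/eqP e1 /eqP e2]|_]; first by case; lia.
  case: andP => [[/eqP e1 /eqP e2]|_]; first by case; lia.
  by move=> _; exact: places_at p iw.
Qed.

Definition row_sorted n (pr pc : nat -> nat) := forall i j, (i < j < n)%N ->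
  (pr j < pr i)%N \/ (pr j = pr i /\ (pc i < pc j)%N).

Definition row_placed T w := exists pr pc, row_sorted (size w) pr pc /\ places pr pc w (at_pos T).

(* Shift the rows far apart, the top row furthest to the right; then lower the
   letters one by one, leftmost first; then move them right, rightmost first. *)
Lemma row_placed_antidiagonal T w : increasing T -> row_placed T w ->
  exists K0, forall K, (K0 <= K)%N -> exists M0, forall M, (M0 <= M)%N ->
    reaches T (fun i => K - i)%N (fun i => M + i)%N w.
Proof.
move=> incT [pr [pc [srt p]]]; have [N bN] := fill_bounded_tab T.
have prpc i : (i < size w)%N -> (0 < pr i <= pc i)%N /\ (pc i < N)%N.
  move=> iw; have f := some_neq (places_at p iw).
  by split; [exact: fill_valid_tab f|exact: bN f].
set n := size w in srt prpc *.
(* As [r <= c < N] on the tableau, every target row [K - i] lies below all of its rows. *)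
exists (N + n)%N => K NK.
(* The shifts of consecutive rows differ by [N], which exceeds the width of a row. All columns
   become at least [K], so lowered letters do not cross the diagonal. *)
pose sh r := ((N - r) * N + K)%N; pose Q i := (pc i + sh (pr i))%N.
have sh_lt r r' : (r < r' < N)%N -> (sh r' + N <= sh r)%N.
  move=> h; rewrite /sh; have -> : (N - r = (N - r') + (r' - r))%N by lia.
  have hN : (N <= (r' - r) * N)%N by rewrite leq_pmull //; lia.
  rewrite mulnDl; lia.
have Q_inc i j : (i < j < n)%N -> (Q i < Q j)%N.
  move=> ij; have [] := srt i j ij.
    have [h1 h2] := prpc i (ltn_trans (andP ij).1 (andP ij).2).
    move=> h; have := sh_lt (pr j) (pr i); rewrite /Q; lia.
  by move=> [e h]; rewrite /Q e ltn_add2r.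
have QK i : (K <= Q i)%N by rewrite /Q /sh addnA leq_addl.
have phase1 t : reaches T pr (fun i => if (pr i < t)%N then Q i else pc i) w.
  elim: t => [|t IH]; first by exists T; split=> //; exact: rt_refl.
  have := reaches_shift_by (r := t) (k := sh t) IH; move=> h.
  apply: reaches_ext (h _) => [i iw|i j iw jw ir jr].
    split=> //; rewrite ltnS; case: (ltngtP (pr i) t) => // e.
    by rewrite /Q e.
  rewrite ir jr ltnn /Q; have [h1 h2] := prpc _ iw; have [h3 h4] := prpc _ jw.
  have := sh_lt (pr i) t; lia.
have {}phase1 : reaches T pr Q w.
  by apply: reaches_ext (phase1 N) => i iw; have [h1 h2] := prpc _ iw; case: ltnP => //; lia.
have phase2 t : (t <= n)%N -> reaches T (fun i => if (i < t)%N then (K - i)%N else pr i) Q w.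
  elim: t => [|t IH] tn //; have {}IH := IH (ltnW tn).
  have [h1 h2] := prpc t tn.
  (* The letters before [t] have already reached rows further down and the later ones lie to the
     right, so the path of letter [t] is free. *)
  have drop d : (pr t + d <= K - t)%N ->
      reaches T (fun i => if (i < t)%N then (K - i)%N else if i == t then (pr t + d)%N else pr i) Q w.
    elim: d => [|d IHd] dK.
      by apply: reaches_ext IH => i iw; split=> //; case: ltngtP => // ->; rewrite addn0.
    have {}IHd : _ := IHd (leq_trans _ dK); have {}IHd := IHd ltac:(lia).
    have := reaches_drop IHd tn; rewrite ltnn eqxx => h.
    apply: reaches_ext (h _ _) => [i iw|i iw it|].
    - by split=> //; case: ltngtP => //; rewrite addnS.
    - have [lt|lt|/it //] := ltngtP i t.
        by apply: Or33; split; [lia|apply: Q_inc; lia].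
      have Qti : (Q t < Q i)%N by apply: Q_inc; rewrite lt.
      have tin : (t < i < n)%N by rewrite lt.
      case: (srt t i tin) => [pl|[pe _]].
        by apply: Or31; split=> //; lia.
      by case: d {IHd dK h} => [|d]; [apply: Or32|apply: Or31]; split=> //; lia.
    - by have := QK t; lia.
  have dK : (pr t + (K - t - pr t) <= K - t)%N by lia.
  apply: reaches_ext (drop _ dK) => i iw; split=> //; rewrite ltnS.
  by case: ltngtP => // ->; lia.
have {phase1}phase2 : reaches T (fun i => K - i)%N Q w.
  by apply: reaches_ext (phase2 n (leqnn _)) => i ->.
(* This bound is chosen after [K], on which [Q] depends; it ensures that letters only have to move
   right. *)
exists (\max_(i < n) Q i) => M QM.
have Qi i : (i < n)%N -> (Q i <= M + i)%N.
  move=> ni; apply: leq_trans (leq_addr _ _); apply: leq_trans QM.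
  exact: (leq_bigmax (Ordinal ni)).
have phase3 t : (t <= n)%N ->
    reaches T (fun i => K - i)%N (fun i => if (n - t <= i)%N then (M + i)%N else Q i) w.
  elim: t => [|t IH] tn.
    by apply: reaches_ext phase2 => i iw; split=> //; case: leqP => //; rewrite subn0 leqNgt iw.
  have {}IH := IH (ltnW tn); pose s := (n - t.+1)%N.
  have := reaches_shift_by (r := (K - s)%N) (k := (M + s - Q s)%N) IH; move=> h.
  have Qs : (Q s <= M + s)%N by apply: Qi; rewrite /s; lia.
  apply: reaches_ext (h _) => [i iw|i j iw jw ir jr].
    split=> //; rewrite -/n in iw; have [->|/eqP ne] := eqVneq i s.
      by rewrite eqxx /s leqnn; case: leqP => h'; rewrite -/s; lia.
    have -> : (K - i == K - s)%N = false by rewrite /s in ne *; lia.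
    by rewrite /s in ne *; case: leqP => h1; case: leqP => h2 //; lia.
  rewrite -/n in iw jw; have js : j = s by rewrite /s in jr *; lia.
  have : (s < i)%N by lia.
  move=> si; rewrite js; have -> : (n - t <= s)%N = false by rewrite /s; lia.
  have -> : (n - t <= i)%N = true by rewrite /s in si *; lia.
  lia.
apply: reaches_ext (phase3 n (leqnn _)) => i iw; split=> //.
by rewrite subnn.
Qed.

(** With common [K] and [M], both reach the tableau that has letter [i] at [(K - i, M + i)]. *)
Lemma same_word_jdt T T' w : increasing T -> increasing T' -> row_placed T w ->
  row_placed T' w -> jdt_equiv T T'.
Proof.
move=> inc inc' /(row_placed_antidiagonal inc)[K0 h] /(row_placed_antidiagonal inc')[K0' h'].
have [M0 {}h] := h (maxn K0 K0') (leq_maxl _ _).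
have [M0' {}h'] := h' (maxn K0 K0') (leq_maxr _ _).
have [U [_ TU p]] := h (maxn M0 M0') (leq_maxl _ _).
have [U' [_ TU' p']] := h' (maxn M0 M0') (leq_maxr _ _).
apply: (jdt_trans TU); suff -> : U = U' by exact: jdt_sym.
apply: at_pos_ext => r c; case e: (at_pos U r c) => [v|].
  by move/p/p': e => ->.
by case e': (at_pos U' r c) => [v|] //; move/p'/p: e'; rewrite e.
Qed.

(** * Tableaux given by sorted lists of entries *)

Notation entry := (nat * nat * int)%type.

(** The order of the row word: a list sorted by it determines a filling together with its word. *)
Definition row_lt (e f : entry) : bool :=
  (f.1.1 < e.1.1)%N || ((f.1.1 == e.1.1) && (e.1.2 < f.1.2)%N).

Lemma row_lt_inj L e f : pairwise row_lt L -> e \in L -> f \in L -> e.1 = f.1 -> e = f.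
Proof.
have irr (g h : entry) : g.1 = h.1 -> row_lt g h -> False.
  by rewrite /row_lt => ->; rewrite !ltnn andbF.
elim: L => //= g L IH /andP[/allP gL pL]; rewrite !inE.
case/orP => [/eqP ->|eL]; case/orP => [/eqP ->|fL] // ef.
- by case: (irr _ _ ef (gL _ fL)).
- by case: (irr _ _ (esym ef) (gL _ eL)).
- exact: IH.
Qed.

Definition lookup (L : seq entry) : fill := fun r c =>
  ohead [seq e.2 | e <- L & e.1 == (r, c)].

Lemma lookupP L r c v : pairwise row_lt L -> (lookup L r c = Some v <-> (r, c, v) \in L).
Proof.
move=> pL; rewrite /lookup; have mem : {subset [seq e <- L | e.1 == (r, c)] <= L}.
  by move=> e; rewrite mem_filter => /andP[].
case E: [seq e <- L | e.1 == (r, c)] mem => [|e s] mem /=.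
  by split=> // h; have := mem_filter (fun e : entry => e.1 == (r, c)) (r, c, v) L;
    rewrite E h /= eqxx.
have eL : e \in L by apply/mem/mem_head.
have /eqP e1 : e.1 == (r, c).
  have : e \in [seq e <- L | e.1 == (r, c)] by rewrite E mem_head.
  by rewrite mem_filter => /andP[].
split=> [[<-]|h]; first by rewrite -e1 -surjective_pairing.
by rewrite (row_lt_inj pL eL h e1).
Qed.

Lemma row_placed_list T L : pairwise row_lt L ->
  (forall r c v, at_pos T r c = Some v <-> (r, c, v) \in L) ->
  row_placed T [seq e.2 | e <- L].
Proof.
move=> pL TL; pose e0 : entry := (0%N, 0%N, 0).
exists (fun i => (nth e0 L i).1.1), (fun i => (nth e0 L i).1.2); split.
  move=> i j; rewrite size_map => /andP[ij jL].
  have /(pairwiseP e0)/(_ i j) := pL; rewrite !inE jL (ltn_trans ij jL).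
  move=> /(_ isT isT ij) /orP[|/andP[/eqP]]; by [left|right].
move=> r c v; rewrite TL size_map; split.
- move=> h; exists (index (r, c, v) L); rewrite ?index_mem //.
  by rewrite (nth_map e0) ?index_mem // nth_index.
- move=> [i iL [<- <- <-]]; rewrite (nth_map e0) // -!surjective_pairing.
  exact: mem_nth.
Qed.

Lemma row_order_sorted N n (f : box -> int) :
  pairwise row_lt [seq (box_row x, box_col x, f x) | x <- row_order N n].
Proof.
elim: n => //= n IH; rewrite map_cat pairwise_cat IH andbT; apply/andP; split.
  apply/allrelP => _ _ /mapP[x + ->] /mapP[y + ->].
  by rewrite mem_row_boxes mem_row_order /row_lt /= => /andP[/eqP -> _] /andP[-> _].
rewrite pairwise_map.
pose r := relpre (fun x => (box_row x, box_col x, f x)) row_lt.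
suff h m : pairwise r (pmap (fun c => insub (n, c)) (iota m N)) by exact: h.
elim: N m {IH} => [|N IH] m //=.
case: insubP => [x _ xE|_] //=; apply/andP; split; last exact: IH.
apply/allP => y; rewrite mem_pmap => /mapP[c]; rewrite mem_iota => cm.
case: insubP => // z _ zE [->]; rewrite /r /row_lt /= /box_row /box_col xE zE /=.
by rewrite eqxx orbC; case/andP: cm => ->.
Qed.

Lemma row_placed_fill_word T : exists N0, forall N, (N0 <= N)%N ->
  row_placed T (fill_word N (at_pos T)).
Proof.
have [N0 bN] := box_bound (domf T); exists N0 => N N0N.
pose f x := odflt 0 T.[? x]; pose s := [seq x <- row_order N N | x \in domf T].
have -> : fill_word N (at_pos T) = [seq e.2 | e <- [seq (box_row x, box_col x, f x) | x <- s]].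
  rewrite -map_comp /fill_word -row_order_word /s.
  elim: (row_order N N) => //= x l ->; case: (boolP (x \in domf T)) => [xT|xT] /=.
    by rewrite /f (in_fnd xT).
  by rewrite not_fnd.
apply: row_placed_list.
  apply: subseq_pairwise (row_order_sorted N N f); apply: map_subseq; exact: filter_subseq.
move=> r c v; split.
- move=> /(@at_pos_some _ _ _ _ _)[x [<- <- Tx]]; have xT : x \in domf T by rewrite -fndSome Tx.
  apply/mapP; exists x; last by rewrite /f Tx.
  rewrite mem_filter xT mem_row_order; have := bN _ xT; have := box_valid x; lia.
- case/mapP => x; rewrite mem_filter => /andP[xT _] [-> -> ->].
  by rewrite at_posE /f (in_fnd xT).
Qed.

Lemma lookup_bounded L : fill_bounded (lookup L).
Proof.
exists (\max_(e <- L) e.1.2).+1 => r c; rewrite /lookup.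
case E: [seq e <- L | e.1 == (r, c)] => [|e s] //= _.
have : e \in [seq e <- L | e.1 == (r, c)] by rewrite E mem_head.
rewrite mem_filter ltnS => /andP[/eqP e1 eL].
by have := @leq_bigmax_seq _ L xpredT (fun e => e.1.2) e eL isT; rewrite e1.
Qed.

Lemma pairwise_mkseq (A : Type) (r : rel A) (f : nat -> A) n :
  (forall i j, (i < j < n)%N -> r (f i) (f j)) -> pairwise r (mkseq f n).
Proof.
move=> h; case: n h => // n h; apply/(pairwiseP (f 0%N)) => i j.
by rewrite !inE size_mkseq => ni nj ij; rewrite !nth_mkseq //; apply: h; rewrite ij.
Qed.

(** * Each relation as a slide of a block *)

Definition entry_of (r c : nat) (x : option int) : seq entry :=
  if x is Some v then [:: (r, c, v)] else [::].

Section Block.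
Variables (R C : nat) (U W : seq entry) (p q s : option int).
Hypothesis RC : (0 < R <= C)%N.
Hypothesis U_left : forall e, e \in U ->
  [/\ (R.+1 < e.1.1)%N, (e.1.1 <= e.1.2)%N, (e.1.2 < C)%N & (e.1.1 + e.1.2 = R + C + 1)%N].
Hypothesis W_right : forall e, e \in W ->
  [/\ (0 < e.1.1 < R)%N, (C.+1 < e.1.2)%N & (e.1.1 + e.1.2 = R + C + 1)%N].
Hypotheses (U_sorted : pairwise row_lt U) (W_sorted : pairwise row_lt W).
Hypothesis ps : forall a b, p = Some a -> s = Some b -> a < b.
Hypothesis qs : forall a b, q = Some a -> s = Some b -> a < b.
Hypothesis s_p : s <> None -> p <> None.
(** For [R = C] the position of [q] lies left of the diagonal, so [s] has no left neighbour
    there. *)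
Hypothesis s_q : s <> None -> q <> None \/ R = C.
Hypothesis q_valid : q <> None -> (R < C)%N.

(* The block [[o p] [q s]] occupies rows [R], [R + 1] and columns [C], [C + 1];
   [U] and [W] continue it along the antidiagonal. *)
Definition block_list o p q s : seq entry :=
  U ++ (entry_of R.+1 C q ++ entry_of R.+1 C.+1 s ++ entry_of R C o ++ entry_of R C.+1 p) ++ W.

Lemma mem_entry_of r c x e : (e \in entry_of r c x) = (e.1 == (r, c)) && (x == Some e.2).
Proof.
case: x => [v|] /=; rewrite ?inE ?andbF //; case: e => [e1 e2] /=.
by rewrite xpair_eqE; congr andb; apply/eqP/eqP => [->|[]].
Qed.

Lemma block_list_sorted o p' q' s' : pairwise row_lt (block_list o p' q' s').
Proof.
have ent r c x : pairwise row_lt (entry_of r c x) by case: x.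
have mid e : e \in entry_of R.+1 C q' ++ entry_of R.+1 C.+1 s' ++ entry_of R C o ++
    entry_of R C.+1 p' -> (R <= e.1.1 <= R.+1)%N.
  rewrite !mem_cat !mem_entry_of.
  by case/or4P => /andP[/eqP -> _]; rewrite ?leqnn ?leqnSn.
rewrite /block_list !pairwise_cat U_sorted W_sorted !ent !andbT /=.
have ltR (e f : entry) : (f.1.1 < e.1.1)%N -> row_lt e f by rewrite /row_lt => ->.
have ltC (e f : entry) : f.1.1 = e.1.1 -> (e.1.2 < f.1.2)%N -> row_lt e f.
  by rewrite /row_lt => -> ->; rewrite eqxx orbT.
repeat (apply/andP; split) => //; apply/allrelP => e f.
- move=> /U_left[h1 _ _ _]; rewrite mem_cat => /orP[/mid/andP[_ h]|/W_right[/andP[_ h] _ _]];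
    apply: ltR; first exact: leq_ltn_trans h h1.
  by apply: (ltn_trans h); apply: ltn_trans h1.
- by move=> /mid/andP[h _] /W_right[/andP[_ h5] _ _]; apply: ltR; exact: leq_trans h.
- rewrite !mem_cat !mem_entry_of => /andP[/eqP e1 _] /or3P[] /andP[/eqP e2 _].
  + by apply: ltC; rewrite e1 e2.
  + by apply: ltR; rewrite e1 e2.
  + by apply: ltR; rewrite e1 e2.
- rewrite !mem_cat !mem_entry_of => /andP[/eqP e1 _] /orP[] /andP[/eqP e2 _];
    by apply: ltR; rewrite e1 e2.
- rewrite !mem_entry_of => /andP[/eqP e1 _] /andP[/eqP e2 _].
  by apply: ltC; rewrite e1 e2.
Qed.

Definition outer r c := [\/ (R.+1 < r)%N /\ (c < C)%N | (r < R)%N /\ (C.+1 < c)%N] /\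
  (r + c = R + C + 1)%N /\ (0 < r <= c)%N.

Definition block o p q s := lookup (block_list o p q s).

Variant block_spec o p q s r c v : Prop :=
| BlockO of r = R & c = C & o = Some v
| BlockP of r = R & c = C.+1 & p = Some v
| BlockQ of r = R.+1 & c = C & q = Some v
| BlockS of r = R.+1 & c = C.+1 & s = Some v
| BlockOuter of outer r c & (r, c, v) \in U ++ W.

Lemma blockP o p' q' s' r c v : block o p' q' s' r c = Some v <-> block_spec o p' q' s' r c v.
Proof.
rewrite /block lookupP; last exact: block_list_sorted.
rewrite /block_list !mem_cat !mem_entry_of; split.
- have out : (r, c, v) \in U ++ W -> block_spec o p' q' s' r c v.
    move=> h; apply: BlockOuter => //; move: h; rewrite mem_cat.
    by case/orP => [/U_left[/= h1 h2 h3 h4]|/W_right[/= h1 h2 h3]]; split; [left; lia|lia|right; lia|lia].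
  case/or3P => [h|/or4P[]|h]; try by (apply: out; rewrite mem_cat h ?orbT).
  + by move=> /andP[/eqP[-> ->] /eqP]; exact: BlockQ.
  + by move=> /andP[/eqP[-> ->] /eqP]; exact: BlockS.
  + by move=> /andP[/eqP[-> ->] /eqP]; exact: BlockO.
  + by move=> /andP[/eqP[-> ->] /eqP]; exact: BlockP.
- case=> [-> -> ->|-> -> ->|-> -> ->|-> -> ->|_]; rewrite /= ?eqxx ?orbT //.
  by rewrite mem_cat => /orP[] ->; rewrite ?orbT.
Qed.

Lemma block_cell o p' q' s' r c x : (forall v, block_spec o p' q' s' r c v <-> x = Some v) ->
  block o p' q' s' r c = x.
Proof.
move=> h; case e: (block _ _ _ _ r c) => [v|]; first by move/blockP/h: e => ->.
by case: x h => // v h; have /blockP := (h v).2 erefl; rewrite e.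
Qed.

Lemma block_cells o p' q' s' : let G := block o p' q' s' in
  [/\ G R C = o, G R C.+1 = p', G R.+1 C = q' & G R.+1 C.+1 = s'].
Proof.
split; apply: block_cell => v; split; try (by move=> ->; constructor);
  by case=> //; rewrite /outer; lia.
Qed.

Lemma block_outside o p' q' s' r c : (R <= r <= R.+1)%N \/ (C <= c <= C.+1)%N ->
  ~ ((R <= r <= R.+1)%N /\ (C <= c <= C.+1)%N) -> block o p' q' s' r c = None.
Proof. by move=> h1 h2; apply: block_cell => v; split=> //; case=> //; rewrite /outer; lia. Qed.

Lemma block_valid o p' q' s' : (q' <> None -> (R < C)%N) -> fill_valid (block o p' q' s').
Proof.
move=> hq r c; case e: (block _ _ _ _ r c) => [v|] // _.
case/blockP: e => [-> -> _|-> -> _|-> -> qE|-> -> _|[_ []] //]; try lia.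
have h : (R < C)%N by apply: hq; rewrite qE.
lia.
Qed.

Let G := block None p q s.
(** Which neighbours move into the empty corner. If [p] and [q] are equal, both do, and [s] then
    takes both of their places. *)
Let pmin := (p != None) && (p == omin p q).
Let qmin := (q != None) && (q == omin p q).
Let smin := (s != None) && (pmin || qmin).
Let F := block (omin p q) (if pmin then s else p) (if qmin then s else q)
  (if smin then None else s).
Let start r c := r = R /\ c = C.
Let vis r c := [\/ r = R /\ c = C, r = R /\ c = C.+1 /\ pmin,
  r = R.+1 /\ c = C /\ qmin | r = R.+1 /\ c = C.+1 /\ smin].

Lemma block_dom r c : slide_dom G start r c <->
  [\/ r = R /\ c = C, r = R /\ c = C.+1 /\ p <> None,
   r = R.+1 /\ c = C /\ q <> None | r = R.+1 /\ c = C.+1 /\ s <> None] \/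
  G r c <> None /\ outer r c.
Proof.
have [g1 g2 g3 g4] := block_cells None p q s; rewrite -/G in g1 g2 g3 g4.
split.
- case=> [[-> ->]|]; first by left; apply: Or41.
  case e: (G r c) => [v|] // h; case/blockP: (e) => // [-> -> ->|-> -> ->|-> -> ->|o _].
  + by left; apply: Or42.
  + by left; apply: Or43.
  + by left; apply: Or44.
  + by right.
- case=> [[[-> ->]|[-> [-> h]]|[-> [-> h]]|[-> [-> h]]]|[h _]].
  + by left.
  + by right; rewrite g2.
  + by right; rewrite g3.
  + by right; rewrite g4.
  + by right.
Qed.

(** Boxes outside the block lie on one antidiagonal and are incomparable to each other and to the
    block, so convexity and minimality are questions about the block alone. *)
Lemma block_corner : corner_set G start.
Proof.
have dpos r c : slide_dom G start r c ->
    ((R <= r <= R.+1)%N /\ (C <= c <= C.+1)%N) \/ outer r c.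
  move=> /block_dom[[[-> ->]|[-> [-> _]]|[-> [-> _]]|[-> [-> _]]]|[_ o]]; last by right.
  - by left; rewrite !leqnn !leqnSn.
  - by left; rewrite !leqnn !leqnSn.
  - by left; rewrite !leqnn !leqnSn.
  - by left; rewrite !leqnn !leqnSn.
have [g1 g2 g3 g4] := block_cells None p q s; rewrite -/G in g1 g2 g3 g4.
split.
- by move=> r c [-> ->].
- by exists C.+1 => r c [_ ->].
- move=> r1 c1 r2 c2 r3 c3 d1 d3 h1 h2 h3.
  have [[-> ->]|ne1] := pselect (r2 = r1 /\ c2 = c1); first exact: d1.
  have [[-> ->]|ne3] := pselect (r2 = r3 /\ c2 = c3); first exact: d3.
  have [b1 b3] : ((R <= r1 <= R.+1)%N /\ (C <= c1 <= C.+1)%N) /\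
      ((R <= r3 <= R.+1)%N /\ (C <= c3 <= C.+1)%N).
    have [b1|[o1 [o1' o1'']]] := dpos _ _ d1; have [b3|[o3 [o3' o3'']]] := dpos _ _ d3.
    - by [].
    - by exfalso; clear -b1 o3 o3' h1 h2; case: o3; lia.
    - by exfalso; clear -b3 o1 o1' h1 h2; case: o1; lia.
    - by exfalso; clear -o3 o3' o1 o1' h1 h2 ne1; case: o1; case: o3; lia.
  have [e1 e2] : r3 = R.+1 /\ c3 = C.+1 by lia.
  have ns : s <> None by case: d3 => [[]|]; rewrite /start ?e1 ?e2 ?g4 //; lia.
  have [e3 e4] : r1 = R /\ c1 = C by lia.
  apply/block_dom; left; have [[r2E c2E]|[r2E c2E]] : r2 = R /\ c2 = C.+1 \/ r2 = R.+1 /\ c2 = C by lia.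
    by apply: Or42; do !split=> //; exact: s_p.
  apply: Or43; do !split=> //; case: (s_q ns) => // RCE.
  by rewrite r2E c2E RCE ltnn in h3.
- move=> r c r' c' [-> ->] /dpos[b|[o [o' _]]] h1 h2.
    by clear -b h1 h2; lia.
  by exfalso; clear -o o' h1 h2; case: o; lia.
- by move=> r c [-> ->].
Qed.

Lemma block_inc : fill_inc G.
Proof.
move=> r1 c1 r2 c2 a b /blockP h1 /blockP h2 rr cc lt.
case: h1 => [//|e1 e2 x|e1 e2 x|e1 e2 x|[o1 [o1' _]] x];
  case: h2 => [//|e3 e4 y|e3 e4 y|e3 e4 y|[o2 [o2' _]] y].
- by exfalso; clear -rr cc lt e1 e2 e3 e4; lia.
- by exfalso; clear -rr cc lt e1 e2 e3 e4; lia.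
- exact: ps x y.
- by exfalso; clear -rr cc lt e1 e2 o2 o2'; case: o2; lia.
- by exfalso; clear -rr cc lt e1 e2 e3 e4; lia.
- by exfalso; clear -rr cc lt e1 e2 e3 e4; lia.
- exact: qs x y.
- by exfalso; clear -rr cc lt e1 e2 o2 o2'; case: o2; lia.
- by exfalso; clear -rr cc lt e1 e2 e3 e4; lia.
- by exfalso; clear -rr cc lt e1 e2 e3 e4; lia.
- by exfalso; clear -rr cc lt e1 e2 e3 e4; lia.
- by exfalso; clear -rr cc lt e1 e2 o2 o2'; case: o2; lia.
- by exfalso; clear -rr cc lt e3 e4 o1 o1'; case: o1; lia.
- by exfalso; clear -rr cc lt e3 e4 o1 o1'; case: o1; lia.
- by exfalso; clear -rr cc lt e3 e4 o1 o1'; case: o1; lia.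
- by exfalso; clear -rr cc lt o1 o1' o2 o2'; case: o1; case: o2; lia.
Qed.

Lemma block_slides : slides_to G start F.
Proof.
have [g1 g2 g3 g4] := block_cells None p q s; rewrite -/G in g1 g2 g3 g4.
have [f1 f2 f3 f4] := block_cells (omin p q) (if pmin then s else p) (if qmin then s else q)
  (if smin then None else s); rewrite -/F in f1 f2 f3 f4.
have out r c : (R <= r <= R.+1)%N \/ (C <= c <= C.+1)%N ->
  ~ ((R <= r <= R.+1)%N /\ (C <= c <= C.+1)%N) -> G r c = None by exact: block_outside.
have m1 : slide_min G R C = omin p q by rewrite /slide_min g2 g3.
have m2 : slide_min G R C.+1 = s by rewrite /slide_min g4 (out R C.+2) //; clear; lia.
have m3 : slide_min G R.+1 C = s.
  rewrite /slide_min g4 (out R.+2 C); [by case: (s)|clear; lia|clear; lia].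
have m4 : slide_min G R.+1 C.+1 = None by rewrite /slide_min !out //; clear; lia.
exists vis; split.
- move=> r c; split.
  + case=> [[-> ->]|[-> [-> /andP[h /eqP pE]]]|[-> [-> /andP[h /eqP qE]]]|[-> [-> /andP[h /orP pq]]]].
    * by left.
    * right; case pa: p h => [a|] // _; exists a; first by rewrite g2.
      left; exists C; split=> //; first exact: Or41.
      by rewrite m1 -pE.
    * right; case qa: q h => [a|] // _; exists a; first by rewrite g3.
      right; exists R; split=> //; first exact: Or41.
      by rewrite m1 -qE.
    * right; case sa: s h => [a|] // _; exists a; first by rewrite g4.
      case: pq => h; [right; exists R|left; exists C]; split=> //; rewrite ?m2 ?m3 //.
        by apply: Or42.
      by apply: Or43.
  + case=> [[-> ->]|[x Gx [[j [e v mj]]|[j [e v mj]]]]]; first exact: Or41.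
    * subst c; case: v Gx mj => [[-> ->]|[-> [-> h]]|[-> [-> h]]|[-> [-> h]]].
      - rewrite g2 m1 => pE oE; apply: Or42; do !split=> //.
        by rewrite /pmin oE pE eqxx.
      - rewrite out //; clear; lia.
      - by rewrite g4 => sE _; apply: Or44; do !split=> //; rewrite /smin sE h orbT.
      - rewrite out //; clear; lia.
    * subst r; case: v Gx mj => [[-> ->]|[-> [-> h]]|[-> [-> h]]|[-> [-> h]]].
      - rewrite g3 m1 => qE oE; apply: Or43; do !split=> //.
        by rewrite /qmin oE qE eqxx.
      - by rewrite g4 => sE _; apply: Or44; do !split=> //; rewrite /smin sE h.
      - rewrite out //; clear; lia.
      - rewrite out //; clear; lia.
- move=> r c [[-> ->]|[-> [-> h]]|[-> [-> h]]|[-> [-> h]]].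
  + by rewrite f1 m1.
  + by rewrite f2 m2 h.
  + by rewrite f3 m3 h.
  + by rewrite f4 m4 h.
- move=> r c nv; have {nv}[n1 n2 n3 n4] : [/\ ~ (r = R /\ c = C), r = R -> c = C.+1 -> ~~ pmin,
      r = R.+1 -> c = C -> ~~ qmin & r = R.+1 -> c = C.+1 -> ~~ smin].
    split; [move=> ?; apply: nv; exact: Or41|move=> *; apply/negP => ?; apply: nv; exact: Or42
           |move=> *; apply/negP => ?; apply: nv; exact: Or43
           |move=> *; apply/negP => ?; apply: nv; exact: Or44].
  apply: block_cell => v; split.
  + case=> [e1 e2|e1 e2|e1 e2|e1 e2|o h]; first by case: n1.
    * by rewrite e1 e2 g2 (negPf (n2 e1 e2)).
    * by rewrite e1 e2 g3 (negPf (n3 e1 e2)).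
    * by rewrite e1 e2 g4 (negPf (n4 e1 e2)).
    * by apply/blockP; exact: BlockOuter.
  + move/blockP; case=> // [e1 e2 h|e1 e2 h|e1 e2 h|o h].
    * by apply: BlockP => //; rewrite (negPf (n2 e1 e2)).
    * by apply: BlockQ => //; rewrite (negPf (n3 e1 e2)).
    * by apply: BlockS => //; rewrite (negPf (n4 e1 e2)).
    * exact: BlockOuter.
Qed.

Definition step_jdt w w' := exists T T', [/\ increasing T, increasing T', jdt_equiv T T',
  row_placed T w & row_placed T' w'].

Lemma entry_word r c x : [seq e.2 | e <- entry_of r c x] = opt_seq x.
Proof. by case: x. Qed.

Lemma block_list_word o p' q' s' : [seq e.2 | e <- block_list o p' q' s'] =
  [seq e.2 | e <- U] ++ (opt_seq q' ++ opt_seq s' ++ opt_seq o ++ opt_seq p') ++ [seq e.2 | e <- W].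
Proof. by rewrite /block_list !map_cat !entry_word. Qed.

Lemma block_step :
  step_jdt ([seq e.2 | e <- U] ++ (opt_seq q ++ opt_seq s ++ opt_seq p) ++ [seq e.2 | e <- W])
   ([seq e.2 | e <- U] ++ (opt_seq (if qmin then s else q) ++ opt_seq (if smin then None else s) ++
      opt_seq (omin p q) ++ opt_seq (if pmin then s else p)) ++ [seq e.2 | e <- W]).
Proof.
have Gv : fill_valid G by exact: block_valid.
have Fv : fill_valid F.
  apply: block_valid; case: ifP => // h ns; case: (s_q ns) => [/q_valid //|RCE].
  by move: h; rewrite /qmin => /andP[/eqP/q_valid].
have [TG TGE] := tab_of_fill Gv (lookup_bounded _).
have [TF TFE] := tab_of_fill Fv (lookup_bounded _).
have GE : at_pos TG = G by apply/funext => r; apply/funext => c.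
have FE : at_pos TF = F by apply/funext => r; apply/funext => c.
have incG : increasing TG.
  by apply: increasing_fill; rewrite GE; [exact: block_inc|exact: corner_set_convex block_corner].
have fs : forward_slide TG TF.
  apply/forward_slide_fill; split=> //; exists start; rewrite GE FE; split.
    exact: block_corner.
  exact: block_slides.
have [_ incF] := forward_increasing fs.
exists TG, TF; split=> //.
- by apply: rt_step; left.
- have := @row_placed_list TG (block_list None p q s); rewrite block_list_word /=; apply.
    exact: block_list_sorted.
  by move=> r c v; rewrite TGE /G /block lookupP //; exact: block_list_sorted.
- rewrite -block_list_word; apply: row_placed_list; first exact: block_list_sorted.
  by move=> r c v; rewrite TFE /F /block lookupP //; exact: block_list_sorted.
Qed.

End Block.

(** Going down the antidiagonal, each letter uses up one row and one column; the distance
    [(size u).*2] keeps the last box on or right of the diagonal. *)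
Lemma lower_frame R C u : (R + (size u).*2 < C)%N -> exists U : seq entry,
  [/\ forall e, e \in U -> [/\ (R.+1 < e.1.1)%N, (e.1.1 <= e.1.2)%N, (e.1.2 < C)%N &
        (e.1.1 + e.1.2 = R + C + 1)%N],
      pairwise row_lt U & [seq e.2 | e <- U] = u].
Proof.
move=> RC; pose f i : entry := ((R.+1 + (size u - i))%N, (C - (size u - i))%N, nth 0 u i).
exists (mkseq f (size u)); split.
- by move=> e /mapP[i]; rewrite mem_iota => iu ->; split=> /=; lia.
- by apply: pairwise_mkseq => i j ij; rewrite /row_lt /=; lia.
- by rewrite -map_comp -[RHS](mkseq_nth 0).
Qed.

Lemma upper_frame C v : (size v < C)%N -> exists W : seq entry,
  [/\ forall e, e \in W -> [/\ (0 < e.1.1 < (size v).+1)%N, (C.+1 < e.1.2)%N &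
        (e.1.1 + e.1.2 = (size v).+1 + C + 1)%N],
      pairwise row_lt W & [seq e.2 | e <- W] = v].
Proof.
move=> RC; pose f i : entry := ((size v - i)%N, (C.+2 + i)%N, nth 0 v i).
exists (mkseq f (size v)); split.
- by move=> e /mapP[i]; rewrite mem_iota => iu ->; split=> /=; lia.
- by apply: pairwise_mkseq => i j ij; rewrite /row_lt /=; lia.
- by rewrite -map_comp -[RHS](mkseq_nth 0).
Qed.

Lemma step_jdt_sym w w' : step_jdt w w' -> step_jdt w' w.
Proof. by move=> [T [T' [h1 h2 h3 h4 h5]]]; exists T', T; split=> //; exact: jdt_sym. Qed.

(** If [s] is present, [q] can be missing only on the diagonal, and there the antidiagonal has no
    room for letters before the block. This is how a relation confined to the beginning of the word
    arises. *)
Lemma word_step u v p q s :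
  (forall a b, p = Some a -> s = Some b -> a < b) ->
  (forall a b, q = Some a -> s = Some b -> a < b) ->
  (s <> None -> p <> None) ->
  let pmin := (p != None) && (p == omin p q) in
  let qmin := (q != None) && (q == omin p q) in
  let smin := (s != None) && (pmin || qmin) in
  (q <> None \/ u = [::]) ->
  step_jdt (u ++ (opt_seq q ++ opt_seq s ++ opt_seq p) ++ v)
   (u ++ (opt_seq (if qmin then s else q) ++ opt_seq (if smin then None else s) ++
      opt_seq (omin p q) ++ opt_seq (if pmin then s else p)) ++ v).
Proof.
move=> ps qs sp pmin qmin smin hq; pose R := (size v).+1.
case: (eqVneq q None) => [q0|qn].
  have u0 : u = [::] by case: hq => //; rewrite q0.
  have [|W [W1 W2 <-]] := @upper_frame R v; first by rewrite /R.
  rewrite u0.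
  by apply: (@block_step R R [::] W p q s) => //; rewrite ?leqnn ?q0 //; right.
pose C := (R + (size u).*2).+1.
have [|U [U1 U2 uE]] := @lower_frame R C u; first by rewrite /C.
have [|W [W1 W2 vE]] := @upper_frame C v; first by rewrite /C /R; lia.
rewrite -uE -vE; apply: (@block_step R C U W p q s) => //.
- by rewrite /C; lia.
- by move=> _; left; apply/eqP.
- by rewrite /C; lia.
Qed.

(** An empty block leaves the word alone on an antidiagonal. *)
Lemma word_tableau w : exists2 T, increasing T & row_placed T w.
Proof.
suff [T [_ [incT _ _ pT _]]] : step_jdt w w by exists T.
by apply: (@word_step [::] w None None None) => //; right.
Qed.

Lemma step_jdt_refl w : step_jdt w w.
Proof.
by have [T incT pT] := word_tableau w; exists T, T; split=> //; exact: rt_refl.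
Qed.

(** The blocks [(p, q, s)] are [(a, a, -)] for idempotence, [(a, a, b)] for the braid, [(b, a, c)]
    and [(c, a, b)] for the two Knuth relations, and [(b, -, a)] on the diagonal for the weak one.
    Braid and weak relation are symmetric in the two letters, so one order of these suffices. *)
Lemma weak_KKnuth_step_jdt w w' : weak_KKnuth_step w w' -> step_jdt w w'.
Proof.
have two u v (a : int) : step_jdt (u ++ [:: a; a] ++ v) (u ++ [:: a] ++ v).
  have := @word_step u v (Some a) (Some a) None; rewrite /= minxx eqxx /=; apply=> //.
  by left.
have braid u v (a b : int) : a < b -> step_jdt (u ++ [:: a; b; a] ++ v) (u ++ [:: b; a; b] ++ v).
  move=> ab; have := @word_step u v (Some a) (Some a) (Some b); rewrite /= minxx eqxx /=; apply=> //.
  - by move=> x y [<-] [<-].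
  - by move=> x y [<-] [<-].
  - by left.
have weak u (a b : int) : b < a -> step_jdt ([:: a; b] ++ u) ([:: b; a] ++ u).
  move=> ab; have := @word_step [::] u (Some b) None (Some a); rewrite /= eqxx /=; apply=> //.
  - by move=> x y [<-] [<-].
  - by right.
case=> {w w'} [u v a|u v a b|u v a b c ba ac|u v a b c ac cb|u a b].
- exact: two.
- by case: (ltgtP a b) => [/braid|/braid h|->]; [exact|exact: step_jdt_sym|exact: step_jdt_refl].
- apply: step_jdt_sym; have := @word_step u v (Some b) (Some a) (Some c).
  rewrite /= (min_l (ltW ba)) eqxx /= (_ : (Some a == Some b) = false); last first.
    by apply/eqP => -[e]; rewrite e ltxx in ba.
  apply=> //.
  - by move=> x y [<-] [<-]; exact: lt_trans ac.
  - by move=> x y [<-] [<-].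
  - by left.
- have := @word_step u v (Some c) (Some a) (Some b).
  rewrite /= (min_r (ltW ac)) eqxx /= (_ : (Some c == Some a) = false); last first.
    by apply/eqP => -[e]; rewrite e ltxx in ac.
  apply=> //.
  - by move=> x y [<-] [<-].
  - by move=> x y [<-] [<-]; exact: lt_trans cb.
  - by left.
- by case: (ltgtP a b) => [/weak h|/weak|->]; [exact: step_jdt_sym|exact|exact: step_jdt_refl].
Qed.

(** * The equivalence of the two relations *)

(** Intermediate words are realized by [word_tableau]; which tableau is chosen for a word is
    immaterial by [same_word_jdt]. *)
Lemma weak_KKnuth_jdt w w' T T' : weak_KKnuth w w' -> increasing T -> increasing T' ->
  row_placed T w -> row_placed T' w' -> jdt_equiv T T'.
Proof.
move=> ww; elim: ww T T' => {w w'}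
  [w w' /weak_KKnuth_step_jdt[S [S' [iS iS' SS pS pS']]]|w|w w' _ IH|w1 w2 w3 _ IH1 _ IH2] T T' iT iT' pT pT'.
- apply: (jdt_trans (same_word_jdt iT iS pT pS)); apply: (jdt_trans SS).
  exact: same_word_jdt iS' iT' pS' pT'.
- exact: same_word_jdt pT pT'.
- by apply: jdt_sym; apply: IH.
- have [S iS pS] := word_tableau w2.
  exact: jdt_trans (IH1 _ _ iT iS pT pS) (IH2 _ _ iS iT' pS pT').
Qed.

Theorem theorem7p8 (T T' : tableau) (w w' : seq int)
    (incT : increasing T) (incT' : increasing T')
    (readT : reading_word T w) (readT' : reading_word T' w') :
  weak_KKnuth w w' <-> jdt_equiv T T'.
Proof.
have [n1 r1] := reading_word_fill incT readT; have [n2 r2] := reading_word_fill incT' readT'.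
have [n3 p1] := row_placed_fill_word T; have [n4 p2] := row_placed_fill_word T'.
split=> [ww|TT].
- pose N := (n1 + n2 + n3 + n4)%N.
  apply: (weak_KKnuth_jdt (w := fill_word N (at_pos T)) (w' := fill_word N (at_pos T'))) => //.
  + apply: (wk_trans (wk_sym (kk_wk (r1 N _)))); first by rewrite /N; lia.
    by apply: (wk_trans ww); apply/kk_wk/r2; rewrite /N; lia.
  + by apply: p1; rewrite /N; lia.
  + by apply: p2; rewrite /N; lia.
- have [n5 h] := jdt_weak TT; pose N := (n1 + n2 + n5)%N.
  apply: (wk_trans (kk_wk (r1 N _))); first by rewrite /N; lia.
  apply: (wk_trans (h N _)); first by rewrite /N; lia.
  by apply/wk_sym/kk_wk/r2; rewrite /N; lia.
Qed.
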